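(* There is an algorithm that, given a graph $G$ on $n$ vertices of clique-width $k$, presented by a slick $k$-expression generating it, and given a real interval $I$, computes the number of eigenvalues (counted with multiplicity) of the adjacency matrix $A$ of $G$ that lie in $I$, in time $O(k^3 n)$.
   Context: Graphs are finite, simple, undirected, with at least one vertex. For a positive integer $k$ let $[k]=\{1,\dots,k\}$. A $k$-expression is an expression formed from atoms $i(v)$, unary operations $\eta_{i,j}$ and $\rho_{i\to j}$, and a binary operation $\oplus$, with $i,j\in[k]$, where: $i(v)$ creates a single vertex $v$ with label $i$; $\eta_{i,j}$ (for $i\ne j$) adds all edges not already present between every vertex with label $i$ and every vertex with label $j$; $\rho_{i\to j}$ changes all labels $i$ to $j$; $\oplus$ forms the disjoint union of two labeled graphs. The graph generated is obtained by deleting the labels. The clique-width of $G$ is the smallest $k$ such that $G$ is generated by a $k$-expression. A slick $k$-expression is an expression formed from atoms $i(v)$ (with $i\in[k]$, creating a single vertex $v$ with label $i$) and binary operations $\oplus_{S,L,R}$, where $L,R$ are functions $[k]\to[k]$ and $S\subseteq[k]\times[k]$. For labeled graphs $G,H$ with labels in $[k]$, $G\oplus_{S,L,R}H$ is obtained as follows: take the disjoint union of $G$ and $H$; add edges from every vertex labeled $i$ in $G$ to every vertex labeled $j$ in $H$ for all $(i,j)\in S$; afterwards replace every label $i$ of a vertex of $G$ by $L(i)$ and every label $i$ of a vertex of $H$ by $R(i)$. The graph generated is obtained by deleting the labels. Every graph of clique-width $k$ is generated by some slick $k$-expression. Intervals may be open, closed, half-open, bounded or unbounded, and are given by their endpoints.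 Time is counted as exact arithmetic operations and comparisons on real numbers (unit cost); the constant in $O(\cdot)$ is absolute. *)

(* Defs.v *)
From HB Require Import structures.
From mathcomp Require Import all_boot all_order all_algebra.
From mathcomp Require Import all_classical reals.

Set Implicit Arguments.
Unset Strict Implicit.
Unset Printing Implicit Defensive.

Import Order.TTheory GRing.Theory Num.Theory.

Local Open Scope ring_scope.

Record sgraph := SGraph {
  vert :> finType;
  edge : rel vert;
  edge_sym : symmetric edge;
  edge_irr : irreflexive edge }.

Definition adjacency (R : realType) (G : sgraph) : 'M[R]_#|G| :=
  \matrix_(i, j) (edge (enum_val i : G) (enum_val j))%:R.

(* The sum ranges over the (finite) set of eigenvalues of A in I, each weighted
   by its multiplicity as a root of the characteristic polynomial. *)
Definition num_eigenvalues_in (R : realType) (n : nat) (A : 'M[R]_n)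
    (I : interval R) : nat :=
  (\big[addn/0]_(x \in [set x : R | eigenvalue A x /\ x \in I]%classic)
     mup x (char_poly A))%N.

(** * Labeled graphs and expressions *)

(* The labels [k] = {1, ..., k} are represented by 'I_k = {0, ..., k-1}.
   Labeled graphs are built on concrete vertex types, the disjoint union being
   carried by the sum type; vertex names are immaterial, so an atom carries its
   label only and generation of a graph is up to isomorphism. *)
Record lgraph (k : nat) := LGraph {
  lvert :> finType;
  ledge : rel lvert;
  lab : lvert -> 'I_k }.

Definition lg_single k (i : 'I_k) : lgraph k :=
  @LGraph k unit (fun _ _ => false) (fun _ => i).

Definition lg_eta k (i j : 'I_k) (G : lgraph k) : lgraph k :=
  @LGraph k G
    (fun x y => [|| ledge x y, (lab x == i) && (lab y == j)
                  | (lab x == j) && (lab y == i)])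
    (@lab k G).

Definition lg_rho k (i j : 'I_k) (G : lgraph k) : lgraph k :=
  @LGraph k G (@ledge k G) (fun x => if lab x == i then j else lab x).

Definition lg_union k (G H : lgraph k) : lgraph k :=
  @LGraph k (G + H)%type
    (fun u v => match u, v with
                | inl x, inl y => ledge x y
                | inr x, inr y => ledge x y
                | _, _ => false
                end)
    (fun u => match u with inl x => lab x | inr y => lab y end).

Definition lg_slick k (S : {set 'I_k * 'I_k}) (L R : {ffun 'I_k -> 'I_k})
    (G H : lgraph k) : lgraph k :=
  @LGraph k (G + H)%type
    (fun u v => match u, v with
                | inl x, inl y => ledge x y
                | inr x, inr y => ledge x y
                | inl x, inr y => (lab x, lab y) \in S
                | inr y, inl x => (lab x, lab y) \in S
                end)
    (fun u => match u with inl x => L (lab x) | inr y => R (lab y) end).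

Definition generates k (H : lgraph k) (G : sgraph) : Prop :=
  exists f : H -> G, bijective f /\ forall x y, edge (f x) (f y) = ledge x y.

Inductive kexpr (k : nat) : Type :=
  | KAtom of 'I_k
  | KEta (i j : 'I_k) of i != j & kexpr k
  | KRho of 'I_k & 'I_k & kexpr k
  | KUnion of kexpr k & kexpr k.

Fixpoint kgraph k (e : kexpr k) : lgraph k :=
  match e with
  | KAtom i => lg_single i
  | KEta i j _ e1 => lg_eta i j (kgraph e1)
  | KRho i j e1 => lg_rho i j (kgraph e1)
  | KUnion e1 e2 => lg_union (kgraph e1) (kgraph e2)
  end.

Definition is_clique_width (G : sgraph) (k : nat) : Prop :=
  (exists e : kexpr k, generates (kgraph e) G) /\
  (forall k', (exists e : kexpr k', generates (kgraph e) G) -> (k <= k')%N).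

Inductive sexpr (k : nat) : Type :=
  | SAtom of 'I_k
  | SJoin of {set 'I_k * 'I_k} & {ffun 'I_k -> 'I_k} & {ffun 'I_k -> 'I_k}
      & sexpr k & sexpr k.

Fixpoint sgraph_of k (e : sexpr k) : lgraph k :=
  match e with
  | SAtom i => lg_single i
  | SJoin Sx L R e1 e2 => lg_slick Sx L R (sgraph_of e1) (sgraph_of e2)
  end.

(** * Real RAM programs *)

(* A program is a finite piece of syntax, independent of the input.  It works
   on natural-number and real scalar variables and on (infinite) natural-number
   and real arrays, all of them named by naturals.  Array indices are naturals;
   real numbers are accessible only through +, -, *, / and comparisons (no
   rounding), and the only real constants are 0 and 1. *)
Inductive iexp : Type :=
  | IConst of nat
  | IVar of nat
  | ILoad of nat & iexp            (* array name, index *)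
  | IAdd of iexp & iexp
  | ISub of iexp & iexp            (* truncated *)
  | IMul of iexp & iexp.

Inductive rexp : Type :=
  | RZero
  | ROne
  | RVar of nat
  | RLoad of nat & iexp
  | RAdd of rexp & rexp
  | RSub of rexp & rexp
  | RMul of rexp & rexp
  | RDiv of rexp & rexp.           (* x / 0 = 0 *)

Inductive bexp : Type :=
  | BIEq of iexp & iexp
  | BILt of iexp & iexp
  | BREq of rexp & rexp
  | BRLt of rexp & rexp
  | BNot of bexp
  | BAnd of bexp & bexp.

Inductive cmd : Type :=
  | CSkip
  | CISet of nat & iexp
  | CIStore of nat & iexp & iexp   (* array name, index, value *)
  | CRSet of nat & rexp
  | CRStore of nat & iexp & rexp
  | CSeq of cmd & cmd
  | CIf of bexp & cmd & cmd
  | CWhile of bexp & cmd.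

Record state (R : Type) := State {
  ivar : nat -> nat;
  iarr : nat -> nat -> nat;
  rvar : nat -> R;
  rarr : nat -> nat -> R }.

Definition upd (T : Type) (f : nat -> T) (a : nat) (v : T) : nat -> T :=
  fun b => if b == a then v else f b.

Definition upd2 (T : Type) (f : nat -> nat -> T) (a p : nat) (v : T) :=
  upd f a (upd (f a) p v).

Section Semantics.
Variable R : realType.
Implicit Type s : state R.

Fixpoint ieval s (e : iexp) : nat :=
  match e with
  | IConst c => c
  | IVar x => ivar s x
  | ILoad a e1 => iarr s a (ieval s e1)
  | IAdd e1 e2 => (ieval s e1 + ieval s e2)%N
  | ISub e1 e2 => (ieval s e1 - ieval s e2)%N
  | IMul e1 e2 => (ieval s e1 * ieval s e2)%N
  end.

Fixpoint reval s (e : rexp) : R :=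
  match e with
  | RZero => 0
  | ROne => 1
  | RVar x => rvar s x
  | RLoad a e1 => rarr s a (ieval s e1)
  | RAdd e1 e2 => reval s e1 + reval s e2
  | RSub e1 e2 => reval s e1 - reval s e2
  | RMul e1 e2 => reval s e1 * reval s e2
  | RDiv e1 e2 => reval s e1 / reval s e2
  end.

Fixpoint beval s (b : bexp) : bool :=
  match b with
  | BIEq e1 e2 => ieval s e1 == ieval s e2
  | BILt e1 e2 => (ieval s e1 < ieval s e2)%N
  | BREq e1 e2 => reval s e1 == reval s e2
  | BRLt e1 e2 => reval s e1 < reval s e2
  | BNot b1 => ~~ beval s b1
  | BAnd b1 b2 => beval s b1 && beval s b2
  end.

(* Evaluating an expression costs one unit per node, so each arithmetic
   operation, comparison and memory access, on reals or on naturals, is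
   charged one unit. *)
Fixpoint icost (e : iexp) : nat :=
  match e with
  | IConst _ | IVar _ => 1
  | ILoad _ e1 => (icost e1).+1
  | IAdd e1 e2 | ISub e1 e2 | IMul e1 e2 => (icost e1 + icost e2).+1
  end.

Fixpoint rcost (e : rexp) : nat :=
  match e with
  | RZero | ROne | RVar _ => 1
  | RLoad _ e1 => (icost e1).+1
  | RAdd e1 e2 | RSub e1 e2 | RMul e1 e2 | RDiv e1 e2 =>
      (rcost e1 + rcost e2).+1
  end.

Fixpoint bcost (b : bexp) : nat :=
  match b with
  | BIEq e1 e2 | BILt e1 e2 => (icost e1 + icost e2).+1
  | BREq e1 e2 | BRLt e1 e2 => (rcost e1 + rcost e2).+1
  | BNot b1 => (bcost b1).+1
  | BAnd b1 b2 => (bcost b1 + bcost b2).+1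
  end.

Definition set_ivar s x v := State (upd (ivar s) x v) (iarr s) (rvar s) (rarr s).
Definition set_iarr s a p v :=
  State (ivar s) (upd2 (iarr s) a p v) (rvar s) (rarr s).
Definition set_rvar s x v := State (ivar s) (iarr s) (upd (rvar s) x v) (rarr s).
Definition set_rarr s a p v :=
  State (ivar s) (iarr s) (rvar s) (upd2 (rarr s) a p v).

(* [exec c s s' t]: started in s, the command c halts in s' after t time
   units. *)
Inductive exec : cmd -> state R -> state R -> nat -> Prop :=
  | ExSkip s : exec CSkip s s 1
  | ExISet s x e : exec (CISet x e) s (set_ivar s x (ieval s e)) (icost e).+1
  | ExIStore s a p e :
      exec (CIStore a p e) s (set_iarr s a (ieval s p) (ieval s e))
           (icost p + icost e).+1
  | ExRSet s x e : exec (CRSet x e) s (set_rvar s x (reval s e)) (rcost e).+1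
  | ExRStore s a p e :
      exec (CRStore a p e) s (set_rarr s a (ieval s p) (reval s e))
           (icost p + rcost e).+1
  | ExSeq c1 c2 s1 s2 s3 t1 t2 :
      exec c1 s1 s2 t1 -> exec c2 s2 s3 t2 ->
      exec (CSeq c1 c2) s1 s3 (t1 + t2)
  | ExIf b c1 c2 s s' t :
      exec (if beval s b then c1 else c2) s s' t ->
      exec (CIf b c1 c2) s s' (bcost b + t).+1
  | ExWhileF b c s : ~~ beval s b -> exec (CWhile b c) s s (bcost b).+1
  | ExWhileT b c s1 s2 s3 t1 t2 :
      beval s1 b -> exec c s1 s2 t1 -> exec (CWhile b c) s2 s3 t2 ->
      exec (CWhile b c) s1 s3 (bcost b + t1 + t2).+1.

End Semantics.

(** * Input and output conventions *)

(* Postfix encoding: an atom with label i is written 0, i; an operation is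
   written after its two operands as 1, then the k * k membership bits of S in
   row-major order, then the values of L, then those of R. *)
Fixpoint encode k (e : sexpr k) : seq nat :=
  match e with
  | SAtom i => [:: 0%N; val i]
  | SJoin Sx L R e1 e2 =>
      encode e1 ++ encode e2 ++
      1%N :: [seq nat_of_bool ((i, j) \in Sx) | i <- enum 'I_k, j <- enum 'I_k]
          ++ [seq val (L i) | i <- enum 'I_k]
          ++ [seq val (R i) | i <- enum 'I_k]
  end.

(* In mathcomp's intervals, [BLeft x] is the endpoint in `[x, ..  or .., x[ and
   [BRight x] the endpoint in `]x, .. or .., x]; [BInfty _ true] is -oo and
   [BInfty _ false] is +oo. *)
Definition bound_kind (R : realType) (b : itv_bound R) : nat :=
  match b with
  | BSide true _ => 0
  | BSide false _ => 1
  | BInfty true => 2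
  | BInfty false => 3
  end.

Definition bound_value (R : realType) (b : itv_bound R) : R :=
  match b with BSide _ x => x | BInfty _ => 0 end.

(* Natural variables 0, 1, 2, 3 hold k, the number n of vertices and the kinds
   of the two endpoints of I; real variables 0 and 1 hold the values of these
   endpoints; natural array 0 holds the encoded expression.  All other cells
   are 0. *)
Definition input_state (R : realType) (k n : nat) (e : sexpr k)
    (I : interval R) : state R :=
  let: Interval l u := I in
  State (nth 0%N [:: k; n; bound_kind l; bound_kind u])
        (fun a => if a == 0%N then nth 0%N (encode e) else fun _ => 0%N)
        (nth 0 [:: bound_value l; bound_value u])
        (fun _ _ => 0).

Definition output (R : realType) (s : state R) : nat := ivar s 0.

(* Main.v *)
Require Import Defs.
From mathcomp Require Import all_boot all_order all_algebra.
From mathcomp Require Import all_classical reals.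
From mathcomp Require Import ring lra zify.
From mathcomp Require Import complex.

(* Counting the eigenvalues of A below c amounts to computing the negative
   index of the quadratic form A - c, and those above c to that of c - A.
   For a subexpression with vertex space V, form q and vector l(v) of label
   sums, the rest of the graph sees v only through z = l(v).  Up to splitting
   off directions whose contribution to the index is known, q(v) can therefore
   be replaced, in any context, by a form 2 w.(A z) + z.(T z) with k x k
   matrices A and T: an energy T on the label sums z satisfying the
   constraints A z = 0, with w as Lagrange multipliers.
   A join of two such pairs is a form in 6k variables w1, z1, w2, z2, y, z,
   where y enforces z = L z1 + R z2.  Symmetric elimination of the first 5k
   variables, O(k) pivots costing O(k^2) each, leaves the residual form
   2 x.(Y z) + z.(T z), and Y may be replaced by the k x k matrix Y^T Y, which
   has the same kernel over the reals. *)

Set Implicit Arguments.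
Unset Strict Implicit.
Unset Printing Implicit Defensive.

Import Order.TTheory GRing.Theory Num.Theory.

Local Open Scope ring_scope.

(** * Negative index *)

(** The index sees strict inequalities only, so null directions may be added or dropped freely.
    Hence nothing goes wrong when [c] is itself an eigenvalue or when multipliers are redundant, and
    the 5k multipliers left by a join may be traded for k; without this compression the pairs would
    grow at every join.

    Elimination cannot remove everything: variables whose mutual block has become zero offer no
    pivot among themselves, and [z] must not be pivoted on, because the still unknown context is
    coupled to it. What remains of the eliminated variables therefore turns into new constraints on
    [z].

    The price of multipliers is bookkeeping. A constraint paired with its multiplier is a hyperbolic
    plane and has exactly one negative direction. An atom introduces k - 1 such planes and a join k
    of them, so the surplus n(k - 1) + (n - 1)k depends on n and k alone and is subtracted once, at
    the very end. *)

Section NegativeIndex.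
Variable R : realType.

(* F is not required to be a quadratic form: everything about a context that an
   elimination step does not touch can be left arbitrary. *)
Definition has_neg_space (V : lmodType R) (F : V -> R) (m : nat) :=
  exists2 f : 'rV[R]_m -> V, linear f & forall t, t != 0 -> F (f t) < 0.

(** As [F] is arbitrary, [F 0 = 0] has to be demanded: it makes every witness [f] injective, whereas
    for [F 0 < 0] the zero map would witness every dimension. *)
Definition neg_index (V : lmodType R) (F : V -> R) (N : nat) :=
  [/\ F 0 = 0, has_neg_space F N & forall m, has_neg_space F m -> (m <= N)%N].

Lemma linear_funD (U V : lmodType R) (f : U -> V) x y :
  linear f -> f (x + y) = f x + f y.
Proof. by move=> lf; have := lf 1 x y; rewrite !scale1r. Qed.

Lemma linear_fun0 (U V : lmodType R) (f : U -> V) : linear f -> f 0 = 0.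
Proof.
move=> lf; apply: (addrI (f 0)).
by rewrite addr0 -[RHS](congr1 f (addr0 0)) linear_funD.
Qed.

Lemma linear_funZ (U V : lmodType R) (f : U -> V) a x :
  linear f -> f (a *: x) = a *: f x.
Proof. by move=> lf; have := lf a x 0; rewrite addr0 linear_fun0 // addr0. Qed.

Lemma linear_funB (U V : lmodType R) (f : U -> V) x y :
  linear f -> f (x - y) = f x - f y.
Proof. by move=> lf; rewrite linear_funD // -scaleN1r linear_funZ // scaleN1r. Qed.

Lemma linear_fun_comp (U V W : lmodType R) (f : U -> V) (g : V -> W) :
  linear f -> linear g -> linear (fun x => g (f x)).
Proof. by move=> lf lg a x y; rewrite lf lg. Qed.

Lemma has_neg_space0 (V : lmodType R) (F : V -> R) : has_neg_space F 0.
Proof.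
exists (fun=> 0) => [a x y | t]; first by rewrite scaler0 addr0.
by rewrite thinmx0 eqxx.
Qed.

Lemma has_neg_space_pull (V W : lmodType R) (h : V -> W) (F : V -> R) (F' : W -> R) m :
  linear h -> (forall v, F' (h v) <= F v) -> has_neg_space F m -> has_neg_space F' m.
Proof.
move=> lh le_F [f lf Ff]; exists (fun t => h (f t)); first exact: linear_fun_comp.
by move=> t t0; apply: le_lt_trans (le_F _) (Ff t t0).
Qed.

Lemma neg_index_iff (V W : lmodType R) (F : V -> R) (F' : W -> R) N :
  (F 0 = 0 -> F' 0 = 0) -> (forall m, has_neg_space F m <-> has_neg_space F' m) ->
  neg_index F N -> neg_index F' N.
Proof.
move=> e eqF [F0 FN maxF]; split; [exact: e| exact/eqF |].
by move=> m /eqF /maxF.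
Qed.

(** [h] and [h'] need not be inverse to each other: each carries negative subspaces of one form to
    negative subspaces of the other. So [V] and [W] may differ by null directions. *)
Lemma neg_index_equiv (V W : lmodType R) (F : V -> R) (F' : W -> R)
    (h : V -> W) (h' : W -> V) N :
  linear h -> linear h' -> (forall v, F' (h v) = F v) ->
  (forall w, F (h' w) = F' w) -> neg_index F N -> neg_index F' N.
Proof.
move=> lh lh' hF hF'; apply: neg_index_iff => [F0 | m].
  by rewrite -(linear_fun0 lh) hF.
split; [apply: (has_neg_space_pull lh) | apply: (has_neg_space_pull lh')] => v.
  by rewrite hF.
by rewrite hF'.
Qed.

Lemma neg_index_eq (V : lmodType R) (F F' : V -> R) N :
  (forall v, F v = F' v) -> neg_index F N -> neg_index F' N.
Proof. by move=> eqF; apply: (@neg_index_equiv _ _ _ _ id id) => // v; rewrite eqF. Qed.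

Lemma neg_index_zero (V : lmodType R) (F : V -> R) :
  (forall v, F v = 0) -> neg_index F 0.
Proof.
move=> F0; split=> [||m [f lf fF]]; [exact: F0 | exact: has_neg_space0 |].
case: m f lf fF => // m f lf fF.
suff /fF : const_mx 1 != 0 :> 'rV[R]_m.+1 by rewrite F0 ltxx.
by apply/eqP => /rowP /(_ ord0); rewrite !mxE => /eqP; rewrite oner_eq0.
Qed.

Lemma linear_mulmxE m (V : lmodType R) (f : 'rV[R]_m -> V) :
  linear f -> forall t, f t = \sum_i t 0 i *: f (delta_mx 0 i).
Proof.
move=> lf t; rewrite {1}[t]row_sum_delta.
elim/big_ind2: _ => [|x x' y y' <- <-|i _]; first exact: linear_fun0.
  exact: linear_funD.
by rewrite linear_funZ.
Qed.

(** [p] linear conditions leave at least [m] of [m + p] dimensions, and the inequality between the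
    forms is needed only there. Upper bounds on an index come from this count. *)
Lemma has_neg_space_ker (V : lmodType R) (F F' : V -> R) p m (h : V -> 'rV[R]_p) :
  linear h -> (forall v, h v = 0 -> F' v <= F v) ->
  has_neg_space F (m + p) -> has_neg_space F' m.
Proof.
move=> lh le_F [f lf Ff].
pose H : 'M[R]_(m + p, p) := \matrix_(i < m + p) h (f (delta_mx 0 i)).
have hfE t : h (f t) = t *m H.
  rewrite (linear_mulmxE (linear_fun_comp lf lh)) mulmx_sum_row.
  by apply: eq_bigr => i _; rewrite rowK.
have rk : (m <= \rank (kermx H))%N.
  by rewrite mxrank_ker leq_subRL ?rank_leq_row // addnC leq_add2l rank_leq_col.
have [B BH Bfree] : exists2 B : 'M[R]_(m, m + p), B *m H = 0 & row_free B.
  (* [pid_mx m] keeps the first [m] rows of a basis of the kernel. *)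
  pose B := row_base (kermx H).
  exists (pid_mx m *m B).
    rewrite -mulmxA; suff -> : B *m H = 0 by rewrite mulmx0.
    by apply/eqP; rewrite -sub_kermx eq_row_base.
  by rewrite /row_free mxrankMfree ?row_base_free // rank_pid_mx.
exists (fun t => f (t *m B)) => [a x y|t t0].
  by rewrite mulmxDl -scalemxAl lf.
have tB0 : t *m B != 0.
  by apply: contraNneq t0 => tB; rewrite -[t](mulmxKp Bfree) tB mul0mx.
by apply: le_lt_trans (le_F _ _) (Ff _ tB0); rewrite hfE -mulmxA BH mulmx0.
Qed.

(* Completing the square in the direction [e]. *)
Lemma has_neg_space_pivot (V : lmodType R) (F : V -> R) (l : V -> R) (e : V) (d : R) m :
  scalar l -> d != 0 -> l e = d -> F 0 = 0 ->
  (forall v s, F (v + s *: e) = F v + s * l v *+ 2 + s ^+ 2 * d) ->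
  has_neg_space F (m + (d < 0)%R) <-> has_neg_space (fun v => F v - l v ^+ 2 / d) m.
Proof.
move=> ll d0 le F0 Fe; split.
  (* A negative pivot costs the single condition [l v = 0], under which both forms agree; for a
     positive pivot, subtracting the square only lowers the form. *)
  case: ltP => [dlt|dge].
    apply: (has_neg_space_ker (h := fun v => l v *: const_mx 1 : 'rV[R]_1)).
      by move=> a x y; rewrite ll scalerDl scalerA.
    move=> v /rowP/(_ ord0); rewrite !mxE mulr1 => ->.
    by rewrite expr0n mul0r subr0.
  rewrite addn0; apply: (@has_neg_space_pull _ _ id) => // v.
  by rewrite gerBl divr_ge0 // sqr_ge0.
case=> f lf Ff.
(* Projection along [e] onto the kernel of [l]. There [F] takes the values of the reduced form, and
   [e] is orthogonal to it, hence one more negative direction when [d < 0]. *)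
pose f1 t := f t - (l (f t) / d) *: e.
have lR : linear (l : V -> R^o) by exact: ll.
have lf1 : linear f1.
  move=> a x y; rewrite /f1 lf ll mulrDl scalerDl opprD scalerBr addrACA.
  by congr (_ - _ + _); rewrite -mulrA; apply/esym/scalerA.
have lf10 t : l (f1 t) = 0.
  by rewrite /f1 [l _](linear_funB _ _ lR) (linear_funZ _ _ lR) le [_ *: _]divfK // subrr.
have Ff1 t s : F (f1 t + s *: e) = (F (f t) - l (f t) ^+ 2 / d) + s ^+ 2 * d.
  rewrite Fe lf10 mulr0 mul0rn addr0 /f1 -scaleNr Fe.
  by field.
have Ff1_lt t : t != 0 -> F (f1 t) < 0.
  by move=> t0; have := Ff1 t 0; rewrite scale0r addr0 expr0n mul0r addr0 => ->; apply: Ff.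
case: ltP => [dlt|dge]; last by rewrite addn0; exists f1.
exists (fun t => f1 (lsubmx t) + (rsubmx t) 0 0 *: e) => [a x y|t t0].
  rewrite !linearP lf1 /= !mxE.
  by rewrite scalerDl -scalerA addrACA -scalerDr.
rewrite Ff1; have [l0|l0] := eqVneq (lsubmx t) 0; last first.
  by apply: ltr_wnDr; [rewrite mulr_ge0_le0 ?sqr_ge0 // ltW | exact: Ff].
rewrite l0 (linear_fun0 lf) F0 (linear_fun0 lR) expr0n mul0r subr0 add0r.
rewrite nmulr_llt0 // exprn_even_gt0 //=.
apply: contraNneq t0 => r0; rewrite -[t]hsubmxK l0.
suff -> : rsubmx t = 0 by rewrite row_mx0.
by apply/matrixP => i j; rewrite !ord1 r0 mxE.
Qed.

Lemma neg_index_pivot (V : lmodType R) (F : V -> R) (l : V -> R) (e : V) (d : R) N :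
  scalar l -> d != 0 -> l e = d ->
  (forall v s, F (v + s *: e) = F v + s * l v *+ 2 + s ^+ 2 * d) ->
  neg_index (fun v => F v - l v ^+ 2 / d) N -> neg_index F (N + (d < 0)%R).
Proof.
move=> ll d0 le Fe [F0 FN Fmax].
have lR : linear (l : V -> R^o) by exact: ll.
have {}F0 : F 0 = 0.
  by move: F0; rewrite (linear_fun0 lR) expr0n mul0r subr0.
have piv m := has_neg_space_pivot m ll d0 le F0 Fe.
split=> // [|m Fm]; first exact/piv.
have [le_dm|] := leqP (d < 0)%R m; last by move/ltnW/leq_trans; apply; exact: leq_addl.
by rewrite -(subnK le_dm) leq_add2r; apply/Fmax/piv; rewrite subnK.
Qed.

Definition dotv p (x y : 'rV[R]_p) : R := \sum_i x 0 i * y 0 i.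

(** The antidiagonal [x = -y] supplies [p] extra negative directions, and on the diagonal [x = y],
    of codimension [p], [F'] dominates [F]. So [p] hyperbolic planes raise the index by exactly [p],
    whatever [F] is. *)
Lemma neg_index_planes (V : lmodType R) (F : V -> R) p N
    (F' : 'rV[R]_p * ('rV[R]_p * V) -> R) :
  (forall x y v, F' (x, (y, v)) = dotv x y *+ 2 + F v) ->
  neg_index F' N -> exists2 N', N = (N' + p)%N & neg_index F N'.
Proof.
move=> F'E [F'0 F'N F'max].
have F0 : F 0 = 0.
  by move: F'0; rewrite F'E /dotv big1 => [|i _]; rewrite ?mxE ?mul0r // mul0rn add0r.
have lift m : has_neg_space F m -> has_neg_space F' (m + p).
  case=> f lf Ff.
  exists (fun t => (- rsubmx t, (rsubmx t, f (lsubmx t)))) => [a x y|t t0].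
    by rewrite !linearP lf.
  rewrite F'E; have -> : dotv (- rsubmx t) (rsubmx t) = - \sum_i (rsubmx t) 0 i ^+ 2.
    by rewrite /dotv -sumrN; apply: eq_bigr => i _; rewrite !mxE; ring.
  have s_ge0 : 0 <= \sum_i (rsubmx t) 0 i ^+ 2 by apply: sumr_ge0 => i _; exact: sqr_ge0.
  have [l0|l0] := eqVneq (lsubmx t) 0; last first.
    have := Ff _ l0; lra.
  rewrite l0 (linear_fun0 lf) F0.
  suff : 0 < \sum_i (rsubmx t) 0 i ^+ 2 by lra.
  rewrite lt0r s_ge0 andbT; apply: contraNneq t0 => /eqP.
  rewrite psumr_eq0 => [/allP r0|i _]; last exact: sqr_ge0.
  rewrite -[t]hsubmxK l0; suff -> : rsubmx t = 0 by rewrite row_mx0.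
  apply/rowP => i; have := r0 i (mem_index_enum _); rewrite sqrf_eq0 => /eqP ->.
  by rewrite mxE.
have drop m : has_neg_space F' (m + p) -> has_neg_space F m.
  case=> f lf Ff.
  have : has_neg_space (fun v : 'rV[R]_p * ('rV[R]_p * V) => F v.2.2) m.
    apply: (@has_neg_space_ker _ F' _ p m (fun v => v.1 - v.2.1)); last by exists f.
      by move=> a [x [y v]] [x' [y' v']] /=; rewrite scalerBr addrACA opprD.
    move=> [x [y v]] /= /eqP; rewrite subr_eq0 => /eqP ->.
    rewrite F'E lerDr mulrn_wge0 //; apply: sumr_ge0 => i _.
    by rewrite -expr2 sqr_ge0.
  by apply: (@has_neg_space_pull _ _ (fun v => v.2.2)).
have le_pN : (p <= N)%N by have := F'max _ (lift 0%N (has_neg_space0 _)).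
exists (N - p)%N; first by rewrite subnK.
split=> // [|m /lift/F'max]; last by rewrite leq_subRL // addnC.
by apply: drop; rewrite subnK.
Qed.

(** * Gram matrices and dot products *)

Lemma mulmx_trl_eq0 m n (A : 'M[R]_(m, n)) : A^T *m A = 0 -> A = 0.
Proof.
move=> A0; apply/matrixP => i j; rewrite mxE; apply/eqP.
have /matrixP/(_ j j) := A0; rewrite !mxE => /eqP.
under eq_bigr do rewrite mxE -expr2.
rewrite psumr_eq0 => [/allP/(_ i (mem_index_enum _))|k _]; last exact: sqr_ge0.
by rewrite sqrf_eq0.
Qed.

(** If [A^T A C = 0] then [(A C)^T (A C) = 0], and a real matrix with zero Gram matrix vanishes.
    This is where the field has to be ordered. *)
Lemma sub_gram m n (A : 'M[R]_(m, n)) : (A <= A^T *m A)%MS.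
Proof.
rewrite submxE; set C := cokermx _; apply/eqP/mulmx_trl_eq0.
by rewrite trmx_mul -!mulmxA (mulmxA A^T) mulmx_coker mulmx0.
Qed.

Lemma dotvE p (x y : 'rV[R]_p) : dotv x y = (x *m y^T) 0 0.
Proof. by rewrite mxE; apply: eq_bigr => i _; rewrite mxE. Qed.

Lemma dotvC p (x y : 'rV[R]_p) : dotv x y = dotv y x.
Proof. by apply: eq_bigr => i _; rewrite mulrC. Qed.

Lemma dotvDl p (x y z : 'rV[R]_p) : dotv (x + y) z = dotv x z + dotv y z.
Proof. by rewrite -big_split; apply: eq_bigr => i _; rewrite mxE mulrDl. Qed.

Lemma dotvZl p a (x z : 'rV[R]_p) : dotv (a *: x) z = a * dotv x z.
Proof. by rewrite mulr_sumr; apply: eq_bigr => i _; rewrite mxE mulrA. Qed.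

Lemma dotvNl p (x z : 'rV[R]_p) : dotv (- x) z = - dotv x z.
Proof. by rewrite -scaleN1r dotvZl mulN1r. Qed.

Lemma dotvDr p (x y z : 'rV[R]_p) : dotv z (x + y) = dotv z x + dotv z y.
Proof. by rewrite !(dotvC z) dotvDl. Qed.

Lemma dotvNr p (x z : 'rV[R]_p) : dotv z (- x) = - dotv z x.
Proof. by rewrite !(dotvC z) dotvNl. Qed.

Lemma dotv_mulmx p q (x : 'rV[R]_p) (y : 'rV[R]_q) (A : 'M[R]_(p, q)) :
  dotv (x *m A) y = \sum_i \sum_j A i j * x 0 i * y 0 j.
Proof.
rewrite exchange_big; apply: eq_bigr => j _; rewrite mxE mulr_suml.
by apply: eq_bigr => i _; rewrite (mulrC (x 0 i)).
Qed.

(* Only the constraints [Y z = 0] matter, and [Y^T Y] has the same kernel as [Y]. *)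
Lemma neg_index_gram m p (V : lmodType R) (Y : 'M[R]_(m, p)) (z : V -> 'rV[R]_p)
    (F : V -> R) N :
  neg_index (fun u : 'rV[R]_p * V => dotv (u.1 *m (Y^T *m Y)) (z u.2) *+ 2 + F u.2) N ->
  neg_index (fun u : 'rV[R]_m * V => dotv (u.1 *m Y) (z u.2) *+ 2 + F u.2) N.
Proof.
(* [D] writes [Y] as a multiple of its Gram matrix, so multipliers translate both ways: by [Y^T] in
   one direction, by [D] in the other. *)
have /submxP[D YE] := sub_gram Y.
apply: (@neg_index_equiv _ _ _ _ (fun u => (u.1 *m Y^T, u.2)) (fun u => (u.1 *m D, u.2))).
- by move=> a [x v] [x' v']; rewrite /= mulmxDl -scalemxAl.
- by move=> a [x v] [x' v']; rewrite /= mulmxDl -scalemxAl.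
- by move=> [x v] /=; rewrite mulmxA.
- by move=> [x v] /=; rewrite -mulmxA -YE.
Qed.

End NegativeIndex.

(** * Spectral theorem for real symmetric matrices *)

Section Spectral.
Variable R : realType.

(** An eigenvalue exists over the complex numbers. Evaluating [w A w^*] in two ways shows that it is
    real; being a root of the characteristic polynomial descends to [R], where it yields a real
    eigenvector to be normalised. *)
Lemma symmetric_real_eigenvector n (A : 'M[R]_n.+1) :
  A^T = A -> exists (mu : R) (v : 'rV[R]_n.+1), v *m v^T = 1%:M /\ v *m A = mu *: v.
Proof.
move=> symA; pose C : numClosedFieldType := complex.complex R.
pose iota : {rmorphism R -> C} := complex.real_complex R.
pose AC := map_mx iota A.
have [z /eigenvalueP[w wA w0]] : exists z, eigenvalue AC z.
  have /closed_rootP[z] : size (char_poly AC) != 1 by rewrite size_char_poly.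
  by exists z; rewrite eigenvalue_root_char.
pose wc := (map_mx Num.conj w)^T.
have conjA : map_mx Num.conj AC = AC.
  by apply/matrixP => i j; rewrite !mxE; apply: conj_Creal; rewrite complex.complex_real.
have ww0 : (w *m wc) 0 0 != 0.
  apply: contraNneq w0 => ww; apply/eqP/rowP => i; rewrite mxE; apply/eqP.
  move: ww; rewrite mxE => /eqP; rewrite psumr_eq0 => [|j _]; last first.
    by rewrite !mxE mul_conjC_ge0.
  move/allP/(_ i (mem_index_enum _)); rewrite !mxE mulf_eq0 conjC_eq0.
  by case/orP.
have zreal : z \is Num.real.
  have e1 : w *m AC *m wc = z *: (w *m wc) by rewrite wA scalemxAl.
  have e2 : w *m AC *m wc = z^* *: (w *m wc).
    rewrite -mulmxA scalemxAr; congr (_ *m _).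
    have -> : AC = (map_mx Num.conj AC)^T by rewrite conjA /AC map_trmx symA.
    by rewrite -trmx_mul -map_mxM wA map_mxZ linearZ.
  apply/CrealP; apply: (mulIf ww0).
  have := congr1 (fun M : 'M_1 => M 0 0) (etrans (esym e2) e1).
  by rewrite mxE => ->; rewrite mxE.
have [mu zE] : exists mu : R, z = iota mu.
  by exists (complex.Re z); apply/esym/complex.RRe_real.
have : eigenvalue A mu.
  rewrite eigenvalue_root_char -(fmorph_root iota) map_char_poly -zE.
  by rewrite -eigenvalue_root_char; apply/eigenvalueP; exists w.
case/eigenvalueP => v vA v0.
pose s := \sum_i v 0 i ^+ 2.
have vvT : v *m v^T = s%:M.
  apply/matrixP => i j; rewrite !ord1 !mxE eqxx mulr1n.
  by apply: eq_bigr => k _; rewrite mxE expr2.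
have s_gt0 : 0 < s.
  rewrite lt0r sumr_ge0 ?andbT => [|i _]; last exact: sqr_ge0.
  apply: contraNneq v0 => /eqP; rewrite psumr_eq0 => [/allP v0|i _]; last exact: sqr_ge0.
  apply/eqP/rowP => i; have := v0 i (mem_index_enum _).
  by rewrite sqrf_eq0 mxE => /eqP.
exists mu, ((Num.sqrt s)^-1 *: v); split.
  rewrite linearZ /= -scalemxAr -scalemxAl scalerA vvT -invfM -expr2 sqr_sqrtr ?ltW //.
  by rewrite scale_scalar_mx mulVf // gt_eqF.
by rewrite -scalemxAl vA !scalerA mulrC.
Qed.

(* The Householder reflection exchanging [v] and the first basis vector. *)
Lemma householder n (v : 'rV[R]_n.+1) : v *m v^T = 1%:M ->
  exists H : 'M[R]_n.+1, [/\ H^T = H, H *m H = 1%:M & delta_mx 0 0 *m H = v].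
Proof.
move=> vv; pose e : 'rV[R]_n.+1 := delta_mx 0 0; pose u := v - e.
have eeT : e *m e^T = 1%:M by rewrite /e trmx_delta mul_delta_mx; apply/matrixP => i j; rewrite !ord1 !mxE.
have [u0|u0] := eqVneq u 0.
  exists 1%:M; rewrite trmx1 !mulmx1; split=> //.
  by apply/esym/eqP; rewrite -subr_eq0 -/e -/u u0.
have veT : v *m e^T = (v 0 0)%:M.
  rewrite /e trmx_delta -colE; apply/matrixP => i j.
  by rewrite !ord1 !mxE eqxx mulr1n.
have evT : e *m v^T = (v 0 0)%:M by rewrite -[e]trmxK -trmx_mul veT tr_scalar_mx.
(* This is the squared length of [v - e], as [v] and [e] are unit vectors. *)
pose s := 2 - 2 * v 0 0.
have uuT : u *m u^T = s%:M.
  rewrite /u linearB /= mulmxBl !mulmxBr vv veT evT eeT.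
  by apply/matrixP => i j; rewrite !ord1 !mxE /= /s; ring.
have s0 : s != 0.
  apply: contraNneq u0 => s0; move: uuT; rewrite s0 => /matrixP/(_ 0 0).
  rewrite mxE [in RHS]mxE mul0rn => /eqP; rewrite psumr_eq0 => [/allP u0|i _]; last first.
    by rewrite [u^T _ _]mxE -expr2 sqr_ge0.
  apply/eqP/rowP => i; have := u0 i (mem_index_enum _).
  by rewrite [u^T _ _]mxE -expr2 sqrf_eq0 => /eqP ->; rewrite mxE.
pose H : 'M[R]_n.+1 := 1%:M - (2 / s) *: (u^T *m u).
exists H; split.
- by rewrite /H linearB /= trmx1 linearZ /= trmx_mul trmxK.
- have : (u^T *m u) *m (u^T *m u) = s *: (u^T *m u).
    by rewrite mulmxA -(mulmxA _ u) uuT mul_mx_scalar -scalemxAl.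
  rewrite /H; move: (u^T *m u) => K KK.
  rewrite mulmxBl mul1mx mulmxBr mulmx1 -scalemxAl -scalemxAr scalerA KK scalerA.
  apply/matrixP => i j; rewrite !mxE; by field.
rewrite -/e /H mulmxBr mulmx1 -scalemxAr mulmxA.
have -> : e *m u^T = (v 0 0 - 1)%:M by rewrite /u linearB /= mulmxBr evT eeT raddfB.
rewrite mul_scalar_mx scalerA.
have -> : 2 / s * (v 0 0 - 1) = -1.
  by apply: (mulIf s0); rewrite mulrAC divfK // /s; ring.
by rewrite scaleN1r opprK /u addrC subrK.
Qed.

(** Deflation: conjugation by a reflection taking the first basis vector to a unit eigenvector makes
    the first row a multiple of that basis vector; by symmetry so is the first column, and the
    induction hypothesis handles the remaining block. *)
Lemma symmetric_spectral n (A : 'M[R]_n) : A^T = A ->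
  exists (P : 'M[R]_n) (d : 'rV[R]_n), P *m P^T = 1%:M /\ A = P^T *m diag_mx d *m P.
Proof.
elim: n A => [|n IHn] A symA.
  by exists 0, 0; split; apply/matrixP => [] [].
have [mu [v [vv vA]]] := symmetric_real_eigenvector symA.
have [H [symH HH eH]] := householder vv.
pose B : 'M[R]_(1 + n) := H *m A *m H.
have symB : B^T = B by rewrite /B !trmx_mul symH symA mulmxA.
have rowB : row 0 B = mu *: delta_mx 0 0.
  rewrite rowE /B !mulmxA eH vA -scalemxAl; congr (_ *: _).
  by rewrite -eH -mulmxA HH mulmx1.
have rowB1 : usubmx B = mu *: delta_mx 0 0.
  rewrite -rowB; apply/rowP => j; rewrite [LHS]mxE [RHS]mxE.
  by congr (fun_of_matrix B _ _); exact/val_inj.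
have BE : B = block_mx mu%:M 0 0 (drsubmx B).
  rewrite -[LHS]submxK; congr block_mx.
  - apply/matrixP => i j; rewrite !ord1 /ulsubmx rowB1 !mxE /= mulr1n.
    by rewrite mulr1.
  - apply/matrixP => i j; rewrite !ord1 /ursubmx rowB1 !mxE /=.
    by rewrite mulr0.
  - rewrite -[dlsubmx B]trmxK trmx_dlsub symB.
    apply/matrixP => i j; rewrite !ord1 mxE /ursubmx rowB1 !mxE /=.
    by rewrite mulr0.
have [|P [d [PP dE]]] := IHn (drsubmx B).
  by rewrite trmx_drsub symB.
pose P1 : 'M[R]_(1 + n) := block_mx 1%:M 0 0 P.
have PP1 : P1 *m P1^T = 1%:M.
  rewrite /P1 tr_block_mx mulmx_block.
  rewrite !(trmx0, trmx1, mulmx0, mul0mx, addr0, add0r, mulmx1) PP.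
  by rewrite -scalar_mx_block.
have DE : B = P1^T *m diag_mx (row_mx mu%:M d) *m P1.
  rewrite BE dE /P1 tr_block_mx diag_mx_row !mulmx_block.
  rewrite !(trmx0, trmx1, mulmx0, mul0mx, addr0, add0r, mulmx1, mul1mx).
  congr block_mx; apply/matrixP => i j; rewrite !ord1 !mxE eqxx ?mulr1n //.
exists (P1 *m H), (row_mx mu%:M d); split.
  by rewrite trmx_mul symH mulmxA -(mulmxA P1) HH mulmx1 PP1.
have AE : A = H *m B *m H.
  by rewrite /B !mulmxA HH mul1mx -mulmxA HH mulmx1.
by rewrite {1}AE DE trmx_mul symH !mulmxA.
Qed.

End Spectral.

(** * Sylvester's law of inertia and eigenvalue counts *)

Section EigenvalueCounts.
Variable R : realType.

(** Upper bound: once the coordinates with negative coefficient vanish, the form dominates the zero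
    form, whose index is 0. Lower bound: those coordinates span a negative subspace. *)
Lemma neg_index_diag n (a : 'I_n -> R) :
  neg_index (fun x : 'rV[R]_n => \sum_i a i * x 0 i ^+ 2) #|[pred i | a i < 0]|.
Proof.
set A := [pred i | _]; set F := fun x => _; split.
- by rewrite /F big1 // => i _; rewrite mxE expr0n mulr0.
- exists (fun t => \row_i \sum_(j | enum_val j == i) t 0 j) => [b x y|t t0].
    apply/rowP => i; rewrite !mxE mulr_sumr -big_split.
    by apply: eq_bigr => j _; rewrite !mxE.
  have [j tj] : exists j, t 0 j != 0.
    apply/existsP; apply: contraNT t0; rewrite negb_exists => /forallP t0.
    by apply/eqP/rowP => j; have := t0 j; rewrite negbK mxE => /eqP.
  have val i : (\row_i \sum_(j | enum_val j == i) t 0 j) 0 (enum_val i) = t 0 i.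
    rewrite mxE (big_pred1 i) // => k; exact: (inj_eq enum_val_inj).
  have le0 i : a i * (\row_i \sum_(j | enum_val j == i) t 0 j) 0 i ^+ 2 <= 0.
    have [Ai|Ai] := boolP (i \in A).
      by rewrite mulr_le0_ge0 ?sqr_ge0 // ltW.
    rewrite mxE big_pred0 ?expr0n ?mulr0 // => k; apply/negbTE.
    by apply: contraNneq Ai => <-; apply: enum_valP.
  rewrite /F (bigD1 (enum_val j)) //= ltr_wnDr ?sumr_le0 // val.
  rewrite nmulr_rlt0; first by rewrite exprn_even_gt0.
  exact: (enum_valP j).
move=> m; rewrite leqNgt => Fm; apply/negP => lt_pm.
move: Fm; rewrite -(subnK (ltnW lt_pm)) => Fm.
have : has_neg_space (fun=> 0 : R) (m - #|A|) (V := 'rV[R]_n).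
  apply: has_neg_space_ker Fm; first exact: (linearP (colsub (fun j : 'I_#|A| => enum_val j))).
  move=> v /rowP v0; apply: sumr_ge0 => i _.
  have [Ai|Ai] := boolP (i \in A); last by rewrite mulr_ge0 ?sqr_ge0 // leNgt.
  by have := v0 (enum_rank_in Ai i); rewrite !mxE enum_rankK_in // => ->; rewrite expr0n mulr0.
have [_ _ /[apply]] := neg_index_zero (fun v : 'rV[R]_n => erefl (0 : R)).
by rewrite leqn0 subn_eq0 leqNgt lt_pm.
Qed.

(** One orthonormal eigenbasis diagonalises all the forms [s (A - c)] at once, so a single list [ds]
    serves the characteristic polynomial, every shift [c] and both signs. *)
Lemma symmetric_inertia n (A : 'M[R]_n) : A^T = A ->
  exists ds : seq R, [/\ size ds = n, char_poly A = \prod_(d <- ds) ('X - d%:P) &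
    forall s c : R,
      neg_index (fun v : 'rV[R]_n => s * (v *m A *m v^T - c *: (v *m v^T)) 0 0)
             (count (fun d => s * (d - c) < 0) ds)].
Proof.
move=> /symmetric_spectral [P [d [PP ->]]].
have PP' : P^T *m P = 1%:M by apply: mulmx1C.
exists [seq d 0 i | i <- enum 'I_n]; split.
- by rewrite size_map size_enum_ord.
- have sim : char_poly (P^T *m diag_mx d *m P) = char_poly (diag_mx d).
    rewrite /char_poly.
    have -> : char_poly_mx (P^T *m diag_mx d *m P) =
        map_mx polyC P^T *m char_poly_mx (diag_mx d) *m map_mx polyC P.
      rewrite /char_poly_mx mulmxBr mulmxBl -!map_mxM; congr (_ - _).
      by rewrite mul_mx_scalar -scalemxAl -map_mxM PP' map_mx1 scalemx1.
    rewrite !det_mulmx mulrAC -det_mulmx -map_mxM PP'.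
    by rewrite map_mx1 det1 mul1r.
  rewrite sim char_poly_trig ?diag_mx_is_trig // big_map big_enum.
  by apply: eq_bigr => i _; rewrite mxE eqxx.
move=> s c.
have key (x : 'rV[R]_n) :
    s * (x *m diag_mx d *m x^T - c *: (x *m x^T)) 0 0 = \sum_i s * (d 0 i - c) * x 0 i ^+ 2.
  rewrite mul_mx_diag !mxE mulr_sumr -sumrB mulr_sumr.
  by apply: eq_bigr => i _; rewrite !mxE; ring.
have := @neg_index_diag n (fun i => s * (d 0 i - c)).
have -> : #|[pred i | s * (d 0 i - c) < 0]| =
    count (fun d => s * (d - c) < 0) [seq d 0 i | i <- enum 'I_n].
  rewrite count_map cardE -size_filter; congr size; rewrite [in RHS]enumT.
  exact: eq_filter.
apply: (@neg_index_equiv _ _ _ _ _ (fun x => x *m P) (fun v => v *m P^T)).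
- by move=> a x y; rewrite mulmxDl -scalemxAl.
- by move=> a x y; rewrite mulmxDl -scalemxAl.
- move=> v; rewrite -key !mulmxA -(mulmxA _ P P^T) PP mulmx1 trmx_mul.
  rewrite !mulmxA -(mulmxA _ P P^T) PP mulmx1.
  by rewrite -(mulmxA _ P P^T) PP mulmx1.
move=> v; rewrite -key trmx_mul trmxK !mulmxA.
by rewrite -(mulmxA v P^T P) PP' mulmx1.
Qed.

Lemma mup_prod_XsubC (x : R) (ds : seq R) :
  mup x (\prod_(d <- ds) ('X - d%:P)) = count_mem x ds.
Proof.
elim: ds => [|d ds IH]; first by rewrite big_nil mupNroot // root1.
rewrite big_cons mupM ?polyXsubC_eq0 // ?prodXsubC_neq0 //; last first.
  by rewrite monic_neq0 // monic_prod_XsubC.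
by rewrite IH /= -['X - _]expr1 mup_XsubCX; case: eqP.
Qed.

(** Multiplicity in a split polynomial is the number of occurrences in [ds]; grouping [ds] by value
    turns the weighted sum into a plain count. *)
Lemma num_eigenvalues_inE n (A : 'M[R]_n) (ds : seq R) (I : interval R) :
  char_poly A = \prod_(d <- ds) ('X - d%:P) ->
  num_eigenvalues_in A I = count (fun d => d \in I) ds.
Proof.
move=> chA; rewrite /num_eigenvalues_in chA.
have -> : [set x | eigenvalue A x /\ x \in I]%classic =
          [set` [seq d <- undup ds | d \in I]]%classic.
  apply/seteqP; split=> x /=; rewrite mem_filter mem_undup eigenvalue_root_char chA root_prod_XsubC.
    by case=> -> ->.
  by case/andP.
rewrite -fsbig_seq ?filter_uniq ?undup_uniq // big_filter.
under eq_bigr do rewrite mup_prod_XsubC.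
rewrite -(permP (perm_count_undup ds)) count_flatten -map_comp sumnE big_map.
rewrite big_mkcond; apply: eq_bigr => x _ /=; rewrite count_nseq.
by case: (x \in I); rewrite ?mul1n ?mul0n.
Qed.

(** An endpoint is a cut of the line, whichever side of an interval it bounds. [BLeft x < b] means
    [x < c] for [BLeft c], [x <= c] for [BRight c], never for -oo and always for +oo. *)
Definition nbelow (ds : seq R) (b : itv_bound R) :=
  count (fun x => (BLeft x < b)%O) ds.

Lemma count_itv (ds : seq R) (l u : itv_bound R) :
  count (fun x => x \in Interval l u) ds = (nbelow ds u - nbelow ds l)%N.
Proof.
have memE x : (x \in Interval l u) = ~~ (BLeft x < l)%O && (BLeft x < u)%O.
  by rewrite itv_boundlr -leNgt; congr (_ && _); case: (u) => [[] y|[]].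
(* When the endpoints are reversed the interval is empty, and the truncated subtraction gives 0
   because [nbelow] is monotone in the cut. *)
have [le_lu|lt_ul] := leP l u.
  have <- : (count (fun x => x \in Interval l u) ds + nbelow ds l = nbelow ds u)%N.
    elim: ds => //= x ds; rewrite /nbelow /= memE => IH.
    rewrite addnACA IH; congr (_ + _)%N.
    case: (ltP (BLeft x) l) => //= [xl|]; last by case: (BLeft x < u)%O.
    by rewrite (lt_le_trans xl le_lu).
  by rewrite addnK.
have -> : count (fun x => x \in Interval l u) ds = 0%N.
  apply/eqP; rewrite -leqn0 leqNgt -has_count; apply/hasPn => x _.
  by rewrite memE -leNgt; apply/negP => /andP[lx /(le_lt_trans lx)]; rewrite ltNge ltW.
apply/esym/eqP; rewrite subn_eq0; apply: sub_count => x /= xu.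
exact: lt_trans xu lt_ul.
Qed.

(** An index only counts strict inequalities. For a cut to the right of [c], the eigenvalues at most
    [c] are thus obtained as the complement of those above [c], which are the negative directions of
    [c - A]. *)
Lemma nbelow_inertia n (A : 'M[R]_n) : A^T = A ->
  exists ds : seq R, [/\ size ds = n,
    forall I : interval R, num_eigenvalues_in A I = count (fun d => d \in I) ds &
    forall (c : R) (right : bool), exists N,
      neg_index (fun v : 'rV[R]_n =>
        (if right then -1 else 1) * (v *m A *m v^T - c *: (v *m v^T)) 0 0) N /\
      nbelow ds (BSide (~~ right) c) = if right then (n - N)%N else N].
Proof.
move=> /symmetric_inertia [ds [sz chA inert]]; exists ds; split=> // [I|c right].
  exact: num_eigenvalues_inE.
exists (count (fun d => (if right then -1 else 1) * (d - c) < 0) ds); split=> //.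
case: right => /=.
  rewrite -sz -(count_predC (fun x => (BLeft x < BRight c)%O) ds).
  have <- : count (predC (fun x => (BLeft x < BRight c)%O)) ds =
      count (fun d => -1 * (d - c) < 0) ds.
    by apply: eq_count => d /=; rewrite bnd_simp -ltNge; apply/idP/idP; lra.
  by rewrite addnK.
by apply: eq_count => d; rewrite bnd_simp mul1r subr_lt0.
Qed.

End EigenvalueCounts.

(** * Symmetric elimination *)

Section NatForms.
Variable R : realType.
Implicit Types (Q : nat -> nat -> R) (X : nat -> R).

(** Rows and columns are indexed by naturals, because [Q] will be the contents of memory cells; only
    indices below [M] matter. *)
Definition quad M Q X := \sum_(a < M) \sum_(b < M) Q a b * X a * X b.

Definition symmetric_below M Q := forall a b, (a < M)%N -> (b < M)%N -> Q a b = Q b a.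

(* H is the context: it does not involve the variables being eliminated, which
   are the first N of M. *)
Definition reduces M N Q Q' d :=
  forall (V : lmodType R) (X : nat -> V -> R) (e : nat -> V) (H : V -> R),
    (forall a, scalar (X a)) ->
    (forall a i, (a < M)%N -> (i < N)%N -> X a (e i) = (a == i)%:R) ->
    (forall v s i, (i < N)%N -> H (v + s *: e i) = H v) ->
    forall n, neg_index (fun v => quad M Q' (X^~ v) + H v) n ->
      neg_index (fun v => quad M Q (X^~ v) + H v) (n + d).

Lemma reduces_refl M N Q : reduces M N Q Q 0.
Proof. by move=> V X e H _ _ _ n; rewrite addn0. Qed.

Lemma reduces_trans M N Q1 Q2 Q3 d1 d2 :
  reduces M N Q1 Q2 d1 -> reduces M N Q2 Q3 d2 -> reduces M N Q1 Q3 (d1 + d2).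
Proof.
move=> r12 r23 V X e H lX Xe He n /(r23 V X e H lX Xe He).
by move/(r12 V X e H lX Xe He); rewrite -addnA (addnC d2).
Qed.

Lemma quad_ext M Q Q' X : (forall a b, (a < M)%N -> (b < M)%N -> Q a b = Q' a b) ->
  quad M Q X = quad M Q' X.
Proof.
move=> eqQ; apply: eq_bigr => a _; apply: eq_bigr => b _.
by rewrite eqQ.
Qed.

Lemma quad_shift M Q X s (j : nat) : symmetric_below M Q -> (j < M)%N ->
  quad M Q (fun a => X a + s * (a == j)%:R) =
  quad M Q X + s * (\sum_(b < M) Q j b * X b) *+ 2 + s ^+ 2 * Q j j.
Proof.
move=> symQ ltjM; pose J := Ordinal ltjM.
have pick (f : nat -> R) : \sum_(a < M) f a * (a == j :> nat)%:R = f j.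
  rewrite (bigD1 J) //= eqxx mulr1 big1 ?addr0 // => a /negbTE aJ.
  by have -> : (a == j :> nat) = false by []; rewrite mulr0.
have e1 : \sum_(a < M) \sum_(b < M) Q a b * X a * (b == j :> nat)%:R =
          \sum_(b < M) Q j b * X b.
  apply: eq_bigr => a _.
  by rewrite (pick (fun b => Q a b * X a)) symQ.
have e2 : \sum_(a < M) \sum_(b < M) Q a b * (a == j :> nat)%:R * X b =
          \sum_(b < M) Q j b * X b.
  rewrite exchange_big; apply: eq_bigr => b _.
  rewrite -(pick (fun a => Q a b * X b)); apply: eq_bigr => a _.
  by rewrite mulrAC.
have e3 : \sum_(a < M) \sum_(b < M) Q a b * (a == j :> nat)%:R * (b == j :> nat)%:R = Q j j.
  under eq_bigr => a _ do rewrite (pick (fun b => Q a b * (a == j :> nat)%:R)).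
  by rewrite (pick (fun a => Q a j)).
rewrite mulr2n -[in X in _ + (X + _)]e1 -e2 -e3 !mulr_sumr /quad -!big_split.
apply: eq_bigr => a _; rewrite !mulr_sumr -!big_split.
by apply: eq_bigr => b _ /=; ring.
Qed.

(** The Schur complement step of Gaussian elimination, kept at full size: for symmetric [Q] with
    nonzero pivot, row and column [i] become zero. *)
Definition pivotm Q i : nat -> nat -> R :=
  fun a b => Q a b - Q i a * Q i b / Q i i.

Lemma quad_pivotm M Q i X :
  quad M (pivotm Q i) X = quad M Q X - (\sum_(b < M) Q i b * X b) ^+ 2 / Q i i.
Proof.
rewrite expr2 mulr_suml mulr_suml -sumrB; apply: eq_bigr => a _.
rewrite mulr_sumr mulr_suml -sumrB; apply: eq_bigr => b _.
by rewrite /pivotm; ring.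
Qed.

Lemma reduces_pivot M N Q i : symmetric_below M Q -> (N <= M)%N -> (i < N)%N -> Q i i != 0 ->
  reduces M N Q (pivotm Q i) (Q i i < 0)%R.
Proof.
move=> symQ leNM ltiN Qii V X e H lX Xe He n nF.
have ltiM := leq_trans ltiN leNM.
have XD a v s : (a < M)%N -> X a (v + s *: e i) = X a v + s * (a == i)%:R.
  by move=> ltaM; rewrite addrC lX Xe // addrC.
apply: (@neg_index_pivot _ _ _ (fun v => \sum_(b < M) Q i b * X b v) (e i)) => //.
- move=> a x y; rewrite mulr_sumr -big_split; apply: eq_bigr => b _.
  by rewrite lX /=; ring.
- rewrite (bigD1 (Ordinal ltiM)) //= Xe // eqxx mulr1 big1 ?addr0 // => b /negbTE bi.
  by rewrite Xe //; have -> : (b == i :> nat) = false by []; rewrite mulr0.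
- move=> v s; rewrite He //.
  have -> : quad M Q (X^~ (v + s *: e i)) = quad M Q (fun a => X a v + s * (a == i)%:R).
    by apply: eq_bigr => a _; apply: eq_bigr => b _; rewrite !XD.
  by rewrite quad_shift //; ring.
by apply: neg_index_eq nF => v; rewrite quad_pivotm; ring.
Qed.

(** The congruence that adds [s] times row [j] to row [i] and then does the same with columns; the
    [s ^+ 2] term is their interaction at the entry (i, i). *)
Definition addrcm Q i j s : nat -> nat -> R := fun a b =>
  Q a b + (a == i)%:R * s * Q j b + (b == i)%:R * s * Q a j
  + (a == i)%:R * (b == i)%:R * s ^+ 2 * Q j j.

Lemma quad_addrcm M Q i j s X : symmetric_below M Q -> (i < M)%N -> (j < M)%N ->
  quad M (addrcm Q i j s) X = quad M Q (fun a => X a + (s * X i) * (a == j)%:R).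
Proof.
move=> symQ ltiM ltjM; rewrite quad_shift //.
have pick (f : nat -> R) : \sum_(a < M) (a == i :> nat)%:R * f a = f i.
  rewrite (bigD1 (Ordinal ltiM)) //= eqxx mul1r big1 ?addr0 // => a /negbTE aJ.
  by have -> : (a == i :> nat) = false by []; rewrite mul0r.
have e2 : \sum_(a < M) \sum_(b < M) (a == i :> nat)%:R * s * Q j b * X a * X b =
          s * X i * \sum_(b < M) Q j b * X b.
  rewrite -(pick (fun a => s * X a * \sum_(b < M) Q j b * X b)).
  apply: eq_bigr => a _; rewrite !mulr_sumr; apply: eq_bigr => b _; ring.
have e1 : \sum_(a < M) \sum_(b < M) (b == i :> nat)%:R * s * Q a j * X a * X b =
          s * X i * \sum_(b < M) Q j b * X b.
  rewrite exchange_big -e2; apply: eq_bigr => b _; apply: eq_bigr => a _.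
  by rewrite (symQ a j) //; ring.
have e3 : \sum_(a < M) \sum_(b < M)
    (a == i :> nat)%:R * (b == i :> nat)%:R * s ^+ 2 * Q j j * X a * X b =
    (s * X i) ^+ 2 * Q j j.
  transitivity (\sum_(a < M) (a == i :> nat)%:R * (s ^+ 2 * Q j j * X a * X i)).
    apply: eq_bigr => a _.
    rewrite -(pick (fun b => s ^+ 2 * Q j j * X a * X b)) mulr_sumr.
    by apply: eq_bigr => b _; ring.
  by rewrite (pick (fun a => s ^+ 2 * Q j j * X a * X i)); ring.
rewrite mulr2n -[in X in _ + (X + _)]e1 -e2 -e3 /quad -!big_split.
apply: eq_bigr => a _; rewrite -!big_split.
by apply: eq_bigr => b _ /=; rewrite /addrcm; ring.
Qed.

Lemma symmetric_below_pivotm M Q i : symmetric_below M Q -> symmetric_below M (pivotm Q i).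
Proof. by move=> symQ a b am bm; rewrite /pivotm symQ // (mulrC (Q i a)). Qed.

Lemma symmetric_below_addrcm M Q i j s : symmetric_below M Q -> (j < M)%N -> symmetric_below M (addrcm Q i j s).
Proof.
move=> symQ jm a b am bm; rewrite /addrcm (symQ a b) // (symQ j b) // (symQ j a) //; ring.
Qed.

(** The congruence is the change of variables [v + s X_i(v) e_j]. As [i != j] it preserves [X_i], so
    the same map with [- s] inverts it; the context is constant along [e_j]. *)
Lemma reduces_addrcm M N Q i j s : symmetric_below M Q -> (N <= M)%N -> (i < N)%N ->
  (j < N)%N -> i != j -> reduces M N Q (addrcm Q i j s) 0.
Proof.
move=> symQ leNM ltiN ltjN ij V X e H lX Xe He n; rewrite addn0.
have ltiM := leq_trans ltiN leNM; have ltjM := leq_trans ltjN leNM.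
have lT (t : R) : linear (fun v => v + (t * X i v) *: e j).
  move=> a x y; rewrite lX mulrDr mulrCA scalerDl scalerDr scalerA; exact: addrACA.
have XT (t : R) a v : (a < M)%N ->
    X a (v + (t * X i v) *: e j) = X a v + t * X i v * (a == j)%:R.
  by move=> ltaM; rewrite addrC lX Xe // addrC.
have XTi t v : X i (v + (t * X i v) *: e j) = X i v.
  by rewrite XT // (negbTE ij) mulr0 addr0.
have main v : quad M Q (X^~ (v + (s * X i v) *: e j)) = quad M (addrcm Q i j s) (X^~ v).
  rewrite quad_addrcm //; apply: eq_bigr => a _; apply: eq_bigr => b _.
  by rewrite !XT.
apply: (neg_index_equiv (lT s) (lT (- s))) => v; first by rewrite main He.
by rewrite He // -main XTi -addrA -scalerDl mulNr addNr scale0r addr0.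
Qed.

End NatForms.

(** * Reduced forms of expressions *)

Section Nodes.
Variables (R : realType) (k : nat) (sg dg : R).

(** The form of [sg A + dg 1], with [A] the adjacency matrix: [A - c] and [c - A] are the cases (1,
    -c) and (-1, c). *)
Definition graph_form (G : lgraph k) (v : {ffun G -> R^o}) : R :=
  \sum_x \sum_y sg * (ledge x y)%:R * v x * v y + \sum_x dg * v x ^+ 2.

Definition label_sums (G : lgraph k) (v : {ffun G -> R^o}) : 'rV[R]_k :=
  \row_i \sum_(x | lab x == i) v x.

(* In every context coupled to G through its label sums only, G can be replaced
   by the pair (A, T); s is the number of hyperbolic planes that this adds and
   cnt the number of negative directions that it removes. *)
Definition represents (G : lgraph k) (A T : 'M[R]_k) (cnt s : nat) :=
  forall (U : lmodType R) (c : U -> 'rV[R]_k) (H : U -> R), linear c ->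
  forall N,
    neg_index (fun p : 'rV[R]_k * ('rV[R]_k * U) =>
      dotv (p.1 *m A) p.2.1 *+ 2 + dotv (p.2.1 *m T) p.2.1
      + dotv p.2.1 (c p.2.2) *+ 2 + H p.2.2) N ->
  exists2 N', (N + cnt = N' + s)%N &
    neg_index (fun p : {ffun G -> R^o} * U =>
      graph_form p.1 + dotv (label_sums p.1) (c p.2) *+ 2 + H p.2) N'.

Lemma sum_lift n (i : 'I_n) (F : 'I_n -> R) :
  \sum_j F j = F i + \sum_(j < n.-1) F (lift i j).
Proof. by case: n i F => [[] //|n] i F; rewrite (bigD1_ord i). Qed.

(** For a single vertex of label [i], all label sums except [z_i] are constrained to 0. The planes
    are formed by [z_j] and [w_j + c_j] for [j != i], the shift by [c] absorbing the context; [w_i]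
    is a null direction. *)
Lemma represents_leaf (i : 'I_k) :
  represents (lg_single i) (\matrix_(a, b) ((a == b) && (a != i))%:R)
    (\matrix_(a, b) (dg *+ ((a == b) && (a == i)))) 0 k.-1.
Proof.
move=> U c H lc N negN.
(* The inverse of dropping coordinate [i]: [t] is inserted there. *)
pose row_of (x : 'rV[R]_k.-1) (t : R) : 'rV[R]_k :=
  \row_j (if unlift i j is Some j' then x 0 j' else t).
have row_of_lift x t j : row_of x t 0 (lift i j) = x 0 j by rewrite mxE liftK.
have row_of_i x t : row_of x t 0 i = t by rewrite mxE unlift_none.
have row_of_lin a x x' t t' : row_of (a *: x + x') (a * t + t') = a *: row_of x t + row_of x' t'.
  by apply/rowP => j; rewrite !mxE; case: unlift => [j'|] //; rewrite !mxE.
have wA (w z : 'rV[R]_k) :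
    dotv (w *m \matrix_(a, b) ((a == b) && (a != i))%:R) z =
    \sum_(j < k.-1) w 0 (lift i j) * z 0 (lift i j).
  rewrite dotv_mulmx.
  transitivity (\sum_a (a != i)%:R * w 0 a * z 0 a).
    apply: eq_bigr => a _; rewrite (bigD1 a) //= mxE eqxx big1 ?addr0 // => b ba.
    by rewrite mxE eq_sym (negbTE ba) !mul0r.
  rewrite (sum_lift i) eqxx !mul0r add0r; apply: eq_bigr => j _.
  by rewrite eq_sym neq_lift mul1r.
have zT (z : 'rV[R]_k) :
    dotv (z *m \matrix_(a, b) (dg *+ ((a == b) && (a == i)))) z = dg * z 0 i ^+ 2.
  rewrite dotv_mulmx (bigD1 i) //= [X in _ + X]big1 ?addr0 => [|a ai]; last first.
    by rewrite big1 // => b _; rewrite mxE (negbTE ai) andbF mulr0n !mul0r.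
  rewrite (bigD1 i) //= mxE !eqxx big1 ?addr0 => [|b bi]; first by rewrite /=; ring.
  by rewrite mxE eq_sym (negbTE bi) !mul0r.
have gfE (v : {ffun lg_single i -> R^o}) : graph_form v = dg * v tt ^+ 2.
  by rewrite /graph_form !(big_pred1 tt) ?mulr0 ?mul0r ?add0r // => -[].
have gsE (v : {ffun lg_single i -> R^o}) x : dotv (label_sums v) x = v tt * x 0 i.
  rewrite /dotv (bigD1 i) //= mxE (big_pred1 tt) ?big1 ?addr0 // => [j ji|[]].
    by rewrite mxE big_pred0 ?mul0r // => x0; rewrite eq_sym (negbTE ji).
  exact: eqxx.
pose V := ({ffun lg_single i -> R^o} * U)%type.
pose F (p : V) := graph_form p.1 + dotv (label_sums p.1) (c p.2) *+ 2 + H p.2.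
pose F' (p : 'rV[R]_k.-1 * ('rV[R]_k.-1 * V)) := dotv p.1 p.2.1 *+ 2 + F p.2.2.
suff /(neg_index_planes (F := F)) : neg_index F' N.
  by case=> // N' -> neg; exists N'; rewrite ?addn0.
pose h (p : 'rV[R]_k * ('rV[R]_k * U)) : 'rV[R]_k.-1 * ('rV[R]_k.-1 * V) :=
  (colsub (lift i) (p.1 + c p.2.2), (colsub (lift i) p.2.1, ([ffun=> p.2.1 0 i], p.2.2))).
pose h' (p : 'rV[R]_k.-1 * ('rV[R]_k.-1 * V)) : 'rV[R]_k * ('rV[R]_k * U) :=
  (row_of p.1 0 - c p.2.2.2, (row_of p.2.1 (p.2.2.1 tt), p.2.2.2)).
apply: (@neg_index_equiv _ _ _ _ F' h h') negN.
- move=> a [w [z u]] [w' [z' u']]; congr (_, (_, (_, _))) => /=.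
  + by rewrite lc; apply/rowP => j; rewrite !mxE; ring.
  + by apply/rowP => j; rewrite !mxE.
  + by apply/ffunP => j; rewrite !ffunE !mxE.
- move=> a [x [y [v u]]] [x' [y' [v' u']]]; congr (_, (_, _)) => /=.
  + by rewrite -[X in row_of _ X](addr0) -[X in row_of _ (X + _)](mulr0 a) row_of_lin lc
      opprD scalerBr addrACA.
  + by rewrite !ffunE; apply: row_of_lin.
- move=> [w [z u]]; rewrite /F' /F /= wA zT gfE gsE !ffunE.
  rewrite [X in _ = _ + X *+ 2 + _]/dotv (sum_lift i) /dotv.
  have -> : \sum_i0 colsub (lift i) (w + c u) 0 i0 * colsub (lift i) z 0 i0 =
      \sum_(j < k.-1) w 0 (lift i j) * z 0 (lift i j)
      + \sum_(j < k.-1) z 0 (lift i j) * c u 0 (lift i j).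
    by rewrite -big_split; apply: eq_bigr => j _ /=; rewrite !mxE; ring.
  ring.
move=> [x [y [v u]]]; rewrite /F' /F /= wA zT gfE gsE row_of_i.
rewrite [X in _ + X *+ 2 + _ = _]/dotv (sum_lift i) row_of_i /dotv.
have -> : \sum_(j < k.-1) (row_of x 0 - c u) 0 (lift i j) * row_of y (v tt) 0 (lift i j) =
    \sum_(j < k.-1) x 0 j * y 0 j
    - \sum_(j < k.-1) row_of y (v tt) 0 (lift i j) * c u 0 (lift i j).
  rewrite -sumrB; apply: eq_bigr => j _ /=; rewrite row_of_lift.
  have -> : (row_of x 0 - c u) 0 (lift i j) = x 0 j - c u 0 (lift i j).
    by rewrite -(row_of_lift x 0 j) !mxE.
  ring.
ring.
Qed.

(* The k blocks of the 6k variables of a join are w1, z1, w2, z2, y, z, in this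
   order; the first five form one row vector, eliminated at once. *)
Definition entry n (x : 'rV[R]_n) (a : nat) : R := if insub a is Some i then x 0 i else 0.

Lemma entryE n (x : 'rV[R]_n) (i : 'I_n) : entry x i = x 0 i.
Proof. by rewrite /entry valK. Qed.

Lemma entry_linear n a (b : R) (x y : 'rV[R]_n) : entry (b *: x + y) a = b * entry x a + entry y a.
Proof. by rewrite /entry; case: insub => [i|]; rewrite ?mxE // mulr0 addr0. Qed.

Definition block n j (x : 'rV[R]_n) : 'rV[R]_k := \row_(i < k) entry x (j * k + i).

Lemma block_linear n j : linear (@block n j).
Proof. by move=> a x y; apply/rowP => i; rewrite !mxE entry_linear. Qed.

Definition join_coord (x : 'rV[R]_(5 * k)) (z : 'rV[R]_k) (a : nat) : R :=
  if (a < 5 * k)%N then entry x a else entry z (a - 5 * k).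

Lemma join_coord_blk x z j (i : 'I_k) : (j < 5)%N -> join_coord x z (j * k + i) = block j x 0 i.
Proof.
move=> j5; rewrite /join_coord mxE; case: ltnP => //; have := ltn_ord i; nia.
Qed.

Lemma join_coord_last x z (i : 'I_k) : join_coord x z (5 * k + i) = z 0 i.
Proof. by rewrite /join_coord ltnNge leq_addr /= addKn entryE. Qed.

Definition unblk (s : seq 'rV[R]_k) : 'rV[R]_(5 * k) :=
  \row_a entry (nth 0 s (a %/ k)) (a %% k).

Lemma block_unblk s j : (j < 5)%N -> block j (unblk s) = nth 0 s j.
Proof.
move=> j5; apply/rowP => i; rewrite mxE.
have ltx : (j * k + i < 5 * k)%N by have := ltn_ord i; nia.
rewrite (entryE _ (Ordinal ltx)) mxE /=.
have k0 : (0 < k)%N by apply: leq_ltn_trans (ltn_ord i).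
by rewrite divnMDl // divn_small // addn0 modnMDl modn_small // entryE.
Qed.

Lemma unblk_linear a x0 x1 x2 x3 x4 y0 y1 y2 y3 y4 :
  unblk [:: a *: x0 + y0; a *: x1 + y1; a *: x2 + y2; a *: x3 + y3; a *: x4 + y4] =
  a *: unblk [:: x0; x1; x2; x3; x4] + unblk [:: y0; y1; y2; y3; y4].
Proof.
apply/rowP => i; rewrite !mxE -entry_linear; congr entry.
have k0 : (0 < k)%N by have := ltn_ord i; lia.
have : (i %/ k < 5)%N by rewrite ltn_divLR.
by case: (i %/ k)%N => [|[|[|[|[|]]]]].
Qed.

(** The pairs of the two operands, the new edges, and the Lagrange term [2 y.(z - L1 z1 - L2 z2)],
    which relabels. It is spelled out over one coordinate sequence because the program accumulates
    it entry by entry. *)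
Definition join_form (Sx : {set 'I_k * 'I_k}) (L1 L2 : {ffun 'I_k -> 'I_k})
    (A1 T1 A2 T2 : 'M[R]_k) (X : nat -> R) : R :=
  \sum_(a < k) \sum_(b < k)
    (A1 a b * X (0 * k + a)%N * X (1 * k + b)%N *+ 2
     + T1 a b * X (1 * k + a)%N * X (1 * k + b)%N)
  + \sum_(a < k) \sum_(b < k)
    (A2 a b * X (2 * k + a)%N * X (3 * k + b)%N *+ 2
     + T2 a b * X (3 * k + a)%N * X (3 * k + b)%N)
  + \sum_(a < k) \sum_(b < k)
      sg * ((a, b) \in Sx)%:R * X (1 * k + a)%N * X (3 * k + b)%N *+ 2
  + \sum_(a < k) (X (4 * k + a)%N * X (5 * k + a)%N
      - X (1 * k + a)%N * X (4 * k + L1 a)%N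
      - X (3 * k + a)%N * X (4 * k + L2 a)%N) *+ 2.

Definition pull (f : {ffun 'I_k -> 'I_k}) (c : 'rV[R]_k) : 'rV[R]_k := \row_a c 0 (f a).
Definition push (f : {ffun 'I_k -> 'I_k}) (z : 'rV[R]_k) : 'rV[R]_k :=
  \row_j \sum_(a | f a == j) z 0 a.

(** [push] relabels label sums and [pull] is its transpose: an outer context [c] is felt by an
    operand as [pull f c]. *)
Lemma push_pull f z c : dotv (push f z) c = dotv z (pull f c).
Proof.
rewrite /dotv [RHS](partition_big f predT) //=; apply: eq_bigr => j _.
rewrite mxE mulr_suml; apply: eq_bigr => a /eqP fa; by rewrite mxE fa.
Qed.

Lemma pull_linear f : linear (pull f).
Proof. by move=> a x y; apply/rowP => i; rewrite !mxE. Qed.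

Lemma push_linear f : linear (push f).
Proof.
move=> a x y; apply/rowP => i; rewrite !mxE mulr_sumr -big_split.
by apply: eq_bigr => j _; rewrite !mxE.
Qed.

Definition join_mx (Sx : {set 'I_k * 'I_k}) : 'M[R]_k := \matrix_(a, b) (sg * ((a, b) \in Sx)%:R).

Lemma join_formE Sx L1 L2 A1 T1 A2 T2 x z :
  join_form Sx L1 L2 A1 T1 A2 T2 (join_coord x z) =
  dotv (block 0 x *m A1) (block 1 x) *+ 2 + dotv (block 1 x *m T1) (block 1 x)
  + (dotv (block 2 x *m A2) (block 3 x) *+ 2 + dotv (block 3 x *m T2) (block 3 x))
  + dotv (block 1 x *m join_mx Sx) (block 3 x) *+ 2
  + (dotv (block 4 x) z - dotv (block 1 x) (pull L1 (block 4 x))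
     - dotv (block 3 x) (pull L2 (block 4 x))) *+ 2.
Proof.
rewrite /join_form !dotv_mulmx; congr (_ + _ + _ + _).
- rewrite -sumrMnl -big_split; apply: eq_bigr => a _.
  rewrite -sumrMnl -big_split; apply: eq_bigr => b _.
  by rewrite !join_coord_blk.
- rewrite -sumrMnl -big_split; apply: eq_bigr => a _.
  rewrite -sumrMnl -big_split; apply: eq_bigr => b _.
  by rewrite !join_coord_blk.
- rewrite -sumrMnl; apply: eq_bigr => a _.
  rewrite -sumrMnl; apply: eq_bigr => b _.
  by rewrite !join_coord_blk // [join_mx Sx a b]mxE.
rewrite -!sumrB -sumrMnl; apply: eq_bigr => a _.
by rewrite join_coord_last !join_coord_blk // [pull L1 _ _ _]mxE [pull L2 _ _ _]mxE.
Qed.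

(** * Joins: splitting the graph form and the label sums *)

Lemma sum_lab (G : lgraph k) (F : G -> 'I_k -> R) :
  \sum_i \sum_(x : G | lab x == i) F x i = \sum_x F x (lab x).
Proof.
rewrite [RHS](partition_big (@lab k G) predT) //=; apply: eq_bigr => i _.
by apply: eq_bigr => x /eqP ->.
Qed.

(** The edges added by a join depend on labels only, so their contribution is bilinear in the label
    sums. This is why k numbers per operand suffice. *)
Lemma cross_form Sx (G1 G2 : lgraph k) (v1 : {ffun G1 -> R^o}) (v2 : {ffun G2 -> R^o}) :
  dotv (label_sums v1 *m join_mx Sx) (label_sums v2) =
  \sum_x \sum_y sg * ((lab x, lab y) \in Sx)%:R * v1 x * v2 y.
Proof.
rewrite dotv_mulmx -(sum_lab (fun x i => \sum_y sg * ((i, lab y) \in Sx)%:R * v1 x * v2 y)).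
apply: eq_bigr => i _; rewrite [RHS]exchange_big /=.
rewrite -(sum_lab (fun y j => \sum_(x | lab x == i) sg * ((i, j) \in Sx)%:R * v1 x * v2 y)).
apply: eq_bigr => j _; rewrite !mxE mulr_sumr; apply: eq_bigr => y _.
by rewrite mulr_sumr mulr_suml; apply: eq_bigr.
Qed.

Lemma graph_form_join Sx L1 L2 (G1 G2 : lgraph k) (v1 : {ffun G1 -> R^o}) (v2 : {ffun G2 -> R^o})
    (v : {ffun lg_slick Sx L1 L2 G1 G2 -> R^o}) :
  (forall x, v (inl x) = v1 x) -> (forall x, v (inr x) = v2 x) ->
  graph_form v = graph_form v1 + graph_form v2 + dotv (label_sums v1 *m join_mx Sx) (label_sums v2) *+ 2.
Proof.
move=> vl vr; rewrite cross_form /graph_form !big_sumType /=.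
have -> : \sum_x dg * v (inl x) ^+ 2 = \sum_x dg * v1 x ^+ 2.
  by apply: eq_bigr => x _; rewrite vl.
have -> : \sum_x dg * v (inr x) ^+ 2 = \sum_x dg * v2 x ^+ 2.
  by apply: eq_bigr => x _; rewrite vr.
under [X in X + _ + (_ + _) = _]eq_bigr => x _ do rewrite big_sumType /=.
under [X in _ + X + (_ + _) = _]eq_bigr => x _ do rewrite big_sumType /=.
rewrite !big_split /= [X in _ + (X + _) + _ = _]exchange_big /=.
have -> : \sum_x \sum_y sg * (ledge x y)%:R * v (inl x) * v (inl y) =
          \sum_x \sum_y sg * (ledge x y)%:R * v1 x * v1 y.
  by apply: eq_bigr => x _; apply: eq_bigr => y _; rewrite !vl.
have -> : \sum_x \sum_y sg * (ledge x y)%:R * v (inr x) * v (inr y) =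
          \sum_x \sum_y sg * (ledge x y)%:R * v2 x * v2 y.
  by apply: eq_bigr => x _; apply: eq_bigr => y _; rewrite !vr.
set c1 := \sum_x \sum_y _ * v (inl x) * v (inr y).
set c2 := \sum_x \sum_y _ * v (inr y) * v (inl x).
set c := (X in _ = _ + X *+ 2).
have -> : c1 = c by apply: eq_bigr => x _; apply: eq_bigr => y _; rewrite vl vr.
have -> : c2 = c by apply: eq_bigr => x _; apply: eq_bigr => y _; rewrite vl vr mulrAC.
ring.
Qed.

Lemma label_sums_join Sx L1 L2 (G1 G2 : lgraph k) (v1 : {ffun G1 -> R^o}) (v2 : {ffun G2 -> R^o})
    (v : {ffun lg_slick Sx L1 L2 G1 G2 -> R^o}) c :
  (forall x, v (inl x) = v1 x) -> (forall x, v (inr x) = v2 x) ->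
  dotv (label_sums v) c = dotv (label_sums v1) (pull L1 c) + dotv (label_sums v2) (pull L2 c).
Proof.
move=> vl vr.
have gsE (G : lgraph k) (w : {ffun G -> R^o}) d : dotv (label_sums w) d = \sum_x w x * d 0 (lab x).
  rewrite -(sum_lab (fun x i => w x * d 0 i)); apply: eq_bigr => i _.
  by rewrite mxE mulr_suml.
rewrite !gsE big_sumType /=.
by congr (_ + _); apply: eq_bigr => x _; rewrite ?vl ?vr mxE.
Qed.

(** The relabeling constraint is split off as [k] planes; then each operand's pair is exchanged for
    its graph, everything else serving as context. That [represents] quantifies over all contexts is
    what makes this possible. *)
Lemma join_equiv Sx L1 L2 G1 G2 A1 T1 A2 T2 cnt1 cnt2 s1 s2
    (U : lmodType R) (c : U -> 'rV[R]_k) (H : U -> R) N :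
  represents G1 A1 T1 cnt1 s1 -> represents G2 A2 T2 cnt2 s2 -> linear c ->
  neg_index (fun p : 'rV[R]_(5 * k) * ('rV[R]_k * U) =>
    join_form Sx L1 L2 A1 T1 A2 T2 (join_coord p.1 p.2.1)
    + dotv p.2.1 (c p.2.2) *+ 2 + H p.2.2) N ->
  exists2 N', (N + (cnt1 + cnt2) = N' + (s1 + s2 + k))%N &
    neg_index (fun p : {ffun lg_slick Sx L1 L2 G1 G2 -> R^o} * U =>
      graph_form p.1 + dotv (label_sums p.1) (c p.2) *+ 2 + H p.2) N'.
Proof.
move=> rep1 rep2 lc negN.
pose S := join_mx Sx.
pose Z := 'rV[R]_k.
pose F1 (p : Z * (Z * (Z * (Z * U)))) : R :=
  let: (w2, (z2, (w1, (z1, u)))) := p in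
  dotv (w2 *m A2) z2 *+ 2 + dotv (z2 *m T2) z2
  + dotv z2 (z1 *m S + pull L2 (c u)) *+ 2
  + (dotv (w1 *m A1) z1 *+ 2 + dotv (z1 *m T1) z1 + dotv z1 (pull L1 (c u)) *+ 2 + H u).
(* The planes pair [y + c u] with [z - g z1 z2]. Completing the product this way leaves [c]
   evaluated at [g z1 z2], that is, the pulled-back contexts of the operands that appear in [F1]. *)
have [|N1 eN1 {}negN] := @neg_index_planes _ _ F1 k N
    (fun p => dotv p.1 p.2.1 *+ 2 + F1 p.2.2) (fun _ _ _ => erefl).
  pose g (z1 z2 : Z) := push L1 z1 + push L2 z2.
  have gE y z1 z2 : dotv y (g z1 z2) = dotv z1 (pull L1 y) + dotv z2 (pull L2 y).
    by rewrite dotvC dotvDl !push_pull.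
  have gl a z1 z2 z1' z2' : g (a *: z1 + z1') (a *: z2 + z2') = a *: g z1 z2 + g z1' z2'.
    by rewrite /g !push_linear scalerDr addrACA.
  clearbody g.
  pose h (p : 'rV[R]_(5 * k) * (Z * U)) : Z * (Z * (Z * (Z * (Z * (Z * U))))) :=
    (block 4 p.1 + c p.2.2, (p.2.1 - g (block 1 p.1) (block 3 p.1),
     (block 2 p.1, (block 3 p.1, (block 0 p.1, (block 1 p.1, p.2.2)))))).
  pose h' (p : Z * (Z * (Z * (Z * (Z * (Z * U)))))) : 'rV[R]_(5 * k) * (Z * U) :=
    let: (y, (z, (w2, (z2, (w1, (z1, u)))))) := p in
    (unblk [:: w1; z1; w2; z2; y - c u], (z + g z1 z2, u)).
  have hF p : dotv (h p).1 (h p).2.1 *+ 2 + F1 (h p).2.2 =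
      join_form Sx L1 L2 A1 T1 A2 T2 (join_coord p.1 p.2.1) + dotv p.2.1 (c p.2.2) *+ 2 + H p.2.2.
    case: p => x [z u]; rewrite join_formE /h /F1 /=.
    rewrite !(dotvDl, dotvDr, dotvNr) !gE (dotvC _ (block 1 x *m S)) (dotvC (c u) z).
    ring.
  apply: (neg_index_equiv (h := h) (h' := h')) negN => //.
  - move=> a [x [z u]] [x' [z' u']]; rewrite /h /= !block_linear lc gl.
    have -> : a *: block 4 x + block 4 x' + (a *: c u + c u') =
        a *: (block 4 x + c u) + (block 4 x' + c u') by rewrite scalerDr addrACA.
    have -> : a *: z + z' - (a *: g (block 1 x) (block 3 x) + g (block 1 x') (block 3 x')) =
        a *: (z - g (block 1 x) (block 3 x)) + (z' - g (block 1 x') (block 3 x')).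
      by rewrite scalerBr opprD addrACA.
    by [].
  - move=> a [y [z [w2 [z2 [w1 [z1 u]]]]]] [y' [z' [w2' [z2' [w1' [z1' u']]]]]].
    rewrite /h' /= lc gl opprD addrACA -scalerBr unblk_linear.
    by congr (_, (_, _)); rewrite [RHS]/= scalerDr addrACA. 
  move=> p; rewrite -hF; case: p => y [z [w2 [z2 [w1 [z1 u]]]]].
  by rewrite /h /h' /= !block_unblk //= addrK subrK.
(* The second operand goes first; its context contains the pair of the first one, to which it is
   coupled by [z1 S]. *)
have lS : linear (fun u : Z * (Z * U) => u.2.1 *m S + pull L2 (c u.2.2)).
  move=> a [w1 [z1 u]] [w1' [z1' u']] /=.
  by rewrite mulmxDl -scalemxAl lc pull_linear scalerDr addrACA.
have := rep2 _ _ (fun u : Z * (Z * U) => dotv (u.1 *m A1) u.2.1 *+ 2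
  + dotv (u.2.1 *m T1) u.2.1 + dotv u.2.1 (pull L1 (c u.2.2)) *+ 2 + H u.2.2) lS N1.
case; first by apply: neg_index_eq negN => -[w2 [z2 [w1 [z1 u]]]].
move=> N2 eN2 {}negN.
(* Now the first operand, whose context already contains the actual graph [G2]; the coupling is
   transposed accordingly. *)
have lS' : linear (fun u : {ffun G2 -> R^o} * U => label_sums u.1 *m S^T + pull L1 (c u.2)).
  move=> a [v2 u] [v2' u'] /=.
  have -> : label_sums (a *: v2 + v2') = a *: label_sums v2 + label_sums v2'.
    apply/rowP => i; rewrite !mxE mulr_sumr -big_split.
    by apply: eq_bigr => x _; rewrite !ffunE.
  by rewrite mulmxDl -scalemxAl lc pull_linear scalerDr addrACA.
have := rep1 _ _ (fun u : {ffun G2 -> R^o} * U =>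
  graph_form u.1 + dotv (label_sums u.1) (pull L2 (c u.2)) *+ 2 + H u.2) lS' N2.
have dotS x y : dotv x (y *m S^T) = dotv (x *m S) y.
  by rewrite !dotvE trmx_mul trmxK mulmxA.
case.
  apply: (@neg_index_equiv _ _ _ _ _ (fun p => (p.2.1, (p.2.2.1, (p.1, p.2.2.2))))
           (fun p => (p.2.2.1, (p.1, (p.2.1, p.2.2.2))))) negN => //.
    move=> [v2 [w1 [z1 u]]] /=; rewrite !dotvDr dotS (dotvC (label_sums _) (_ *m S)); ring.
  move=> [w1 [z1 [v2 u]]] /=; rewrite !dotvDr dotS (dotvC (label_sums _) (_ *m S)); ring.
move=> N3 eN3 {}negN; exists N3; first by lia.
pose G := lg_slick Sx L1 L2 G1 G2.
pose h (p : {ffun G1 -> R^o} * ({ffun G2 -> R^o} * U)) : {ffun G -> R^o} * U :=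
  ([ffun x : G => match x with inl y => p.1 y | inr y => p.2.1 y end], p.2.2).
pose h' (p : {ffun G -> R^o} * U) : {ffun G1 -> R^o} * ({ffun G2 -> R^o} * U) :=
  ([ffun x => p.1 (inl x)], ([ffun x => p.1 (inr x)], p.2)).
apply: (@neg_index_equiv _ _ _ _ _ h h') negN.
- move=> a [v1 [v2 u]] [v1' [v2' u']]; congr (_, _).
  by apply/ffunP => -[x|x]; rewrite !ffunE.
- by move=> a [v u] [v' u']; congr (_, (_, _)); apply/ffunP => x; rewrite !ffunE.
- move=> [v1 [v2 u]] /=.
  rewrite (graph_form_join (v1 := v1) (v2 := v2)) => [|x|x]; rewrite ?ffunE //.
  rewrite (label_sums_join (v1 := v1) (v2 := v2)) => [|x|x]; rewrite ?ffunE //.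
  by rewrite !dotvDr dotS; ring.
move=> [v u] /=.
rewrite [in RHS](graph_form_join (v1 := [ffun x => v (inl x)]) (v2 := [ffun x => v (inr x)])) => [|x|x]; rewrite ?ffunE //.
rewrite [in RHS](label_sums_join (v1 := [ffun x => v (inl x)]) (v2 := [ffun x => v (inr x)])) => [|x|x]; rewrite ?ffunE //.
by rewrite !dotvDr dotS; ring.
Qed.


Lemma represents_join Sx L1 L2 G1 G2 A1 T1 A2 T2 cnt1 cnt2 s1 s2 (Q Q' : nat -> nat -> R) d :
  represents G1 A1 T1 cnt1 s1 -> represents G2 A2 T2 cnt2 s2 ->
  (forall X, quad (6 * k) Q X = join_form Sx L1 L2 A1 T1 A2 T2 X) ->
  reduces (6 * k) (5 * k) Q Q' d -> symmetric_below (6 * k) Q' ->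
  (forall a b, (a < 5 * k)%N -> (b < 5 * k)%N -> Q' a b = 0) ->
  represents (lg_slick Sx L1 L2 G1 G2)
    (\matrix_(a, b) \sum_(r < 5 * k) Q' r (5 * k + a)%N * Q' r (5 * k + b)%N)
    (\matrix_(a, b) Q' (5 * k + a)%N (5 * k + b)%N) (cnt1 + cnt2 + d) (s1 + s2 + k).
Proof.
move=> rep1 rep2 QE red symQ Q0 U c H lc N negN.
pose Y : 'M[R]_(5 * k, k) := \matrix_(r, b) Q' r (5 * k + b)%N.
pose T : 'M[R]_k := \matrix_(a, b) Q' (5 * k + a)%N (5 * k + b)%N.
have {}negN : neg_index (fun u : 'rV[R]_(5 * k) * ('rV[R]_k * U) => dotv (u.1 *m Y) u.2.1 *+ 2 +
    (dotv (u.2.1 *m T) u.2.1 + dotv u.2.1 (c u.2.2) *+ 2 + H u.2.2)) N.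
  apply: (@neg_index_gram _ _ _ _ Y fst
    (fun u => dotv (u.1 *m T) u.1 + dotv u.1 (c u.2) *+ 2 + H u.2)).
  suff <- : \matrix_(a, b) (\sum_(r < 5 * k) Q' r (5 * k + a)%N * Q' r (5 * k + b)%N) = Y^T *m Y.
    by apply: neg_index_eq negN => -[w [z u]] /=; rewrite !addrA.
  by apply/matrixP => a b; rewrite !mxE; apply: eq_bigr => r _; rewrite !mxE.
have QE' x z : quad (6 * k) Q' (join_coord x z) = dotv (x *m Y) z *+ 2 + dotv (z *m T) z.
  have -> : (6 * k = 5 * k + k)%N by lia.
  rewrite /quad big_split_ord /=.
  have xE (i : 'I_(5 * k)) : join_coord x z i = x 0 i by rewrite /join_coord ltn_ord entryE.
  have -> : \sum_(i < 5 * k) \sum_(b < 5 * k + k) Q' i b * join_coord x z i * join_coord x z b =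
      dotv (x *m Y) z.
    rewrite dotv_mulmx; apply: eq_bigr => i _.
    rewrite big_split_ord /= big1 ?add0r => [|j _]; last by rewrite Q0 ?mul0r.
    by apply: eq_bigr => j _; rewrite xE join_coord_last mxE.
  have -> : \sum_(i < k) \sum_(b < 5 * k + k) Q' (5 * k + i)%N b * join_coord x z (5 * k + i) * join_coord x z b =
      dotv (x *m Y) z + dotv (z *m T) z.
    under eq_bigr => i _ do rewrite big_split_ord /=.
    rewrite big_split /= !dotv_mulmx; congr (_ + _).
      rewrite exchange_big /=; apply: eq_bigr => i _; apply: eq_bigr => j _.
      rewrite xE join_coord_last mxE symQ; [ring | | ]; have := ltn_ord j; have := ltn_ord i; lia.
    by apply: eq_bigr => i _; apply: eq_bigr => j _; rewrite !join_coord_last mxE.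
  ring.
pose Xc a (p : 'rV[R]_(5 * k) * ('rV[R]_k * U)) := join_coord p.1 p.2.1 a.
(* The eliminated directions lie in the first factor, while the context [Hc] reads only the second,
   as [reduces] demands. *)
pose e i : 'rV[R]_(5 * k) * ('rV[R]_k * U) := (\row_j (j == i :> nat)%:R, 0).
pose Hc (p : 'rV[R]_(5 * k) * ('rV[R]_k * U)) := dotv p.2.1 (c p.2.2) *+ 2 + H p.2.2.
have lX a : scalar (Xc a).
  by move=> b x y; rewrite /Xc /join_coord; case: ifP => _; rewrite entry_linear.
have Xe a i : (a < 6 * k)%N -> (i < 5 * k)%N -> Xc a (e i) = (a == i)%:R.
  move=> am i5; rewrite /Xc /join_coord /=; case: ltnP => a5.
    by rewrite (entryE _ (Ordinal a5)) mxE.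
  rewrite (_ : (a == i) = false); last by apply/negbTE; rewrite neq_ltn (leq_trans i5 a5) orbT.
  by rewrite /entry; case: insub => // j; rewrite mxE.
have He v s i : (i < 5 * k)%N -> Hc (v + s *: e i) = Hc v.
  move=> _; rewrite /Hc; have -> // : (v + s *: e i).2 = v.2.
  by rewrite /= scaler0 addr0.
have {}negN : neg_index (fun v => quad (6 * k) Q (Xc^~ v) + Hc v) (N + d).
  apply: red lX Xe He _ _.
  by apply: neg_index_eq negN => -[x [z u]]; rewrite /Hc /= QE' !addrA.
have [|N' eN {}negN] := join_equiv rep1 rep2 lc (N := N + d) (Sx := Sx) (L1 := L1) (L2 := L2) (H := H).
  by apply: neg_index_eq negN => -[x [z u]]; rewrite /Hc /= QE addrA.
by exists N' => //; lia.
Qed.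

(** * The root of the expression *)

Lemma dotv0 n (x : 'rV[R]_n) : dotv x 0 = 0.
Proof. by rewrite /dotv big1 // => i _; rewrite mxE mulr0. Qed.

(** At the root the context is the zero space, so every variable may be eliminated and the zero form
    is left: the index of the pair is the number [d] of negative pivots. The pair is embedded in
    [6 * k] variables, the others having zero coefficients, to reuse the elimination of joins. *)
Lemma represents_root (G : lgraph k) A T cnt s (Q Q' : nat -> nat -> R) d :
  represents G A T cnt s ->
  (forall X, quad (6 * k) Q X = \sum_(a < k) \sum_(b < k)
    (A a b * X (0 * k + a)%N * X (1 * k + b)%N *+ 2
     + T a b * X (1 * k + a)%N * X (1 * k + b)%N)) ->
  reduces (6 * k) (6 * k) Q Q' d ->
  (forall a b, (a < 6 * k)%N -> (b < 6 * k)%N -> Q' a b = 0) ->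
  exists2 N, (d + cnt = N + s)%N & neg_index (@graph_form G) N.
Proof.
move=> repG QE red Q0.
have negd : neg_index (fun v : 'rV[R]_(6 * k) => quad (6 * k) Q (entry v) + 0) (0 + d).
  apply: (red _ (fun a v => entry v a) (fun i => \row_j (j == i :> nat)%:R) (fun=> 0)) => //.
  - by move=> a b x y; rewrite entry_linear.
  - by move=> a i am i6; rewrite (entryE _ (Ordinal am)) mxE.
  apply: neg_index_zero => v; rewrite addr0 /quad big1 // => a _; rewrite big1 // => b _.
  by rewrite Q0 // !mul0r.
rewrite add0n in negd.
have l0 : linear (fun _ : 'rV[R]_0 => 0 : 'rV[R]_k) by move=> a x y; rewrite scaler0 addr0.
have [|N eN negN] := repG _ _ (fun=> 0) l0 d; last first.
  exists N => //; move: negN.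
  apply: (@neg_index_equiv _ _ _ _ _ fst (fun v => (v, 0))) => // [a x y|p|v] /=.
  - by congr (_, _); rewrite [RHS]/= scaler0 addr0.
  - by rewrite dotv0 mul0rn !addr0.
  - by rewrite dotv0 mul0rn !addr0.
pose Z := 'rV[R]_k.
pose h (x : 'rV[R]_(6 * k)) : Z * (Z * 'rV[R]_0) := (block 0 x, (block 1 x, 0)).
pose h' (p : Z * (Z * 'rV[R]_0)) : 'rV[R]_(6 * k) :=
  \row_a entry (nth 0 [:: p.1; p.2.1] (a %/ k)) (a %% k).
have rvblk j (x : 'rV[R]_(6 * k)) (i : 'I_k) : (j < 6)%N -> entry x (j * k + i) = block j x 0 i.
  by move=> j6; rewrite mxE.
have F'E (x : 'rV[R]_(6 * k)) : quad (6 * k) Q (entry x) =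
    dotv (block 0 x *m A) (block 1 x) *+ 2 + dotv (block 1 x *m T) (block 1 x).
  rewrite QE !dotv_mulmx -sumrMnl -big_split; apply: eq_bigr => a _.
  rewrite -sumrMnl -big_split; apply: eq_bigr => b _.
  by rewrite !rvblk.
have blkh' p j : (j < 2)%N -> block j (h' p) = nth 0 [:: p.1; p.2.1] j.
  move=> j5; apply/rowP => i; rewrite mxE.
  have ltx : (j * k + i < 6 * k)%N by have := ltn_ord i; nia.
  rewrite (entryE _ (Ordinal ltx)) mxE /=.
  have k0 : (0 < k)%N by apply: leq_ltn_trans (ltn_ord i).
  by rewrite divnMDl // divn_small // addn0 modnMDl modn_small // entryE.
apply: (@neg_index_equiv _ _ _ _ _ h h') negd.
- by move=> a x y; rewrite /h !block_linear; congr (_, (_, _)); rewrite [RHS]/= scaler0 addr0.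
- move=> a [w [z u]] [w' [z' u']]; apply/rowP => i; rewrite !mxE -entry_linear.
  by congr entry; rewrite /=; case: (i %/ k)%N => [|[|n]] //=; rewrite ?nth_nil scaler0 addr0.
- by move=> x; rewrite /= F'E dotv0 mul0rn !addr0.
by move=> p; rewrite F'E !blkh' //= dotv0 mul0rn !addr0.
Qed.

End Nodes.

(** * Total correctness with time bounds *)

(* Over-approximations of the cells that a command may write. *)
Fixpoint imod (c : cmd) (x : nat) : bool :=
  match c with
  | CISet y _ => x == y
  | CSeq c1 c2 | CIf _ c1 c2 => imod c1 x || imod c2 x
  | CWhile _ c1 => imod c1 x
  | _ => false
  end.

Fixpoint iamod (c : cmd) (x : nat) : bool :=
  match c with
  | CIStore y _ _ => x == y
  | CSeq c1 c2 | CIf _ c1 c2 => iamod c1 x || iamod c2 x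
  | CWhile _ c1 => iamod c1 x
  | _ => false
  end.

Fixpoint rmod (c : cmd) (x : nat) : bool :=
  match c with
  | CRSet y _ => x == y
  | CSeq c1 c2 | CIf _ c1 c2 => rmod c1 x || rmod c2 x
  | CWhile _ c1 => rmod c1 x
  | _ => false
  end.

Fixpoint ramod (c : cmd) (x : nat) : bool :=
  match c with
  | CRStore y _ _ => x == y
  | CSeq c1 c2 | CIf _ c1 c2 => ramod c1 x || ramod c2 x
  | CWhile _ c1 => ramod c1 x
  | _ => false
  end.

Section Hoare.
Variable R : realType.
Implicit Types (s : state R) (c : cmd) (Q : state R -> Prop).

(** A frame condition. It is closed under composition for a fixed [c], so it can be carried through
    the iterations of a loop; arrays are tracked as a whole. *)
Record same c s s' : Prop := Same {
  same_i : forall x, ~~ imod c x -> ivar s' x = ivar s x;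
  same_ia : forall x, ~~ iamod c x -> iarr s' x = iarr s x;
  same_r : forall x, ~~ rmod c x -> rvar s' x = rvar s x;
  same_ra : forall x, ~~ ramod c x -> rarr s' x = rarr s x }.

Lemma same_trans c s1 s2 s3 : same c s1 s2 -> same c s2 s3 -> same c s1 s3.
Proof.
case=> i1 ia1 r1 ra1 [i2 ia2 r2 ra2]; split=> x Hx.
- by rewrite i2 ?i1.
- by rewrite ia2 ?ia1.
- by rewrite r2 ?r1.
by rewrite ra2 ?ra1.
Qed.

Lemma same_mono c c' s s' :
  (forall x, imod c x -> imod c' x) -> (forall x, iamod c x -> iamod c' x) ->
  (forall x, rmod c x -> rmod c' x) -> (forall x, ramod c x -> ramod c' x) ->
  same c s s' -> same c' s s'.
Proof.
move=> mi mia mr mra [i ia r ra]; split=> x Hx.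
- by apply: i; apply: contraNN Hx; apply: mi.
- by apply: ia; apply: contraNN Hx; apply: mia.
- by apply: r; apply: contraNN Hx; apply: mr.
by apply: ra; apply: contraNN Hx; apply: mra.
Qed.

Lemma exec_same c s s' t : exec c s s' t -> same c s s'.
Proof.
elim=> {c s s' t}.
- by [].
- by move=> s x e; split=> // y /= /negbTE yx; rewrite /upd yx.
- by move=> s a p e; split=> // y /= /negbTE yx; rewrite /upd2 /upd yx.
- by move=> s x e; split=> // y /= /negbTE yx; rewrite /upd yx.
- by move=> s a p e; split=> // y /= /negbTE yx; rewrite /upd2 /upd yx.
- move=> c1 c2 s1 s2 s3 t1 t2 _ IH1 _ IH2; apply: (same_trans (s2 := s2)).
    by apply: same_mono IH1 => x /= ->.
  by apply: same_mono IH2 => x /= ->; rewrite orbT.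
- move=> b c1 c2 s s' t _; case: (beval s b) => IH.
    by apply: same_mono IH => x /= ->.
  by apply: same_mono IH => x /= ->; rewrite orbT.
- by [].
- by move=> b c s1 s2 s3 t1 t2 _ _ IH1 _ IH2; apply: same_trans IH2; apply: same_mono IH1.
Qed.

Lemma same_seql c1 c2 s s' : same c1 s s' -> same (CSeq c1 c2) s s'.
Proof. by apply: same_mono => x /= ->. Qed.

Lemma same_seqr c1 c2 s s' : same c2 s s' -> same (CSeq c1 c2) s s'.
Proof. by apply: same_mono => x /= ->; rewrite orbT. Qed.

Lemma same_ifl b c1 c2 s s' : same c1 s s' -> same (CIf b c1 c2) s s'.
Proof. by apply: same_mono => x /= ->. Qed.

(** Existence of a run includes termination, and [T] is only an upper bound, so costs can be rounded
    up at any point by [wp_conseq]. *)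
Definition wp c s T Q := exists s' t, [/\ exec c s s' t, (t <= T)%N & Q s'].

Lemma wp_conseq c s T T' Q Q' :
  wp c s T Q -> (T <= T')%N -> (forall s', Q s' -> Q' s') -> wp c s T' Q'.
Proof.
by case=> s' [t [ex tT q]] TT' qq; exists s', t; split; [|exact: leq_trans TT'|exact: qq].
Qed.

Lemma wp_same c s T Q : wp c s T Q -> wp c s T (fun s' => same c s s' /\ Q s').
Proof.
by case=> s' [t [ex tT q]]; exists s', t; split=> //; split=> //; apply: exec_same ex.
Qed.

Lemma wp_skip s Q : Q s -> wp CSkip s 1 Q.
Proof. by move=> q; exists s, 1%N; split=> //; constructor. Qed.

Lemma wp_iset x e s Q : Q (set_ivar s x (ieval s e)) -> wp (CISet x e) s (icost e).+1 Q.
Proof. by move=> q; exists (set_ivar s x (ieval s e)), (icost e).+1; split=> //; constructor. Qed.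

Lemma wp_rset x e s Q : Q (set_rvar s x (reval s e)) -> wp (CRSet x e) s (rcost e).+1 Q.
Proof. by move=> q; exists (set_rvar s x (reval s e)), (rcost e).+1; split=> //; constructor. Qed.

Lemma wp_rstore a p e s Q :
  Q (set_rarr s a (ieval s p) (reval s e)) -> wp (CRStore a p e) s (icost p + rcost e).+1 Q.
Proof.
by move=> q; exists (set_rarr s a (ieval s p) (reval s e)), (icost p + rcost e).+1;
  split=> //; constructor.
Qed.

Lemma wp_seq c1 c2 s T1 T2 Q :
  wp c1 s T1 (fun s' => wp c2 s' T2 Q) -> wp (CSeq c1 c2) s (T1 + T2) Q.
Proof.
case=> s1 [t1 [ex1 le1 [s2 [t2 [ex2 le2 q]]]]].
by exists s2, (t1 + t2)%N; split; [apply: ExSeq ex1 ex2 | exact: leq_add |].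
Qed.

(** Charging both branches instead of the larger one keeps bounds plain sums, at the price of a
    constant factor. *)
Lemma wp_if b c1 c2 s T1 T2 Q :
  (beval s b -> wp c1 s T1 Q) -> (~~ beval s b -> wp c2 s T2 Q) ->
  wp (CIf b c1 c2) s (bcost b + (T1 + T2)).+1 Q.
Proof.
move=> H1 H2.
have : wp (if beval s b then c1 else c2) s (T1 + T2) Q.
  case: ifPn => [/H1|/H2] H; apply: wp_conseq H _ _ => //; [exact: leq_addr | exact: leq_addl].
case=> s' [t [ex le q]]; exists s', (bcost b + t).+1; split=> //; first by constructor.
by rewrite ltnS leq_add2l.
Qed.

Lemma wp_while b c s T1 T2 Q : beval s b ->
  wp c s T1 (fun s' => wp (CWhile b c) s' T2 Q) ->
  wp (CWhile b c) s (bcost b + T1 + T2).+1 Q.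
Proof.
move=> sb [s1 [t1 [ex1 le1 [s2 [t2 [ex2 le2 q]]]]]].
exists s2, (bcost b + t1 + t2).+1; split=> //; first exact: ExWhileT ex2.
by rewrite ltnS leq_add // leq_add2l.
Qed.

Lemma wp_while_stop b c s Q : ~~ beval s b -> Q s -> wp (CWhile b c) s (bcost b).+1 Q.
Proof. by move=> sb q; exists s, (bcost b).+1; split=> //; constructor. Qed.

(** * Counting loops *)

Definition cfor x e c :=
  CSeq (CISet x (IConst 0))
    (CWhile (BILt (IVar x) e) (CSeq c (CISet x (IAdd (IVar x) (IConst 1))))).

Lemma same_for x e c s s' : same c s s' -> same (cfor x e c) s s'.
Proof. by apply: same_mono => y /= ->; rewrite ?orbT. Qed.

Lemma wp_for x e c s N B T (I : nat -> state R -> Prop) :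
  ~~ imod c x ->
  (forall s', same (cfor x e c) s s' -> ieval s' e = N) -> (N < B)%N ->
  I 0 (set_ivar s x 0) ->
  (forall i s', (i < N)%N -> ivar s' x = i -> same (cfor x e c) s s' -> I i s' ->
     wp c s' T (fun s'' => I i.+1 (set_ivar s'' x i.+1))) ->
  wp (cfor x e c) s (B * (T + icost e + 8))
     (fun s' => same (cfor x e c) s s' /\ I N s').
Proof.
move=> cx eN ltNB I0 IS.
apply: (@wp_conseq _ _ (2 + (N * (T + icost e + 7) + (icost e + 3)))
         _ (fun s' => same (cfor x e c) s s' /\ I N s')) => //; last first.
  have : (N.+1 * (T + icost e + 8) <= B * (T + icost e + 8))%N by rewrite leq_mul2r ltNB orbT.
  nia.
apply: wp_seq; apply: (@wp_iset x (IConst 0)) => /=.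
set W := CWhile _ _.
have main m i s' : (i + m = N)%N -> ivar s' x = i -> same (cfor x e c) s s' -> I i s' ->
    wp W s' (m * (T + icost e + 7) + (icost e + 3)) (fun s' => same (cfor x e c) s s' /\ I N s').
  elim: m i s' => [|m IH] i s' im s'x ss' Is'.
    have iN : i = N by rewrite -im addn0.
    have stop : ~~ beval s' (BILt (IVar x) e) by rewrite /= eN // s'x iN ltnn.
    have := wp_while_stop (Q := fun s' => same (cfor x e c) s s' /\ I N s') _ stop.
    rewrite -/W => /(_ (CSeq c (CISet x (IAdd (IVar x) (IConst 1))))) H.
    rewrite iN in Is'; apply: wp_conseq (H (conj ss' Is')) _ (fun=> id).
    by rewrite /= add0n addn3 add1n.
  have ltiN : (i < N)%N by rewrite -im addnS ltnS leq_addr.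
  apply: (wp_conseq (T := (bcost (BILt (IVar x) e) + (T + 4)
     + (m * (T + icost e + 7) + (icost e + 3))).+1) _ _ (fun=> id)).
    apply: wp_while; first by rewrite /= eN // s'x.
    apply: wp_seq; apply: wp_conseq (wp_same (IS i s' ltiN s'x ss' Is')) (leqnn _) _.
    move=> s1 [ss1 Is1]; apply: (@wp_iset x (IAdd (IVar x) (IConst 1))).
    have -> : ieval s1 (IAdd (IVar x) (IConst 1)) = i.+1.
      by rewrite /= (same_i ss1) // s'x addn1.
    apply: (IH i.+1) => //; [by rewrite -im addSnnS | by rewrite /= /upd eqxx |].
    apply: same_trans ss' _; apply: (same_trans (s2 := s1)).
      by apply: same_mono ss1 => z /= ->; rewrite ?orbT.
    by split=> // z /=; rewrite !negb_or /upd => /andP[/negbTE ->].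
  by rewrite /= mulSn; lia.
apply: (main N 0%N) => //; first by rewrite /= /upd eqxx.
by split=> // z /=; rewrite !negb_or /upd => /andP[/negbTE ->].
Qed.

End Hoare.

(** * Building the form of a join *)

Local Notation "c1 ;; c2" := (CSeq c1 c2) (at level 90, right associativity).
Local Infix "#+" := IAdd (at level 50, left associativity).
Local Infix "#-" := ISub (at level 50, left associativity).
Local Infix "#*" := IMul (at level 40, left associativity).

(* Natural variables: vcnt counts negative pivots, vpos is the reading position,
   vsp the stack height, vM = 6k the width of Q.  Real variables: rsg and rdg are
   the factor of the edges and the diagonal entry.  Real arrays: 0 holds the
   matrix Q of the current join, row by row, 1 and 2 the stacks of the matrices
   A and T, 3 the pivot row. *)
Local Notation vk := 0%N.
Local Notation vn := 1%N.
Local Notation vcnt := 4%N.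
Local Notation vpos := 5%N.
Local Notation vsp := 6%N.
Local Notation vtok := 7%N.
Local Notation va := 8%N.
Local Notation vb := 9%N.
Local Notation vr := 10%N.
Local Notation vi := 11%N.
Local Notation vj := 12%N.
Local Notation vM := 13%N.
Local Notation vlow := 14%N.
Local Notation rsg := 2%N.
Local Notation rdg := 3%N.
Local Notation ral := 4%N.
Local Notation rd := 5%N.
Local Notation racc := 6%N.

Definition qidx (r c : iexp) := r #* IVar vM #+ c.
Definition qget r c := RLoad 0 (qidx r c).
Definition qadd r c v := CRStore 0 (qidx r c) (RAdd (qget r c) v).
Definition qsym r c v := qadd r c v ;; qadd c r v.
Definition sidx (h a b : iexp) := (h #* IVar vk #+ a) #* IVar vk #+ b.
Definition off j a := IConst j #* IVar vk #+ a.
(** The only real constants of the machine are 0 and 1. *)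
Definition rhalf := RDiv ROne (RAdd ROne ROne).
Definition rmone := RSub RZero ROne.

Definition clearQ := cfor va (IVar vM #* IVar vM) (CRStore 0 (IVar va) RZero).

(* [qsym] writes an entry and its transpose, so T is loaded as T / 2. *)
Definition loadQ (h : iexp) (j : nat) :=
  cfor va (IVar vk) (cfor vb (IVar vk) (
    qsym (off j (IVar va)) (off j.+1 (IVar vb)) (RLoad 1 (sidx h (IVar va) (IVar vb))) ;;
    qsym (off j.+1 (IVar va)) (off j.+1 (IVar vb))
      (RMul rhalf (RLoad 2 (sidx h (IVar va) (IVar vb)))))).

Definition loadS :=
  cfor va (IVar vk) (cfor vb (IVar vk) (
    CIf (BIEq (ILoad 0 (IVar vpos #+ IConst 1 #+ (IVar va #* IVar vk #+ IVar vb))) (IConst 1))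
      (qsym (off 1 (IVar va)) (off 3 (IVar vb)) (RVar rsg)) CSkip)).

(** A join token is its tag, then k * k bits, then the values of [L], then those of [R], whence the
    offsets. *)
Definition labL := ILoad 0 (IVar vpos #+ IConst 1 #+ (IVar vk #* IVar vk #+ IVar va)).
Definition labR :=
  ILoad 0 (IVar vpos #+ IConst 1 #+ (IVar vk #* IVar vk #+ (IVar vk #+ IVar va))).

Definition loadLR :=
  cfor va (IVar vk) (
    qsym (off 4 (IVar va)) (off 5 (IVar va)) ROne ;;
    qsym (off 1 (IVar va)) (off 4 labL) rmone ;;
    qsym (off 3 (IVar va)) (off 4 labR) rmone).

Section Build.
Variables (R : realType) (k : nat).
Hypothesis k_gt0 : (0 < k)%N.
Implicit Types s : state R.
Let M := (6 * k)%N.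

Definition mat (m : nat) s (a b : nat) : R := rarr s 0 (a * m + b)%N.

Lemma flat_eq m a b r c : (b < m)%N -> (c < m)%N ->
  (a * m + b == r * m + c)%N = (a == r) && (b == c).
Proof.
move=> bm cm; apply/eqP/andP => [e|[/eqP -> /eqP ->] //].
have m0 : (0 < m)%N by apply: leq_ltn_trans bm.
have := congr1 (divn^~ m) e; rewrite /= !divnMDl // !divn_small // !addn0 => ar.
by split; apply/eqP => //; move: e; rewrite ar => /addnI.
Qed.

Lemma mat_set m s r c w a b : (b < m)%N -> (c < m)%N ->
  mat m (set_rarr s 0 (r * m + c) w) a b = if (a == r) && (b == c) then w else mat m s a b.
Proof. by move=> bm cm; rewrite /mat /= /upd2 /upd eqxx flat_eq. Qed.

Lemma ieval_set_rarr s a p w e : ieval (set_rarr s a p w) e = ieval s e.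
Proof. by elim: e => //= [? ? ->|? -> ? ->|? -> ? ->|? -> ? ->]. Qed.

(** The matrix is specified by symmetry and by its form alone. Each write then just adds a term to
    the form, even if several writes hit the same cell. *)
Definition quad_spec s (f : (nat -> R) -> R) :=
  symmetric_below M (mat M s) /\ forall X, quad M (mat M s) X = f X.

Lemma quad_spec_ext s f g : quad_spec s f -> (forall X, f X = g X) -> quad_spec s g.
Proof. by case=> sy fE fg; split=> // X; rewrite fE. Qed.

Lemma quad_add m Q Q' r c (v : R) X : (r < m)%N -> (c < m)%N ->
  (forall a b, (a < m)%N -> (b < m)%N ->
     Q' a b = Q a b + (if (a == r) && (b == c) then v else 0)) ->
  quad m Q' X = quad m Q X + v * X r * X c.
Proof.
move=> rm cm QE; rewrite /quad.
have -> : v * X r * X c = \sum_(a < m) \sum_(b < m)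
    (if (a == r :> nat) && (b == c :> nat) then v else 0) * X a * X b.
  rewrite (bigD1 (Ordinal rm)) //= [X in _ + X]big1 ?addr0 => [|a ar]; last first.
    rewrite big1 // => b _; have /negbTE -> : (a != r :> nat) by exact: ar.
    by rewrite /= !mul0r.
  rewrite (bigD1 (Ordinal cm)) //= !eqxx big1 ?addr0 // => b bc.
  have /negbTE -> : (b != c :> nat) by exact: bc.
  by rewrite !mul0r.
rewrite -big_split; apply: eq_bigr => a _; rewrite -big_split; apply: eq_bigr => b _.
by rewrite QE // /= -!mulrDl.
Qed.

(** For [r0 = c0] both writes hit the same diagonal cell, and the term is still doubled. The value
    [v] must not read array 0, because it is evaluated again after the first write. *)
Lemma wp_qsym r c v s f r0 c0 : ivar s vM = M ->
  ieval s r = r0 -> ieval s c = c0 -> (r0 < M)%N -> (c0 < M)%N ->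
  (forall p w, reval (set_rarr s 0 p w) v = reval s v) -> quad_spec s f ->
  wp (qsym r c v) s (4 * (icost r + icost c) + 2 * rcost v + 18)
    (fun s' => quad_spec s' (fun X => f X + reval s v * X r0 * X c0 *+ 2)).
Proof.
move=> sM er ec rm cm ev [sy fE].
suff H : quad_spec (set_rarr (set_rarr s 0 (ieval s (qidx r c)) (reval s (RAdd (qget r c) v))) 0
      (ieval (set_rarr s 0 (ieval s (qidx r c)) (reval s (RAdd (qget r c) v))) (qidx c r))
      (reval (set_rarr s 0 (ieval s (qidx r c)) (reval s (RAdd (qget r c) v))) (RAdd (qget c r) v)))
    (fun X => f X + reval s v * X r0 * X c0 *+ 2).
  by apply: wp_conseq (wp_seq (wp_rstore (wp_rstore H))) _ (fun=> id) => /=; lia.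
rewrite /= !ieval_set_rarr /= er ec sM ev.
set s1 := set_rarr s 0 _ _; set s2 := set_rarr s1 _ _ _.
have e1 a b : (a < M)%N -> (b < M)%N -> mat M s1 a b =
    mat M s a b + (if (a == r0) && (b == c0) then reval s v else 0).
  move=> am bm; rewrite mat_set //; case: ifP => [/andP[/eqP -> /eqP ->] //|_].
  by rewrite addr0.
have e2 a b : (a < M)%N -> (b < M)%N -> mat M s2 a b =
    mat M s1 a b + (if (a == c0) && (b == r0) then reval s v else 0).
  move=> am bm; rewrite mat_set //; case: ifP => [/andP[/eqP -> /eqP ->] //|_].
  by rewrite addr0.
split=> [a b am bm|X].
  by rewrite !e2 // !e1 // (sy a b) // (andbC (b == c0)) (andbC (b == r0)) addrAC.
rewrite (quad_add X cm rm e2) (quad_add X rm cm e1) fE; ring.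
Qed.

Lemma wp_for_acc x e c s N B T f g :
  ~~ imod c x -> (forall s', same (cfor x e c) s s' -> ieval s' e = N) -> (N < B)%N ->
  quad_spec s f ->
  (forall i s' f', (i < N)%N -> ivar s' x = i -> same (cfor x e c) s s' -> quad_spec s' f' ->
     wp c s' T (fun s'' => quad_spec s'' (fun X => f' X + g i X))) ->
  wp (cfor x e c) s (B * (T + icost e + 8))
    (fun s' => same (cfor x e c) s s' /\ quad_spec s' (fun X => f X + \sum_(i < N) g i X)).
Proof.
move=> cx eN NB Ps H.
apply: (@wp_for R x e c s N B T (fun i s' => quad_spec s' (fun X => f X + \sum_(j < i) g j X))) => //.
  by apply: quad_spec_ext Ps _ => X; rewrite big_ord0 addr0.
move=> i s' iN s'x ss' Ps'; apply: wp_conseq (H i s' _ iN s'x ss' Ps') _ _ => // s''.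
by move=> Ps''; apply: quad_spec_ext Ps'' _ => X; rewrite big_ord_recr /= addrA.
Qed.

Lemma wp_clearQ s : ivar s vk = k -> ivar s vM = M ->
  wp clearQ s (800 * (k * k)) (fun s' => same clearQ s s' /\ quad_spec s' (fun=> 0)).
Proof.
move=> sk sM.
have H := @wp_for R va (IVar vM #* IVar vM) (CRStore 0 (IVar va) RZero) s (M * M) (M * M).+1 3
  (fun i s' => forall x, (x < i)%N -> rarr s' 0 x = 0).
have {}H := H isT _ (leqnn _) _ _.
apply: wp_conseq (H _ _ _) _ _ => {H} [s' ss'|//|i s' iM s'a ss' I||].
- by rewrite /= (same_i ss') // sM.
- apply: wp_conseq (wp_rstore (Q := _) _) (leqnn _) (fun=> id) => x.
  rewrite /= s'a /upd2 /upd eqxx ltnS leq_eqVlt.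
  by case: eqP => //= _; apply: I.
- by rewrite /= /M; nia.
move=> s' [ss' I]; split=> //.
have m0 a b : (a < M)%N -> (b < M)%N -> mat M s' a b = 0.
  move=> am bm; apply: I; rewrite -[X in (_ < X * _)%N](ltn_predK am) mulSn addnC.
  rewrite -addSn leq_add // leq_mul2r; apply/orP; right.
  by rewrite -ltnS (ltn_predK am).
split=> [a b am bm|X]; first by rewrite !m0.
rewrite /quad big1 // => a _; rewrite big1 // => b _.
by rewrite m0 // !mul0r.
Qed.

Definition slot (i : nat) s (h a b : nat) : R := rarr s i ((h * k + a) * k + b)%N.

Lemma block_lt j a n : (j < n)%N -> (a < k)%N -> (j * k + a < n * k)%N.
Proof. nia. Qed.

Lemma wp_loadQ h j h0 s f : ivar s vk = k -> ivar s vM = M ->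
  (forall s', same (loadQ h j) s s' -> ieval s' h = h0) -> (icost h <= 3)%N -> (j < 5)%N ->
  quad_spec s f ->
  wp (loadQ h j) s (1000 * (k * k)) (fun s' => same (loadQ h j) s s' /\
    quad_spec s' (fun X => f X + \sum_(a < k) \sum_(b < k)
      (slot 1 s h0 a b * X (j * k + a)%N * X (j.+1 * k + b)%N *+ 2
       + slot 2 s h0 a b * X (j.+1 * k + a)%N * X (j.+1 * k + b)%N))).
Proof.
move=> sk sM hE hc j5 Ps.
apply: wp_conseq (wp_for_acc (N := k) (B := 2 * k) (T := 2 * k * (200 + 1 + 8)) (f := f)
  (g := fun a X => \sum_(b < k)
      (slot 1 s h0 a b * X (j * k + a)%N * X (j.+1 * k + b)%N *+ 2
       + slot 2 s h0 a b * X (j.+1 * k + a)%N * X (j.+1 * k + b)%N)) _ _ _ Ps _) _ (fun=> id) => //.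
- by move=> s' ss'; rewrite /= (same_i ss').
- by lia.
- move=> a s1 f1 ak s1a ss1 Ps1.
  apply: wp_conseq (wp_for_acc (N := k) (B := 2 * k) (T := 200) (f := f1)
    (g := fun b X => slot 1 s h0 a b * X (j * k + a)%N * X (j.+1 * k + b)%N *+ 2
       + slot 2 s h0 a b * X (j.+1 * k + a)%N * X (j.+1 * k + b)%N) _ _ _ Ps1 _) (leqnn _) _ => //.
  + by move=> s' ss'; rewrite /= (same_i ss') // (same_i ss1).
  + by lia.
  + move=> b s2 f2 bk s2b ss2 Ps2.
    have s2a : ivar s2 va = a by rewrite (same_i ss2).
    have s2k : ivar s2 vk = k by rewrite (same_i ss2) // (same_i ss1).
    have s2M : ivar s2 vM = M by rewrite (same_i ss2) // (same_i ss1).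
    have ss : same (loadQ h j) s s2.
      by apply: same_trans ss1 _; apply: same_for.
    have s2A : rarr s2 1 = rarr s 1 by rewrite (same_ra ss).
    have s2T : rarr s2 2 = rarr s 2 by rewrite (same_ra ss).
    have s2h := hE _ ss.
    have er : ieval s2 (off j (IVar va)) = (j * k + a)%N by rewrite /= s2k s2a.
    have ec : ieval s2 (off j.+1 (IVar vb)) = (j.+1 * k + b)%N by rewrite /= s2k s2b.
    have ltr : (j * k + a < M)%N by apply: block_lt => //; apply: ltnW.
    have ltc : (j.+1 * k + b < M)%N by apply: block_lt.
    have ltc' : (j.+1 * k + a < M)%N by apply: block_lt.
    have W := wp_qsym (v := RLoad 1 (sidx h (IVar va) (IVar vb))) s2M er ec ltr ltc _ Ps2.
    apply: wp_conseq (wp_seq (wp_conseq (wp_same (W _)) (leqnn _) _)) _ (fun=> id).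
    * by move=> p w; rewrite /= !ieval_set_rarr.
    * move=> s3 [ss3 Ps3].
      have s3k : ivar s3 vk = k by rewrite (same_i ss3).
      have s3M : ivar s3 vM = M by rewrite (same_i ss3).
      have s3a : ivar s3 va = a by rewrite (same_i ss3).
      have s3b : ivar s3 vb = b by rewrite (same_i ss3).
      have s3T : rarr s3 2 = rarr s 2 by rewrite (same_ra ss3).
      have s3h : ieval s3 h = h0.
        apply: hE; apply: same_trans ss _; apply/same_for/same_for.
        exact: same_seql.
      have er' : ieval s3 (off j.+1 (IVar va)) = (j.+1 * k + a)%N by rewrite /= s3k s3a.
      have ec' : ieval s3 (off j.+1 (IVar vb)) = (j.+1 * k + b)%N by rewrite /= s3k s3b.
      have W' := wp_qsym (v := RMul rhalf (RLoad 2 (sidx h (IVar va) (IVar vb))))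
        s3M er' ec' ltc' ltc _ Ps3.
      apply: wp_conseq (W' _) (leqnn _) _ => [p w|s4 Ps4].
        by rewrite /= !ieval_set_rarr.
      apply: quad_spec_ext Ps4 _ => X.
      rewrite /= s2h s2k s2a s2b s2A s3h s3k s3a s3b s3T /slot; field.
    * by [].
    by rewrite /=; lia.
  by move=> s' [].
by rewrite /=; nia.
Qed.

Lemma wp_loadS s f : ivar s vk = k -> ivar s vM = M -> quad_spec s f ->
  wp loadS s (1000 * (k * k)) (fun s' => same loadS s s' /\
    quad_spec s' (fun X => f X + \sum_(a < k) \sum_(b < k)
      rvar s rsg * (iarr s 0 (ivar s vpos + 1 + (a * k + b)) == 1)%:R
        * X (1 * k + a)%N * X (3 * k + b)%N *+ 2)).
Proof.
move=> sk sM Ps.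
pose g a b (X : nat -> R) := rvar s rsg * (iarr s 0 (ivar s vpos + 1 + (a * k + b)) == 1)%:R
        * X (1 * k + a)%N * X (3 * k + b)%N *+ 2.
apply: wp_conseq (wp_for_acc (N := k) (B := 2 * k) (T := 2 * k * (200 + 1 + 8)) (f := f)
  (g := fun a X => \sum_(b < k) g a b X) _ _ _ Ps _) _ (fun=> id) => //.
- by move=> s' ss'; rewrite /= (same_i ss').
- by lia.
- move=> a s1 f1 ak s1a ss1 Ps1.
  apply: wp_conseq (wp_for_acc (N := k) (B := 2 * k) (T := 200) (f := f1)
    (g := g a) _ _ _ Ps1 _) (leqnn _) _ => //.
  + by move=> s' ss'; rewrite /= (same_i ss') // (same_i ss1).
  + by lia.
  + move=> b s2 f2 bk s2b ss2 Ps2.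
    have s2a : ivar s2 va = a by rewrite (same_i ss2).
    have s2k : ivar s2 vk = k by rewrite (same_i ss2) // (same_i ss1).
    have s2M : ivar s2 vM = M by rewrite (same_i ss2) // (same_i ss1).
    have s2p : ivar s2 vpos = ivar s vpos by rewrite (same_i ss2) // (same_i ss1).
    have s2i : iarr s2 0 = iarr s 0 by rewrite (same_ia ss2) // (same_ia ss1).
    have s2s : rvar s2 rsg = rvar s rsg by rewrite (same_r ss2) // (same_r ss1).
    apply: wp_conseq (wp_if (T1 := 100) (T2 := 1) _ _) _ (fun=> id) => //=.
    * rewrite s2i s2p s2a s2b s2k => bit.
      have er : ieval s2 (off 1 (IVar va)) = (1 * k + a)%N by rewrite /= s2k s2a.
      have ec : ieval s2 (off 3 (IVar vb)) = (3 * k + b)%N by rewrite /= s2k s2b.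
      have W := wp_qsym (v := RVar rsg) s2M er ec (block_lt _ ak) (block_lt _ bk) _ Ps2.
      apply: wp_conseq (W _ _ _) _ _ => //= s3 Ps3.
      by apply: quad_spec_ext Ps3 _ => X; rewrite s2s /g bit mulr1.
    rewrite s2i s2p s2a s2b s2k => /negbTE bit; apply: wp_skip.
    by apply: quad_spec_ext Ps2 _ => X; rewrite /g bit mulr0 !mul0r mul0rn addr0.
  by move=> s' [].
by rewrite /=; nia.
Qed.

Lemma wp_loadLR s f (L1 L2 : nat -> nat) : ivar s vk = k -> ivar s vM = M ->
  (forall a, (a < k)%N -> iarr s 0 (ivar s vpos + 1 + (k * k + a)) = L1 a /\ (L1 a < k)%N) ->
  (forall a, (a < k)%N -> iarr s 0 (ivar s vpos + 1 + (k * k + (k + a))) = L2 a /\ (L2 a < k)%N) ->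
  quad_spec s f ->
  wp loadLR s (1000 * k) (fun s' => same loadLR s s' /\
    quad_spec s' (fun X => f X + \sum_(a < k) (X (4 * k + a)%N * X (5 * k + a)%N
      - X (1 * k + a)%N * X (4 * k + L1 a)%N
      - X (3 * k + a)%N * X (4 * k + L2 a)%N) *+ 2)).
Proof.
move=> sk sM HL1 HL2 Ps.
apply: wp_conseq (wp_for_acc (N := k) (B := 2 * k) (T := 400) (f := f)
  (g := fun a X => (X (4 * k + a)%N * X (5 * k + a)%N
      - X (1 * k + a)%N * X (4 * k + L1 a)%N
      - X (3 * k + a)%N * X (4 * k + L2 a)%N) *+ 2) _ _ _ Ps _) _ (fun=> id) => //.
- by move=> s' ss'; rewrite /= (same_i ss').
- by lia.
- move=> a s1 f1 ak s1a ss1 Ps1.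
  have [L1E L1k] := HL1 _ ak; have [L2E L2k] := HL2 _ ak.
  have s1k : ivar s1 vk = k by rewrite (same_i ss1).
  have s1M : ivar s1 vM = M by rewrite (same_i ss1).
  have s1p : ivar s1 vpos = ivar s vpos by rewrite (same_i ss1).
  have s1i : iarr s1 0 = iarr s 0 by rewrite (same_ia ss1).
  have er j : ieval s1 (off j (IVar va)) = (j * k + a)%N by rewrite /= s1k s1a.
  have eL1 : ieval s1 (off 4 labL) = (4 * k + L1 a)%N by rewrite /= s1k s1a s1p s1i L1E.
  have eL2 : ieval s1 (off 4 labR) = (4 * k + L2 a)%N by rewrite /= s1k s1a s1p s1i L2E.
  (* The dummy command stands for its footprint, real array 0; index expressions do not depend on
     that array. *)
  have stable s2 e : same (CSeq (qadd (IConst 0) (IConst 0) RZero) CSkip) s1 s2 ->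
      ieval s2 e = ieval s1 e.
    move=> ss2; elim: e => //= [x|x e ->|e1 -> e2 ->|e1 -> e2 ->|e1 -> e2 ->] //.
      by rewrite (same_i ss2).
    by rewrite (same_ia ss2).
  have W1 := wp_qsym (v := ROne) s1M (er 4) (er 5) (block_lt _ ak) (block_lt _ ak) _ Ps1.
  have {}W1 := wp_same (W1 isT isT (fun _ _ => erefl)).
  have lt4 x : (x < k)%N -> (4 * k + x < M)%N by apply: block_lt.
  apply: wp_conseq (wp_seq (wp_conseq W1 (leqnn _) _)) _ (fun=> id).
  + move=> s2 [/(same_mono (c' := CSeq (qadd (IConst 0) (IConst 0) RZero) CSkip)) ss2 Ps2].
    have {}ss2 : same (CSeq (qadd (IConst 0) (IConst 0) RZero) CSkip) s1 s2.
      by apply: ss2 => // x /=; rewrite orbF orbb.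
    have s2M : ivar s2 vM = M by rewrite (same_i ss2).
    have W2 := wp_qsym (v := rmone) s2M (etrans (stable _ _ ss2) (er 1))
       (etrans (stable _ _ ss2) eL1) (block_lt _ ak) (lt4 _ L1k) _ Ps2.
    have {}W2 := wp_same (W2 isT (fun _ _ => erefl)).
    apply: wp_conseq (wp_seq (wp_conseq W2 (leqnn _) _)) (leqnn _) (fun=> id).
    move=> s3 [/(same_mono (c' := CSeq (qadd (IConst 0) (IConst 0) RZero) CSkip)) ss3 Ps3].
    have {}ss3 : same (CSeq (qadd (IConst 0) (IConst 0) RZero) CSkip) s1 s3.
      by apply: same_trans ss2 (ss3 _ _ _ _) => // x /=; rewrite orbF orbb.
    have s3M : ivar s3 vM = M by rewrite (same_i ss3).
    have W3 := wp_qsym (v := rmone) s3M (etrans (stable _ _ ss3) (er 3))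
       (etrans (stable _ _ ss3) eL2) (block_lt _ ak) (lt4 _ L2k) _ Ps3.
    apply: wp_conseq (W3 isT (fun _ _ => erefl)) (leqnn _) _ => s4 Ps4.
    by apply: quad_spec_ext Ps4 _ => X; rewrite /=; ring.
  by rewrite /=; lia.
by rewrite /=; nia.
Qed.

End Build.

(** * Elimination program *)

(** [vj = vi] encodes failure, which is unambiguous since the search runs only if the diagonal entry
    is zero. There is no early exit: the last nonzero column wins. *)
Definition searchc (nb : iexp) :=
  CISet vj (IVar vi) ;;
  cfor vb nb (CIf (BREq (qget (IVar vi) (IVar vb)) RZero) CSkip (CISet vj (IVar vb))).

Definition addrowc :=
  cfor vb (IVar vM) (CRStore 0 (qidx (IVar vi) (IVar vb))
    (RAdd (qget (IVar vi) (IVar vb)) (RMul (RVar ral) (qget (IVar vj) (IVar vb))))).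

Definition addcolc :=
  cfor vb (IVar vM) (CRStore 0 (qidx (IVar vb) (IVar vi))
    (RAdd (qget (IVar vb) (IVar vi)) (RMul (RVar ral) (qget (IVar vb) (IVar vj))))).

(* When Q i i = 0 and Q i j != 0, adding +-1 times the j-th basis vector to the
   i-th one makes the i-th diagonal entry 2 (+- Q i j) + Q j j, which is nonzero
   for at least one of the signs. *)
Definition addrcc :=
  CIf (BREq (RAdd (qget (IVar vj) (IVar vj))
             (RAdd (qget (IVar vi) (IVar vj)) (qget (IVar vi) (IVar vj)))) RZero)
    (CRSet ral rmone) (CRSet ral ROne) ;;
  addrowc ;; addcolc.

Definition fixdiagc nb :=
  CIf (BREq (qget (IVar vi) (IVar vi)) RZero)
    (searchc nb ;; CIf (BIEq (IVar vj) (IVar vi)) CSkip addrcc) CSkip.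

(** Elimination works in place and overwrites row [i] while later rows still need it. *)
Definition copyrowc := cfor vb (IVar vM) (CRStore 3 (IVar vb) (qget (IVar vi) (IVar vb))).

Definition elimc :=
  cfor va (IVar vM) (cfor vb (IVar vM) (CRStore 0 (qidx (IVar va) (IVar vb))
    (RSub (qget (IVar va) (IVar vb))
       (RDiv (RMul (RLoad 3 (IVar va)) (RLoad 3 (IVar vb))) (RVar rd))))).

Definition pivotc :=
  CRSet rd (qget (IVar vi) (IVar vi)) ;;
  CIf (BRLt (RVar rd) RZero) (CISet vcnt (IVar vcnt #+ IConst 1)) CSkip ;;
  copyrowc ;; elimc.

(* One pass suffices: once row i has been treated it vanishes on the eliminated
   variables, and later steps keep it so. *)
Definition reducec nb :=
  cfor vi nb (fixdiagc nb ;;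
    CIf (BREq (qget (IVar vi) (IVar vi)) RZero) CSkip pivotc).

Section Reduce.
Variables (R : realType) (k : nat).
Hypothesis k_gt0 : (0 < k)%N.
Implicit Types s : state R.
Let M := (6 * k)%N.

Lemma reduces_eqr N m (Q Q' Q'' : nat -> nat -> R) d : reduces m N Q Q' d ->
  (forall a b, (a < m)%N -> (b < m)%N -> Q'' a b = Q' a b) -> reduces m N Q Q'' d.
Proof.
move=> red eqQ V X e H lX Xe He n nF; apply: red lX Xe He _ _.
by apply: neg_index_eq nF => v; rewrite (quad_ext _ eqQ).
Qed.

Lemma wp_searchc nb s i N : ivar s vi = i -> ivar s vM = M -> (i < N)%N -> (N <= M)%N ->
  (forall s', same (reducec nb) s s' -> ieval s' nb = N) -> icost nb = 3%N ->
  mat M s i i = 0 ->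
  wp (searchc nb) s (500 * k) (fun s' =>
    (ivar s' vj = i /\ forall b, (b < N)%N -> mat M s i b = 0) \/
    [/\ ivar s' vj <> i, (ivar s' vj < N)%N & mat M s i (ivar s' vj) != 0]).
Proof.
move=> si sM iN NM nbE nbc Qii.
have sub : forall s', same (searchc nb) s s' -> same (reducec nb) s s'.
  by move=> s' ?; apply/same_for/same_seql/same_ifl/same_seql.
have H : wp (searchc nb) s (2 + M.+1 * (13 + 3 + 8)) (fun s' => (ivar s' vj < N)%N /\
    (mat M s i (ivar s' vj) != 0 \/
      (ivar s' vj = i /\ forall b, (b < N)%N -> mat M s i b = 0))).
  apply: wp_seq; apply: wp_conseq (wp_same (wp_iset (Q := fun s' => ivar s' vj = i) _))
    (leqnn _) _ => /= [|s1 [ss1 s1j]].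
    by rewrite /upd eqxx.
  have W := @wp_for R vb nb (CIf (BREq (qget (IVar vi) (IVar vb)) RZero) CSkip (CISet vj (IVar vb)))
    s1 N M.+1 13 (fun t s' => (ivar s' vj < N)%N /\ (mat M s i (ivar s' vj) != 0 \/
      (ivar s' vj = i /\ forall b, (b < t)%N -> mat M s i b = 0))).
  rewrite nbc in W; apply: wp_conseq (W _ _ _ _ _) (leqnn _) _ => {W} //.
  - move=> s' ss'; apply: nbE; apply: sub; apply: (same_trans (s2 := s1)).
      exact: same_seql.
    exact: same_seqr.
  - by rewrite /= /upd /= s1j; split=> //; right.
  - move=> t s2 tN s2b ss2 [s2j s2P].
    have s2i : ivar s2 vi = i by rewrite (same_i ss2) // (same_i ss1).
    have s2M : ivar s2 vM = M by rewrite (same_i ss2) // (same_i ss1).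
    have s2Q : mat M s2 = mat M s by rewrite /mat (same_ra ss2) // (same_ra ss1).
    have Qt : rarr s2 0 (i * M + t)%N = mat M s i t by rewrite -s2Q.
    apply: (@wp_conseq _ _ _ _ _ _ _ (@wp_if _ _ _ _ _ 1 2 _ _ _) _ (fun=> id)) => //=.
    + rewrite s2i s2M s2b Qt => /eqP Q0; apply: wp_skip.
      rewrite /= /upd /=; split=> //; case: s2P => [|[ji Z]]; [by left|right].
      split=> // b; rewrite ltnS leq_eqVlt => /orP[/eqP -> //|]; exact: Z.
    + rewrite s2i s2M s2b Qt => Q0; apply: (@wp_iset _ vj (IVar vb)).
      by rewrite /= /upd /= s2b; split=> //; left.
  by move=> s' [].
apply: wp_conseq H _ _ => [|s' [jN [nz|]]]; first by rewrite /M; nia.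
  by right; split=> // ji; move: nz; rewrite ji Qii eqxx.
by left.
Qed.

Lemma wp_addrowc s i j : ivar s vi = i -> ivar s vj = j -> ivar s vM = M ->
  (i < M)%N -> (j < M)%N -> i != j ->
  wp addrowc s (300 * k) (fun s' => forall a b, (a < M)%N -> (b < M)%N ->
    mat M s' a b = mat M s a b + (a == i)%:R * rvar s ral * mat M s j b).
Proof.
move=> si sj sM iM jM ij.
have W := @wp_for R vb (IVar vM) (CRStore 0 (qidx (IVar vi) (IVar vb))
    (RAdd (qget (IVar vi) (IVar vb)) (RMul (RVar ral) (qget (IVar vj) (IVar vb))))) s M M.+1 30
  (fun t s' => forall a b, (a < M)%N -> (b < M)%N ->
    mat M s' a b = mat M s a b + ((a == i) && (b < t)%N)%:R * rvar s ral * mat M s j b).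
apply: wp_conseq (W _ _ _ _ _) _ _ => {W} //.
- by move=> s' ss'; rewrite /= (same_i ss').
- by move=> a b am bm; rewrite andbF !mul0r addr0.
- move=> t s1 tM s1b ss1 I.
  have s1i : ivar s1 vi = i by rewrite (same_i ss1).
  have s1j : ivar s1 vj = j by rewrite (same_i ss1).
  have s1M : ivar s1 vM = M by rewrite (same_i ss1).
  have s1r : rvar s1 ral = rvar s ral by rewrite (same_r ss1).
  apply: wp_conseq (wp_rstore (Q := _) _) _ (fun=> id) => //= a b am bm.
  rewrite s1i s1M s1b s1j s1r -/(mat M s1 i t) -/(mat M s1 j t).
  rewrite [LHS](mat_set _ _ _ _ bm tM) (I i t) // (I j t) // (I a b) // ltnn.
  rewrite ltnS (leq_eqVlt b) [j == i]eq_sym (negbTE ij) !andbF !mul0r !addr0 /=.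
  have [->|ai] := eqVneq a i; last by rewrite !mul0r !addr0.
  have [->|bt] := eqVneq b t; rewrite /= ?eqxx ?mul1r //.
- by rewrite /= /M; nia.
move=> s' [_ I] a b am bm; rewrite I // bm andbT //.
Qed.

Lemma wp_addcolc s i j : ivar s vi = i -> ivar s vj = j -> ivar s vM = M ->
  (i < M)%N -> (j < M)%N -> i != j ->
  wp addcolc s (300 * k) (fun s' => forall a b, (a < M)%N -> (b < M)%N ->
    mat M s' a b = mat M s a b + (b == i)%:R * rvar s ral * mat M s a j).
Proof.
move=> si sj sM iM jM ij.
have W := @wp_for R vb (IVar vM) (CRStore 0 (qidx (IVar vb) (IVar vi))
    (RAdd (qget (IVar vb) (IVar vi)) (RMul (RVar ral) (qget (IVar vb) (IVar vj))))) s M M.+1 30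
  (fun t s' => forall a b, (a < M)%N -> (b < M)%N ->
    mat M s' a b = mat M s a b + ((b == i) && (a < t)%N)%:R * rvar s ral * mat M s a j).
apply: wp_conseq (W _ _ _ _ _) _ _ => {W} //.
- by move=> s' ss'; rewrite /= (same_i ss').
- by move=> a b am bm; rewrite andbF !mul0r addr0.
- move=> t s1 tM s1b ss1 I.
  have s1i : ivar s1 vi = i by rewrite (same_i ss1).
  have s1j : ivar s1 vj = j by rewrite (same_i ss1).
  have s1M : ivar s1 vM = M by rewrite (same_i ss1).
  have s1r : rvar s1 ral = rvar s ral by rewrite (same_r ss1).
  apply: wp_conseq (wp_rstore (Q := _) _) _ (fun=> id) => //= a b am bm.
  rewrite s1i s1M s1b s1j s1r -/(mat M s1 t i) -/(mat M s1 t j).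
  rewrite [LHS](mat_set _ _ _ _ bm iM) (I t i) // (I t j) // (I a b) // ltnn.
  rewrite ltnS (leq_eqVlt a) [j == i]eq_sym (negbTE ij) !andbF !mul0r !addr0 /=.
  have [->|bi] := eqVneq b i; last by rewrite andbF !mul0r !addr0.
  have [->|at_] := eqVneq a t; rewrite /= ?eqxx ?mul1r //.
- by rewrite /= /M; nia.
move=> s' [_ I] a b am bm; rewrite I // am andbT //.
Qed.

Definition pivot_sign (Q : nat -> nat -> R) i j : R :=
  if Q j j + (Q i j + Q i j) == 0 then -1 else 1.

Lemma wp_addrcc s i j : ivar s vi = i -> ivar s vj = j -> ivar s vM = M ->
  (i < M)%N -> (j < M)%N -> i != j ->
  wp addrcc s (1000 * k) (fun s' => forall a b, (a < M)%N -> (b < M)%N ->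
    mat M s' a b = addrcm (mat M s) i j (pivot_sign (mat M s) i j) a b).
Proof.
move=> si sj sM iM jM ij.
have H1 : wp (CIf (BREq (RAdd (qget (IVar vj) (IVar vj))
             (RAdd (qget (IVar vi) (IVar vj)) (qget (IVar vi) (IVar vj)))) RZero)
    (CRSet ral rmone) (CRSet ral ROne)) s 100 (fun s' => rvar s' ral = pivot_sign (mat M s) i j).
  apply: (@wp_conseq _ _ _ _ _ _ _ (@wp_if _ _ _ _ _ 4 2 _ _ _) _ (fun=> id)) => //=.
    rewrite si sj sM => e; apply: (@wp_rset _ ral rmone).
    by rewrite /= /upd /pivot_sign /mat e /= sub0r.
  rewrite si sj sM => /negbTE e; apply: (@wp_rset _ ral ROne).
  by rewrite /= /upd /pivot_sign /mat e.
apply: (@wp_conseq _ _ _ (100 + (300 * k + 300 * k)) _ _ _ _ _ (fun=> id)); last by nia.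
apply: wp_seq; apply: wp_conseq (wp_same H1) (leqnn _) _ => s1 [ss1 s1r].
have s1Q : mat M s1 = mat M s by rewrite /mat (same_ra ss1).
have s1i : ivar s1 vi = i by rewrite (same_i ss1).
have s1j : ivar s1 vj = j by rewrite (same_i ss1).
have s1M : ivar s1 vM = M by rewrite (same_i ss1).
apply: wp_seq; apply: wp_conseq (wp_same (wp_addrowc s1i s1j s1M iM jM ij)) (leqnn _) _.
move=> s2 [ss2 s2Q].
have s2i : ivar s2 vi = i by rewrite (same_i ss2).
have s2j : ivar s2 vj = j by rewrite (same_i ss2).
have s2M : ivar s2 vM = M by rewrite (same_i ss2).
apply: wp_conseq (wp_addcolc s2i s2j s2M iM jM ij) (leqnn _) _ => s3 s3Q a b am bm.
(* The column pass reads the row already updated, which produces the quadratic term of [addrcm]. *)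
rewrite s3Q // !s2Q // (same_r ss2) // s1r s1Q /addrcm; ring.
Qed.

Lemma addrcm_diag (Q : nat -> nat -> R) i j m : symmetric_below m Q -> (i < m)%N -> (j < m)%N ->
  i != j -> Q i i = 0 -> Q i j != 0 -> addrcm Q i j (pivot_sign Q i j) i i != 0.
Proof.
move=> sy im jm ij Qii Qij; rewrite /addrcm eqxx Qii (sy j i) // /pivot_sign.
case: ifPn => [/eqP e|e].
  have -> : Q j j = - (Q i j + Q i j) by rewrite -[LHS](addrK (Q i j + Q i j)) e sub0r.
  (* Here the sign is -1 and the new diagonal entry equals -4 times [Q i j]. *)
  by apply: contraNneq Qij => e2; apply/eqP; move: e2 => /=; lra.
by apply: contraNneq e => e2; apply/eqP; move: e2 => /=; lra.
Qed.

Lemma wp_fixdiagc nb s i N : ivar s vi = i -> ivar s vM = M -> (i < N)%N -> (N <= M)%N ->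
  (forall s', same (reducec nb) s s' -> ieval s' nb = N) -> icost nb = 3%N ->
  symmetric_below M (mat M s) -> (forall a b, (a < i)%N -> (b < N)%N -> mat M s a b = 0) ->
  wp (fixdiagc nb) s (2000 * k) (fun s' => [/\ symmetric_below M (mat M s'),
    reduces M N (mat M s) (mat M s') 0,
    forall a b, (a < i)%N -> (b < N)%N -> mat M s' a b = 0 &
    mat M s' i i = 0 -> forall b, (b < N)%N -> mat M s' i b = 0]).
Proof.
move=> si sM iN NM nbE nbc sy Z.
have iM := leq_trans iN NM.
apply: (@wp_conseq _ _ _ _ _ _ _ (@wp_if _ _ _ _ _ (500 * k + (1000 * k + 5)) 1 _ _ _) _ (fun=> id)) => /=.
- rewrite si sM -/(mat M s i i) => /eqP Qii; apply: wp_seq.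
  apply: wp_conseq (wp_same (wp_searchc si sM iN NM nbE nbc Qii)) (leqnn _) _ => s1 [ss1 sJ].
  have s1Q : mat M s1 = mat M s by rewrite /mat (same_ra ss1).
  have s1i : ivar s1 vi = i by rewrite (same_i ss1).
  have s1M : ivar s1 vM = M by rewrite (same_i ss1).
  apply: (@wp_conseq _ _ _ _ _ _ _ (@wp_if _ _ _ _ _ 1 (1000 * k) _ _ _) _ (fun=> id)) => /=.
  + rewrite s1i => /eqP s1j; case: sJ => [[_ Zi]|[]] //.
    apply: wp_skip; rewrite s1Q; split=> //; exact: reduces_refl.
  + rewrite s1i => /eqP s1j; case: sJ => [[]|[_ jN Qij]] //.
    have jM := leq_trans jN NM; set j := ivar s1 vj in s1j jN Qij jM.
    have ij : i != j by apply/eqP => e; apply: s1j.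
    apply: wp_conseq (wp_addrcc s1i (erefl _) s1M iM jM ij) (leqnn _) _ => s2.
    rewrite -/j s1Q => s2Q; split.
    * by move=> a b am bm; rewrite !s2Q //; apply: (@symmetric_below_addrcm _ M _ i j _ sy jM).
    * by apply: reduces_eqr s2Q; apply: reduces_addrcm.
    (* Treated rows stay zero: the row operation touches row [i] only, and the column operation adds
       multiples of [Q a j = 0]. *)
    * move=> a b ai bN; have aM := ltn_trans ai iM; have bM := leq_trans bN NM.
      by rewrite s2Q // /addrcm (Z a b) // (Z a j) // (ltn_eqF ai) !(mul0r, mulr0, addr0).
    by move=> /eqP; rewrite s2Q // (negbTE (addrcm_diag sy iM jM ij Qii Qij)).
  by rewrite /=; lia.
- rewrite si sM -/(mat M s i i) => Qii; apply: wp_skip; split=> //; first exact: reduces_refl.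
  by move=> e; rewrite e eqxx in Qii.
by nia.
Qed.

Lemma wp_copyrowc s i : ivar s vi = i -> ivar s vM = M -> (i < M)%N ->
  wp copyrowc s (300 * k) (fun s' => forall b, (b < M)%N -> rarr s' 3 b = mat M s i b).
Proof.
move=> si sM iM.
have W := @wp_for R vb (IVar vM) (CRStore 3 (IVar vb) (qget (IVar vi) (IVar vb))) s M M.+1 30
  (fun t s' => forall b, (b < t)%N -> rarr s' 3 b = mat M s i b).
apply: wp_conseq (W _ _ _ _ _) _ _ => {W} //.
- by move=> s' ss'; rewrite /= (same_i ss').
- move=> t s1 tM s1b ss1 I.
  have s1i : ivar s1 vi = i by rewrite (same_i ss1).
  have s1M : ivar s1 vM = M by rewrite (same_i ss1).
  have s1Q : mat M s1 = mat M s by rewrite /mat (same_ra ss1).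
  apply: wp_conseq (wp_rstore (Q := _) _) _ (fun=> id) => //= b.
  rewrite s1i s1M s1b -/(mat M s1 i t) s1Q ltnS leq_eqVlt /upd2 /upd /=.
  by have [->|bt] := eqVneq b t => //= bt'; apply: I.
- by rewrite /= /M; nia.
by move=> s' [].
Qed.

Lemma wp_elimc s i : ivar s vM = M -> (i < M)%N ->
  (forall b, (b < M)%N -> rarr s 3 b = mat M s i b) -> rvar s rd = mat M s i i ->
  wp elimc s (2500 * (k * k)) (fun s' => forall a b, (a < M)%N -> (b < M)%N ->
    mat M s' a b = pivotm (mat M s) i a b).
Proof.
move=> sM iM sp sd.
have W := @wp_for R va (IVar vM) (cfor vb (IVar vM) (CRStore 0 (qidx (IVar va) (IVar vb))
    (RSub (qget (IVar va) (IVar vb))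
       (RDiv (RMul (RLoad 3 (IVar va)) (RLoad 3 (IVar vb))) (RVar rd))))) s M M.+1 (M.+1 * (25 + 1 + 8))
  (fun t s' => forall a b, (a < M)%N -> (b < M)%N ->
    mat M s' a b = if (a < t)%N then pivotm (mat M s) i a b else mat M s a b).
apply: wp_conseq (W _ _ _ _ _) _ _ => {W} //.
- by move=> s' ss'; rewrite /= (same_i ss').
- move=> t s1 tM s1a ss1 I.
  have W := @wp_for R vb (IVar vM) (CRStore 0 (qidx (IVar va) (IVar vb))
    (RSub (qget (IVar va) (IVar vb))
       (RDiv (RMul (RLoad 3 (IVar va)) (RLoad 3 (IVar vb))) (RVar rd)))) s1 M M.+1 25
  (fun u s' => forall a b, (a < M)%N -> (b < M)%N ->
    mat M s' a b = if (a < t)%N || (a == t) && (b < u)%N then pivotm (mat M s) i a b else mat M s a b).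
  apply: wp_conseq (W _ _ _ _ _) _ _ => {W} //.
  + by move=> s' ss'; rewrite /= (same_i ss') // (same_i ss1).
  + by move=> a b am bm; rewrite ltn0 andbF orbF; apply: I.
  + move=> u s2 uM s2b ss2 I2.
    have s2a : ivar s2 va = t by rewrite (same_i ss2).
    have s2M : ivar s2 vM = M by rewrite (same_i ss2) // (same_i ss1).
    have s2p b : (b < M)%N -> rarr s2 3 b = mat M s i b.
      by move=> bm; rewrite (same_ra ss2) // (same_ra ss1) // sp.
    have s2d : rvar s2 rd = mat M s i i by rewrite (same_r ss2) // (same_r ss1).
    apply: wp_conseq (wp_rstore (Q := _) _) _ (fun=> id) => //= a b am bm.
    rewrite s2a s2M s2b s2d !s2p // -/(mat M s2 t u).
    rewrite [LHS](mat_set _ _ _ _ bm uM) (I2 t u) // (I2 a b) //.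
    rewrite ltnS (leq_eqVlt b) !ltnn eqxx /=.
    have [->|at_] := eqVneq a t; last by rewrite /= !orbF.
    by have [->|bu] := eqVneq b u; rewrite ltnn //= eqxx.
  move=> s2 [_ I2] a b am bm; apply: etrans (I2 a b am bm) _.
  by rewrite bm andbT ltnS (leq_eqVlt a) orbC.
- by rewrite /= /M; nia.
by move=> s' [_ I] a b am bm; rewrite I // am.
Qed.

Lemma wp_pivotc s i : ivar s vi = i -> ivar s vM = M -> (i < M)%N ->
  wp pivotc s (3000 * (k * k)) (fun s' =>
    ivar s' vcnt = (ivar s vcnt + (mat M s i i < 0)%R)%N /\
    forall a b, (a < M)%N -> (b < M)%N -> mat M s' a b = pivotm (mat M s) i a b).
Proof.
move=> si sM iM.
apply: (@wp_conseq _ _ _ (7 + (9 + (300 * k + 2500 * (k * k)))) _ _ _ _ _ (fun=> id)); last by nia.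
apply: wp_seq; apply: (wp_conseq (wp_same (wp_rset (Q := fun s' => rvar s' rd = mat M s i i) _)) (leqnn _)).
  by rewrite /= /upd /= si sM.
move=> s1 [ss1 s1d].
have s1Q : mat M s1 = mat M s by rewrite /mat (same_ra ss1).
apply: wp_seq; have H : wp (CIf (BRLt (RVar rd) RZero) (CISet vcnt (IVar vcnt #+ IConst 1)) CSkip)
    s1 9 (fun s' => ivar s' vcnt = (ivar s vcnt + (mat M s i i < 0)%R)%N).
  apply: (@wp_conseq _ _ _ _ _ _ _ (@wp_if _ _ _ _ _ 4 1 _ _ _) _ (fun=> id)) => //=.
    rewrite s1d => e; apply: (@wp_iset _ vcnt (IVar vcnt #+ IConst 1)).
    by rewrite /= /upd /= e (same_i ss1).
  rewrite s1d => /negbTE e; apply: wp_skip.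
  by rewrite e addn0 (same_i ss1).
apply: wp_conseq (wp_same H) (leqnn _) _ => s2 [ss2 s2c].
have s2Q : mat M s2 = mat M s by rewrite -s1Q /mat (same_ra ss2).
have s2i : ivar s2 vi = i by rewrite (same_i ss2) // (same_i ss1).
have s2M : ivar s2 vM = M by rewrite (same_i ss2) // (same_i ss1).
apply: wp_seq; apply: wp_conseq (wp_same (wp_copyrowc s2i s2M iM)) (leqnn _) _ => s3 [ss3 s3p].
have s3Q : mat M s3 = mat M s by rewrite -s2Q /mat (same_ra ss3).
have s3M : ivar s3 vM = M by rewrite (same_i ss3).
have s3d : rvar s3 rd = mat M s3 i i by rewrite (same_r ss3) // (same_r ss2) // s3Q.
have s3p' b : (b < M)%N -> rarr s3 3 b = mat M s3 i b by move=> bm; rewrite s3p // s2Q s3Q.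
apply: wp_conseq (wp_same (wp_elimc s3M iM s3p' s3d)) (leqnn _) _ => s4 [ss4 s4Q].
by split; [rewrite (same_i ss4) // (same_i ss3) | rewrite -s3Q].
Qed.

Lemma wp_reducec nb s N : ivar s vM = M -> (N <= M)%N ->
  (forall s', same (reducec nb) s s' -> ieval s' nb = N) -> icost nb = 3%N ->
  symmetric_below M (mat M s) ->
  wp (reducec nb) s (50 * 1000 * (k * k * k)) (fun s' => same (reducec nb) s s' /\
    exists d, [/\ ivar s' vcnt = (ivar s vcnt + d)%N,
      reduces M N (mat M s) (mat M s') d, symmetric_below M (mat M s') &
      forall a b, (a < N)%N -> (b < N)%N -> mat M s' a b = 0]).
Proof.
move=> sM NM nbE nbc sy.
have W := @wp_for R vi nb (fixdiagc nb ;;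
    CIf (BREq (qget (IVar vi) (IVar vi)) RZero) CSkip pivotc) s N M.+1
    (2000 * k + (8 + (1 + 3000 * (k * k))).+1)
  (fun i s' => exists d, [/\ ivar s' vcnt = (ivar s vcnt + d)%N,
      reduces M N (mat M s) (mat M s') d, symmetric_below M (mat M s') &
      forall a b, (a < i)%N -> (b < N)%N -> mat M s' a b = 0]).
apply: wp_conseq (W _ nbE _ _ _) _ (fun=> id) => {W} //.
- by exists 0%N; rewrite addn0; split=> //; apply: reduces_refl.
- move=> i s1 iN s1i ss1 [d [cnt1 red1 sy1 Z1]].
  have iM := leq_trans iN NM.
  have s1M : ivar s1 vM = M by rewrite (same_i ss1).
  have nbE1 s' : same (reducec nb) s1 s' -> ieval s' nb = N.
    by move=> ss'; apply: nbE; apply: same_trans ss1 ss'.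
  apply: wp_seq.
  apply: wp_conseq (wp_same (wp_fixdiagc s1i s1M iN NM nbE1 nbc sy1 Z1)) (leqnn _) _.
  move=> s2 [ss2 [sy2 red2 Z2 Zi2]].
  have s2i : ivar s2 vi = i by rewrite (same_i ss2).
  have s2M : ivar s2 vM = M by rewrite (same_i ss2).
  have s2c : ivar s2 vcnt = (ivar s vcnt + d)%N by rewrite (same_i ss2).
  have red12 := reduces_trans red1 red2; rewrite addn0 in red12.
  apply: (@wp_conseq _ _ _ _ _ _ _ (@wp_if _ _ _ _ _ 1 (3000 * (k * k)) _ _ _) _ (fun=> id)) => //=.
  + rewrite s2i s2M -/(mat M s2 i i) => /eqP Qii; apply: wp_skip; exists d; split=> // a b.
    by rewrite ltnS leq_eqVlt => /orP[/eqP ->|]; [apply: Zi2 | apply: Z2].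
  + rewrite s2i s2M -/(mat M s2 i i) => Qii.
    apply: wp_conseq (wp_pivotc s2i s2M iM) (leqnn _) _ => s3 [s3c s3Q].
    exists (d + (mat M s2 i i < 0)%R)%N.
    rewrite -[mat M (set_ivar _ _ _)]/(mat M s3); split.
    * by rewrite /= /upd /= s3c s2c addnA.
    * apply: reduces_trans red12 _; apply: reduces_eqr s3Q; exact: reduces_pivot.
    * by move=> a b am bm; rewrite !s3Q //; apply: (@symmetric_below_pivotm _ M _ i sy2).
    (* The pivot row is cleared by its own step; an earlier row is unchanged, because its
       coefficient [Q i a] is zero by symmetry. *)
    move=> a b ai bN; have aM : (a < M)%N by apply: leq_ltn_trans iM.
    have bM := leq_trans bN NM; apply: etrans (s3Q _ _ aM bM) _; rewrite /pivotm.
    move: ai; rewrite ltnS leq_eqVlt => /orP[/eqP ->|ai].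
      by rewrite mulrAC divff // mul1r subrr.
    by rewrite Z2 // (sy2 i a) // Z2 // mul0r mul0r subr0.
(* At most [6 * k + 1 <= 7 * k] rounds, each quadratic in [k]. *)
rewrite /= nbc /M; apply: (@leq_trans (7 * k * (6 * 1000 * (k * k)))).
  by apply: leq_mul; nia.
have -> : (7 * k * (6 * 1000 * (k * k)) = 42 * 1000 * (k * k * k))%N by lia.
by rewrite leq_mul2r orbT.
Qed.

End Reduce.

(** * Processing one token *)

Definition store2 h vA vT :=
  CRStore 1 (sidx h (IVar va) (IVar vb)) vA ;; CRStore 2 (sidx h (IVar va) (IVar vb)) vT.

Definition leafbody :=
  CIf (BIEq (IVar va) (IVar vb))
    (CIf (BIEq (IVar va) (ILoad 0 (IVar vpos #+ IConst 1)))
       (store2 (IVar vsp) RZero (RVar rdg)) (store2 (IVar vsp) ROne RZero))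
    (store2 (IVar vsp) RZero RZero).

Definition fillc c := cfor va (IVar vk) (cfor vb (IVar vk) c).

Definition leafc :=
  fillc leafbody ;;
  CISet vpos (IVar vpos #+ IConst 2) ;; CISet vsp (IVar vsp #+ IConst 1).

(** The slot of the first operand is reused: all that matters has moved into [Q]. Each Gram entry is
    a sum of 5k products, so the k * k entries stay within the cubic budget. *)
Definition extractbody :=
  CRSet racc RZero ;;
  cfor vr (IConst 5 #* IVar vk) (CRSet racc (RAdd (RVar racc)
    (RMul (qget (IVar vr) (off 5 (IVar va))) (qget (IVar vr) (off 5 (IVar vb)))))) ;;
  store2 (IVar vsp #- IConst 2) (RVar racc) (qget (off 5 (IVar va)) (off 5 (IVar vb))).

Definition joinc :=
  clearQ ;; loadQ (IVar vsp #- IConst 2) 0 ;; loadQ (IVar vsp #- IConst 1) 2 ;;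
  loadS ;; loadLR ;; reducec (IConst 5 #* IVar vk) ;; fillc extractbody ;;
  CISet vpos (IVar vpos #+ IConst 1 #+ (IVar vk #* IVar vk #+ (IVar vk #+ IVar vk))) ;;
  CISet vsp (IVar vsp #- IConst 1).

Section Tokens.
Variables (R : realType) (k : nat).
Hypothesis k_gt0 : (0 < k)%N.
Implicit Types s : state R.
Let M := (6 * k)%N.

(** Stack discipline: pairs stored below height [h], by subexpressions already read, survive. *)
Definition lower h s s' := forall x, (x < h * k * k)%N ->
  rarr s' 1 x = rarr s 1 x /\ rarr s' 2 x = rarr s 2 x.

Lemma cell_eq h a b a' b' : (a < k)%N -> (b < k)%N -> (a' < k)%N -> (b' < k)%N ->
  ((h * k + a) * k + b == (h * k + a') * k + b')%N = (a == a') && (b == b').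
Proof. by move=> ak bk ak' bk'; rewrite flat_eq // eqn_add2l. Qed.

Lemma lower_cell h a b x : (x < h * k * k)%N -> (x == (h * k + a) * k + b)%N = false.
Proof.
move=> lx; apply/negbTE; rewrite neq_ltn; apply/orP; left; apply: leq_trans lx _.
by rewrite mulnDl -addnA leq_addr.
Qed.

Lemma wp_fill c s h T (fA fT : nat -> nat -> R) : ivar s vk = k ->
  ~~ imod c va -> ~~ imod c vb -> ~~ imod c vk ->
  (forall s' a b, (a < k)%N -> (b < k)%N -> same (fillc c) s s' ->
     ivar s' va = a -> ivar s' vb = b ->
     wp c s' T (fun s'' =>
       rarr s'' 1 = upd (rarr s' 1) ((h * k + a) * k + b)%N (fA a b) /\
       rarr s'' 2 = upd (rarr s' 2) ((h * k + a) * k + b)%N (fT a b))) ->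
  wp (fillc c) s (2 * k * (2 * k * (T + 9) + 9)) (fun s' => [/\ same (fillc c) s s',
    forall a b, (a < k)%N -> (b < k)%N ->
      slot k 1 s' h a b = fA a b /\ slot k 2 s' h a b = fT a b & lower h s s']).
Proof.
move=> sk ca cb ck H.
have W := @wp_for R va (IVar vk) (cfor vb (IVar vk) c) s k (2 * k) (2 * k * (T + 1 + 8))
  (fun i s' => lower h s s' /\ forall a b, (a < i)%N -> (a < k)%N -> (b < k)%N ->
      slot k 1 s' h a b = fA a b /\ slot k 2 s' h a b = fT a b).
apply: wp_conseq (W _ _ _ _ _) _ _ => {W}.
- by rewrite /= (negbTE ca).
- by move=> s' ss'; rewrite /= (same_i ss') //= (negbTE ck).
- by lia.
- by [].
- move=> a s1 ak s1a ss1 [low1 I1].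
  have s1k : ivar s1 vk = k by rewrite (same_i ss1) //= (negbTE ck).
  have W := @wp_for R vb (IVar vk) c s1 k (2 * k) T
    (fun j s' => lower h s s' /\ forall a' b, (a' < a)%N || (a' == a) && (b < j)%N ->
       (a' < k)%N -> (b < k)%N ->
       slot k 1 s' h a' b = fA a' b /\ slot k 2 s' h a' b = fT a' b).
  apply: wp_conseq (W _ _ _ _ _) _ _ => {W} //.
  + by move=> s' ss'; rewrite /= (same_i ss') //= (negbTE ck).
  + by lia.
  + split=> // a' b; rewrite ltn0 andbF orbF; exact: I1.
  + move=> b s2 bk s2b ss2 [low2 I2].
    have s2a : ivar s2 va = a by rewrite (same_i ss2) //= (negbTE ca).
    have ss : same (fillc c) s s2 by apply: same_trans ss1 _; apply: same_for.
    apply: wp_conseq (H _ _ _ ak bk ss s2a s2b) (leqnn _) _ => s3 [e1 e2]; split.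
      by move=> x lx; rewrite /= e1 e2 /upd lower_cell //; apply: low2.
    move=> a' b' ab' ak' bk'; rewrite /slot /= e1 e2 /upd cell_eq //.
    have [eab|nab] := boolP ((a' == a) && (b' == b)).
      by case/andP: eab => /eqP -> /eqP ->.
    apply: I2 => //; move: ab' nab; rewrite ltnS (leq_eqVlt b').
    by case: (a' < a)%N => //=; case: (a' == a) => //=; case: (b' == b).
  move=> s2 [_ [low2 I2]]; split=> // a' b; rewrite ltnS leq_eqVlt orbC => ab ak' bk'.
  by apply: I2 => //; rewrite bk' andbT.
- by rewrite -!addnA.
by move=> s' [ss' [low I]]; split=> // a b ak bk; apply: I.
Qed.

Lemma wp_store2 h vA vT s T (Q : state R -> Prop) :
  (icost (sidx h (IVar va) (IVar vb)) * 2 + rcost vA + rcost vT + 2 <= T)%N ->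
  Q (set_rarr (set_rarr s 1 (ieval s (sidx h (IVar va) (IVar vb))) (reval s vA)) 2
       (ieval s (sidx h (IVar va) (IVar vb)))
       (reval (set_rarr s 1 (ieval s (sidx h (IVar va) (IVar vb))) (reval s vA)) vT)) ->
  wp (store2 h vA vT) s T Q.
Proof.
move=> cost HQ; apply: wp_conseq (wp_seq (wp_rstore (wp_rstore (Q := Q) _))) _ (fun=> id).
  by rewrite ieval_set_rarr.
by move: cost; lia.
Qed.

Definition slotM i s h : 'M[R]_k := \matrix_(a, b) slot k i s h a b.

Lemma wp_leafc s (i : 'I_k) dg : ivar s vk = k -> rvar s rdg = dg ->
  iarr s 0 (ivar s vpos + 1) = i ->
  wp leafc s (1000 * (k * k)) (fun s' => [/\ same leafc s s',
    ivar s' vpos = (ivar s vpos + 2)%N /\ ivar s' vsp = (ivar s vsp).+1,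
    lower (ivar s vsp) s s',
    slotM 1 s' (ivar s vsp) = \matrix_(a, b) ((a == b) && (a != i))%:R &
    slotM 2 s' (ivar s vsp) = \matrix_(a, b) (dg *+ ((a == b) && (a == i)))]).
Proof.
move=> sk sdg si; set h := ivar s vsp.
have F := @wp_fill leafbody s h 100
  (fun a b => ((a == b) && (a != i))%:R) (fun a b => dg *+ ((a == b) && (a == i))) sk isT isT isT.
apply: (wp_conseq (T := (2 * k * (2 * k * (100 + 9) + 9) + (4 + 4))%N) (wp_same (Q := fun s' =>
    [/\ forall a b, (a < k)%N -> (b < k)%N ->
          slot k 1 s' h a b = ((a == b) && (a != i))%:R /\
          slot k 2 s' h a b = dg *+ ((a == b) && (a == i)),
        lower h s s', ivar s' vpos = (ivar s vpos + 2)%N & ivar s' vsp = h.+1]) _)).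
- apply: wp_seq; apply: wp_conseq (F _) (leqnn _) _ => {F}; last first.
    move=> s1 [ss1 E low]; apply: wp_seq; apply: (@wp_iset _ vpos); apply: (@wp_iset _ vsp).
    split=> //; first by rewrite /= /upd /= (same_i ss1).
    by rewrite /= /upd /= (same_i ss1) // addn1.
  move=> s1 a b ak bk ss1 s1a s1b.
  have s1k : ivar s1 vk = k by rewrite (same_i ss1).
  have s1h : ivar s1 vsp = h by rewrite (same_i ss1).
  have s1p : ivar s1 vpos = ivar s vpos by rewrite (same_i ss1).
  have s1i : iarr s1 0 = iarr s 0 by rewrite (same_ia ss1).
  have s1d : rvar s1 rdg = dg by rewrite (same_r ss1).
  have cell : ieval s1 (sidx (IVar vsp) (IVar va) (IVar vb)) = ((h * k + a) * k + b)%N.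
    by rewrite /= s1k s1h s1a s1b.
  apply: (@wp_conseq _ _ _ _ _ _ _ (@wp_if _ _ _ _ _ 65 30 _ _ _) _ (fun=> id)) => //=.
    rewrite s1a s1b => /eqP ab.
    apply: (@wp_conseq _ _ _ _ _ _ _ (@wp_if _ _ _ _ _ 27 27 _ _ _) _ (fun=> id)) => //=.
      rewrite s1a s1p s1i si => /eqP ai.
      by apply: wp_store2 => //; rewrite cell /= s1d ab -ai -ab !eqxx.
    rewrite s1a s1p s1i si => /negbTE ai.
    by apply: wp_store2 => //; rewrite cell /= ab eqxx -ab ai.
  rewrite s1a s1b => /negbTE ab.
  by apply: wp_store2 => //; rewrite cell /= ab.
- by nia.
move=> s' [ss' [E low p sp]]; split=> //; apply/matrixP => a b; rewrite !mxE.
  by have [-> _] := E a b (ltn_ord a) (ltn_ord b).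
by have [_ ->] := E a b (ltn_ord a) (ltn_ord b).
Qed.

Lemma wp_extract s h : ivar s vk = k -> ivar s vM = M -> ivar s vsp = h.+2 ->
  wp (fillc extractbody) s (2 * 1000 * (k * k * k)) (fun s' => [/\ same (fillc extractbody) s s',
    lower h s s',
    slotM 1 s' h = \matrix_(a, b) \sum_(r < 5 * k) mat M s r (5 * k + a)%N * mat M s r (5 * k + b)%N &
    slotM 2 s' h = \matrix_(a, b) mat M s (5 * k + a)%N (5 * k + b)%N]).
Proof.
move=> sk sM ssp.
have F := @wp_fill extractbody s h (300 * k)
  (fun a b => \sum_(r < 5 * k) mat M s r (5 * k + a)%N * mat M s r (5 * k + b)%N)
  (fun a b => mat M s (5 * k + a)%N (5 * k + b)%N) sk isT isT isT.
apply: wp_conseq (F _) _ _ => {F}.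
- move=> s1 a b ak bk ss1 s1a s1b.
  have s1k : ivar s1 vk = k by rewrite (same_i ss1).
  have s1M : ivar s1 vM = M by rewrite (same_i ss1).
  have s1Q : mat M s1 = mat M s by rewrite /mat (same_ra ss1).
  apply: (wp_conseq (T := (2 + (210 * k + 80))%N) _ _ (fun=> id)); last by nia.
  apply: wp_seq; apply: (@wp_rset _ racc RZero); set s2 := set_rvar _ _ _.
  have s2k : ivar s2 vk = k by [].
  apply: wp_seq.
  have W := @wp_for R vr (IConst 5 #* IVar vk) (CRSet racc (RAdd (RVar racc)
    (RMul (qget (IVar vr) (off 5 (IVar va))) (qget (IVar vr) (off 5 (IVar vb)))))) s2
    (5 * k) (6 * k) 24 (fun t s' => rvar s' racc =
      \sum_(r < t) mat M s r (5 * k + a)%N * mat M s r (5 * k + b)%N).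
  apply: wp_conseq (W _ _ _ _ _) _ _ => {W} //.
  + by move=> s' ss'; rewrite /= (same_i ss') // s2k.
  + by lia.
  + by rewrite big_ord0 /= /upd.
  + move=> t s3 t5 s3r ss3 I.
    have s3k : ivar s3 vk = k by rewrite (same_i ss3).
    have s3M : ivar s3 vM = M by rewrite (same_i ss3).
    have s3a : ivar s3 va = a by rewrite (same_i ss3).
    have s3b : ivar s3 vb = b by rewrite (same_i ss3).
    have s3Q : mat M s3 = mat M s by rewrite -s1Q /mat (same_ra ss3).
    apply: (@wp_rset _ racc); rewrite /= /upd /= s3k s3M s3a s3b s3r I big_ord_recr /=.
    by rewrite -s3Q.
  + by rewrite /=; nia.
  move=> s3 [ss3 I].
  have s3k : ivar s3 vk = k by rewrite (same_i ss3).
  have s3M : ivar s3 vM = M by rewrite (same_i ss3).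
  have s3a : ivar s3 va = a by rewrite (same_i ss3).
  have s3b : ivar s3 vb = b by rewrite (same_i ss3).
  have s3Q : mat M s3 = mat M s by rewrite -s1Q /mat (same_ra ss3).
  have s3A : rarr s3 1 = rarr s1 1 by rewrite (same_ra ss3).
  have s3T : rarr s3 2 = rarr s1 2 by rewrite (same_ra ss3).
  have s3sp : ivar s3 vsp = h.+2 by rewrite (same_i ss3) //= (same_i ss1).
  have cell : ieval s3 (sidx (IVar vsp #- IConst 2) (IVar va) (IVar vb)) = ((h * k + a) * k + b)%N.
    by rewrite /= s3k s3sp s3a s3b subSS subSS subn0.
  apply: wp_store2 => //; rewrite cell; split.
    by rewrite /= -s3A -I.
  rewrite /= s3k s3M s3a s3b -s3T -s3Q.
  by [].
- by nia.
move=> s' [ss' E low]; split=> //; apply/matrixP => a b; rewrite !mxE.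
  by have [-> _] := E a b (ltn_ord a) (ltn_ord b).
by have [_ ->] := E a b (ltn_ord a) (ltn_ord b).
Qed.

Lemma wp_joinc s h (Sx : {set 'I_k * 'I_k}) (L1 L2 : {ffun 'I_k -> 'I_k})
    (sg dg : R) (G1 G2 : lgraph k) c1 c2 (m1 m2 : nat) :
  ivar s vk = k -> ivar s vM = M -> ivar s vsp = h.+2 -> rvar s rsg = sg ->
  (forall a b : 'I_k, iarr s 0 (ivar s vpos + 1 + (a * k + b)) = ((a, b) \in Sx)) ->
  (forall a : 'I_k, iarr s 0 (ivar s vpos + 1 + (k * k + a)) = L1 a) ->
  (forall a : 'I_k, iarr s 0 (ivar s vpos + 1 + (k * k + (k + a))) = L2 a) ->
  represents sg dg G1 (slotM 1 s h) (slotM 2 s h) c1 m1 ->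
  represents sg dg G2 (slotM 1 s h.+1) (slotM 2 s h.+1) c2 m2 ->
  wp joinc s (60 * 1000 * (k * k * k)) (fun s' => [/\ same joinc s s',
    ivar s' vpos = (ivar s vpos + 1 + (k * k + (k + k)))%N /\ ivar s' vsp = h.+1,
    lower h s s' &
    exists2 d, ivar s' vcnt = (ivar s vcnt + d)%N &
      represents sg dg (lg_slick Sx L1 L2 G1 G2) (slotM 1 s' h) (slotM 2 s' h) (c1 + c2 + d)
        (m1 + m2 + k)]).
Proof.
move=> sk sM ssp srg inS inL1 inL2 rep1 rep2.
apply: (wp_conseq (T := (800 * (k * k) + (1000 * (k * k) + (1000 * (k * k) + (1000 * (k * k)
   + (1000 * k + (50 * 1000 * (k * k * k) + (2 * 1000 * (k * k * k) + (20 + 20))))))))%N)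
  (wp_same (Q := fun s' => [/\ ivar s' vpos = (ivar s vpos + 1 + (k * k + (k + k)))%N,
    ivar s' vsp = h.+1, lower h s s' & exists2 d, ivar s' vcnt = (ivar s vcnt + d)%N &
      represents sg dg (lg_slick Sx L1 L2 G1 G2) (slotM 1 s' h) (slotM 2 s' h) (c1 + c2 + d)
        (m1 + m2 + k)]) _)); last first.
- by move=> s' [ss' [p sp low H]].
- have k3 : (k * k <= k * k * k)%N by rewrite leq_pmulr.
  have k2 : (k <= k * k)%N by rewrite leq_pmulr.
  by lia.
apply: wp_seq; apply: wp_conseq (wp_clearQ k_gt0 sk sM) (leqnn _) _ => t1 [st1 P1].
have t1k : ivar t1 vk = k by rewrite (same_i st1).
have t1M : ivar t1 vM = M by rewrite (same_i st1).
apply: wp_seq; apply: wp_conseq (wp_loadQ (h0 := h) k_gt0 t1k t1M _ _ _ P1) (leqnn _) _ => //.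
  by move=> s' ss'; rewrite /= (same_i ss') // (same_i st1) // ssp subSS subSS subn0.
move=> t2 [st2 P2].
have t2k : ivar t2 vk = k by rewrite (same_i st2).
have t2M : ivar t2 vM = M by rewrite (same_i st2).
apply: wp_seq; apply: wp_conseq (wp_loadQ (h0 := h.+1) k_gt0 t2k t2M _ _ _ P2) (leqnn _) _ => //.
  by move=> s' ss'; rewrite /= (same_i ss') // (same_i st2) // (same_i st1) // ssp subSS subn0.
move=> t3 [st3 P3].
have t3k : ivar t3 vk = k by rewrite (same_i st3).
have t3M : ivar t3 vM = M by rewrite (same_i st3).
apply: wp_seq; apply: wp_conseq (wp_loadS k_gt0 t3k t3M P3) (leqnn _) _ => t4 [st4 P4].
have t4k : ivar t4 vk = k by rewrite (same_i st4).
have t4M : ivar t4 vM = M by rewrite (same_i st4).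
have t4i : iarr t4 0 = iarr s 0.
  by rewrite (same_ia st4) // (same_ia st3) // (same_ia st2) // (same_ia st1).
have t4p : ivar t4 vpos = ivar s vpos.
  by rewrite (same_i st4) // (same_i st3) // (same_i st2) // (same_i st1).
(* The loading loop counts with naturals, so the label maps are extended by 0. *)
pose lf (L : {ffun 'I_k -> 'I_k}) a := if insub a is Some i then val (L i) else 0%N.
have lfE L (a : 'I_k) : lf L a = L a by rewrite /lf valK.
apply: wp_seq.
apply: wp_conseq (wp_loadLR k_gt0 (L1 := lf L1) (L2 := lf L2) t4k t4M _ _ P4) (leqnn _) _.
- move=> a ak; rewrite -[a]/(val (Ordinal ak)) lfE t4i t4p inL1; split=> //.
- move=> a ak; rewrite -[a]/(val (Ordinal ak)) lfE t4i t4p inL2; split=> //.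
move=> t5 [st5 [sy5 P5]].
have t5M : ivar t5 vM = M by rewrite (same_i st5).
have t5k : ivar t5 vk = k by rewrite (same_i st5).
have QE X : quad (6 * k) (mat M t5) X =
    join_form sg Sx L1 L2 (slotM 1 s h) (slotM 2 s h) (slotM 1 s h.+1) (slotM 2 s h.+1) X.
  rewrite P5 /join_form add0r; congr (_ + _ + _ + _).
  - apply: eq_bigr => a _; apply: eq_bigr => b _; rewrite !mxE /slot.
    by rewrite (same_ra st1) // (same_ra st1).
  - apply: eq_bigr => a _; apply: eq_bigr => b _; rewrite !mxE /slot.
    by rewrite !(same_ra st2) // !(same_ra st1).
  - apply: eq_bigr => a _; apply: eq_bigr => b _.
    rewrite (same_r st3) // (same_r st2) // (same_r st1) // srg.
    rewrite (same_i st3) // (same_i st2) // (same_i st1) //.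
    rewrite (same_ia st3) // (same_ia st2) // (same_ia st1) // inS.
    by case: (_ \in Sx).
  by apply: eq_bigr => a _; rewrite !lfE.
apply: wp_seq.
apply: wp_conseq (wp_reducec k_gt0 (N := (5 * k)%N) t5M _ _ _ sy5) (leqnn _) _ => //.
- by rewrite leq_mul2r orbT.
- by move=> s' ss'; rewrite /= (same_i ss') // t5k.
move=> t6 [st6 [d [c6 red6 sy6 Z6]]].
have t6M : ivar t6 vM = M by rewrite (same_i st6).
have t6k : ivar t6 vk = k by rewrite (same_i st6).
have t6i x : x \in [:: vpos; vsp] -> ivar t6 x = ivar s x.
  by rewrite !inE => /orP[] /eqP ->;
    rewrite (same_i st6) // (same_i st5) // (same_i st4) // (same_i st3) // (same_i st2) // (same_i st1).
have t6r x : x \in [:: 1; 2] -> rarr t6 x = rarr s x.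
  by rewrite !inE => /orP[] /eqP ->;
    rewrite (same_ra st6) // (same_ra st5) // (same_ra st4) // (same_ra st3) // (same_ra st2) // (same_ra st1).
have t6c : ivar t6 vcnt = (ivar s vcnt + d)%N.
  by rewrite c6 (same_i st5) // (same_i st4) // (same_i st3) // (same_i st2) // (same_i st1).
have t6sp : ivar t6 vsp = h.+2 by rewrite t6i.
apply: wp_seq; apply: wp_conseq (wp_extract t6k t6M t6sp) (leqnn _) _ => t7 [st7 low7 A7 T7].
apply: wp_seq; apply: (wp_conseq (T := 12) (T' := 20) _ _ (fun=> id)) => //.
apply: (@wp_iset _ vpos); apply: (wp_conseq (T := 4) (T' := 20) _ _ (fun=> id)) => //.
apply: (@wp_iset _ vsp); split.
- by rewrite /= /upd /= !(same_i st7) // t6k t6i.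
- by rewrite /= /upd /= (same_i st7) // t6sp subn1.
- by move=> x lx; have [e1 e2] := low7 x lx; rewrite /= e1 e2 !t6r.
exists d; first by rewrite /= /upd /= (same_i st7).
rewrite -[slotM 1 _ h]/(slotM 1 t7 h) -[slotM 2 _ h]/(slotM 2 t7 h) A7 T7.
exact: represents_join rep1 rep2 QE red6 sy6 Z6.
Qed.

End Tokens.

(** * Processing an expression *)

Definition tokc :=
  CIf (BIEq (ILoad 0 (IVar vpos)) (IConst 0)) leafc joinc.

(** A binary expression with n atoms has n - 1 joins, hence 2n - 1 tokens. *)
Definition tokloop :=
  CWhile (BILt (IVar vtok) (IConst 2 #* IVar vn #- IConst 1))
    (tokc ;; CISet vtok (IVar vtok #+ IConst 1)).

(** The counters are reset because the program may run twice, once per endpoint. The last assignment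
    removes the hyperbolic planes: k - 1 per atom and k per join. *)
Definition solvec :=
  CISet vM (IConst 6 #* IVar vk) ;; CISet vcnt (IConst 0) ;; CISet vpos (IConst 0) ;;
  CISet vsp (IConst 0) ;; CISet vtok (IConst 0) ;; tokloop ;;
  clearQ ;; loadQ (IConst 0) 0 ;; reducec (IConst 6 #* IVar vk) ;;
  CISet vcnt (IVar vcnt #-
    (IVar vn #* (IVar vk #- IConst 1) #+ (IVar vn #- IConst 1) #* IVar vk)).

(** Kinds 2 and 3 are -oo and +oo. For kind 0 the form is [A - c] and the index is the count; for
    kind 1 it is [c - A] and the count is the complement. *)
Definition boundc (kv entry out : nat) :=
  CIf (BIEq (IVar kv) (IConst 2)) (CISet out (IConst 0))
  (CIf (BIEq (IVar kv) (IConst 3)) (CISet out (IVar vn))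
  (CIf (BIEq (IVar kv) (IConst 0)) (CRSet rsg ROne) (CRSet rsg rmone) ;;
   CRSet rdg (RSub RZero (RMul (RVar rsg) (RVar entry))) ;;
   solvec ;;
   CIf (BIEq (IVar kv) (IConst 0)) (CISet out (IVar vcnt))
     (CISet out (IVar vn #- IVar vcnt)))).

(** [vlow] receives the count for the upper endpoint and variable 15 that for the lower one.
    Variable 0, which holds k, is overwritten only at the end. *)
Definition mainc := boundc 3 1 vlow ;; boundc 2 0 15 ;; CISet 0 (IVar vlow #- IVar 15).

(** * Numbers of atoms, tokens and hyperbolic planes *)

Fixpoint nleaf k (e : sexpr k) : nat :=
  match e with SAtom _ => 1 | SJoin _ _ _ e1 e2 => nleaf e1 + nleaf e2 end.

Fixpoint ntok k (e : sexpr k) : nat :=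
  match e with SAtom _ => 1 | SJoin _ _ _ e1 e2 => (ntok e1 + ntok e2).+1 end.

Fixpoint shift k (e : sexpr k) : nat :=
  match e with SAtom _ => k.-1 | SJoin _ _ _ e1 e2 => shift e1 + shift e2 + k end.

Lemma nleaf_gt0 k (e : sexpr k) : (0 < nleaf e)%N.
Proof. by elim: e => //= _ _ _ e1 H1 e2 H2; rewrite addn_gt0 H1. Qed.

Lemma ntokE k (e : sexpr k) : (ntok e).+1 = (2 * nleaf e)%N.
Proof. elim: e => //= _ _ _ e1 H1 e2 H2; lia. Qed.

Lemma shiftE k (e : sexpr k) : shift e = (nleaf e * (k - 1) + (nleaf e - 1) * k)%N.
Proof.
elim: e => [i|S L1 L2 e1 H1 e2 H2] /=; first by lia.
rewrite H1 H2; have := nleaf_gt0 e1; have := nleaf_gt0 e2.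
move: (nleaf e1) (nleaf e2) => [//|n1] [//|n2] _ _; nia.
Qed.

Lemma sexpr_gt0 k (e : sexpr k) : (0 < k)%N.
Proof. by elim: e => // i; apply: leq_ltn_trans (ltn_ord i). Qed.

Lemma card_sgraph_of k (e : sexpr k) : #|sgraph_of e| = nleaf e.
Proof. by elim: e => [i|S L1 L2 e1 H1 e2 H2] /=; rewrite ?card_unit // card_sum H1 H2. Qed.

Lemma nth_allpairs_grid (S T : Type) (f : S -> T -> nat) (s : seq S) (t : seq T) x0 y0 a b :
  (a < size s)%N -> (b < size t)%N ->
  nth 0%N [seq f x y | x <- s, y <- t] (a * size t + b) = f (nth x0 s a) (nth y0 t b).
Proof.
elim: s a => //= x s IH [|a] asz bt.
  by rewrite nth_cat size_map mul0n bt (nth_map y0).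
rewrite nth_cat size_map mulSn -addnA ltnNge leq_addr /= addKn; exact: IH.
Qed.

Section Solve.
Variables (R : realType) (k : nat).
Hypothesis k_gt0 : (0 < k)%N.
Implicit Types s : state R.

Lemma encode_join Sx L1 L2 (e1 e2 : sexpr k) (inp : nat -> nat) p :
  (forall i, (i < size (encode (SJoin Sx L1 L2 e1 e2)))%N ->
     inp (p + i)%N = nth 0%N (encode (SJoin Sx L1 L2 e1 e2)) i) ->
  let q := (p + size (encode e1) + size (encode e2))%N in
  [/\ forall i, (i < size (encode e1))%N -> inp (p + i)%N = nth 0%N (encode e1) i,
      forall i, (i < size (encode e2))%N ->
        inp (p + size (encode e1) + i)%N = nth 0%N (encode e2) i,
      inp q = 1%N /\
      (p + size (encode (SJoin Sx L1 L2 e1 e2)) = q + 1 + (k * k + (k + k)))%N,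
      forall a b : 'I_k, inp (q + 1 + (a * k + b))%N = ((a, b) \in Sx) &
      (forall a : 'I_k, inp (q + 1 + (k * k + a))%N = L1 a) /\
      (forall a : 'I_k, inp (q + 1 + (k * k + (k + a)))%N = L2 a)].
Proof.
rewrite /=; set E1 := encode e1; set E2 := encode e2.
set SS := [seq nat_of_bool ((i, j) \in Sx) | i <- enum 'I_k, j <- enum 'I_k].
have szS : size SS = (k * k)%N by rewrite size_allpairs !size_enum_ord.
set LL := [seq _ | i <- enum 'I_k]; set RR := [seq val (L2 i) | i <- enum 'I_k].
have szL : size LL = k by rewrite size_map size_enum_ord.
have szR : size RR = k by rewrite size_map size_enum_ord.
rewrite !size_cat /= !size_cat szS szL szR => H.
have H' i : (i < 1 + (k * k + (k + k)))%N ->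
    inp (p + size E1 + size E2 + i)%N = nth 0%N (1%N :: SS ++ LL ++ RR) i.
  move=> ik; rewrite -!addnA H; last by lia.
  by rewrite nth_cat ltnNge leq_addr /= addKn nth_cat ltnNge leq_addr /= addKn.
split=> [i i1|i i2|||].
- by rewrite H ?nth_cat ?i1 //; lia.
- rewrite -addnA H; last by lia.
  by rewrite nth_cat ltnNge leq_addr /= addKn nth_cat i2.
- split; last by lia.
  by rewrite -[X in inp X]addn0 H'.
- move=> a b; have ab : (a * k + b < k * k)%N by have := ltn_ord a; have := ltn_ord b; nia.
  rewrite -addnA H' /=; last by lia.
  rewrite nth_cat szS ab.
  have := @nth_allpairs_grid _ _ (fun i j => nat_of_bool ((i, j) \in Sx)) (enum 'I_k) (enum 'I_k) a b a b.
  by rewrite size_enum_ord !nth_ord_enum => ->.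
split=> a; rewrite -addnA H' /=; try by (have := ltn_ord a; lia).
- rewrite nth_cat szS add0n.
  by rewrite ltnNge leq_addr /= addKn nth_cat szL ltn_ord (nth_map a) ?size_enum_ord // nth_ord_enum.
rewrite nth_cat szS add0n ltnNge leq_addr /= addKn nth_cat szL ltnNge leq_addr /= addKn.
by rewrite (nth_map a) ?size_enum_ord // nth_ord_enum.
Qed.

(** The cost of a join token, the dearer kind, plus a margin for dispatch and loop control. *)
Definition tokcost := (61 * 1000 * (k * k * k))%N.

(* The loop is not over after e, hence the continuation form. *)
Lemma wp_tokloop_expr (sg dg : R) n (e : sexpr k) s h T Q :
  ivar s vk = k -> ivar s vM = (6 * k)%N -> ivar s vn = n ->
  rvar s rsg = sg -> rvar s rdg = dg -> ivar s vsp = h ->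
  (forall i, (i < size (encode e))%N -> iarr s 0 (ivar s vpos + i) = nth 0%N (encode e) i) ->
  (ivar s vtok + ntok e <= 2 * n - 1)%N ->
  (forall s', same tokloop s s' -> ivar s' vtok = (ivar s vtok + ntok e)%N ->
     ivar s' vpos = (ivar s vpos + size (encode e))%N -> ivar s' vsp = h.+1 ->
     lower k h s s' ->
     (exists2 d, ivar s' vcnt = (ivar s vcnt + d)%N &
        represents sg dg (sgraph_of e) (slotM k 1 s' h) (slotM k 2 s' h) d (shift e)) ->
     wp tokloop s' T Q) ->
  wp tokloop s (ntok e * tokcost + T) Q.
Proof.
elim: e s h T Q => [i|Sx L1 L2 e1 IH1 e2 IH2] s h T Q sk sM sn ssg sdg ssp inp tn cont.
  have i0 : iarr s 0 (ivar s vpos) = 0%N by have := inp 0%N isT; rewrite addn0.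
  have i1 : iarr s 0 (ivar s vpos + 1) = i by have := inp 1%N isT.
  apply: (wp_conseq (T := (7 + ((4 + (1000 * (k * k) + 1)).+1 + 4) + T).+1) _ _ (fun=> id)); last first.
    rewrite /tokcost mul1n.
    have k3 : (k * k <= k * k * k)%N by rewrite leq_pmulr.
    have k2 : (0 < k * k)%N by rewrite muln_gt0 k_gt0.
    lia.
  apply: wp_while; first by rewrite /= sn; move: tn => /=; lia.
  apply: wp_seq; apply: wp_if => [_|]; last by rewrite /= i0 eqxx.
  apply: wp_conseq (wp_leafc k_gt0 sk sdg i1) (leqnn _) _ => s1 [ss1 [p1 sp1] low1 A1 T1].
  apply: (@wp_iset _ vtok); apply: cont.
  - apply: (same_trans (s2 := s1)).
      by apply: (@same_mono R leafc) ss1 => // x /= ->; rewrite ?orbT.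
    by split=> // z /=; rewrite !negb_or /upd => /andP[_ /negbTE ->].
  - by rewrite /= /upd /= (same_i ss1).
  - by rewrite /= /upd /= p1.
  - by rewrite /= /upd /= sp1 ssp.
  - by rewrite -ssp.
  exists 0%N; first by rewrite /= /upd /= (same_i ss1) // addn0.
  rewrite -[slotM k 1 _ h]/(slotM k 1 s1 h) -[slotM k 2 _ h]/(slotM k 2 s1 h) -ssp A1 T1.
  exact: represents_leaf.
have [in1 in2 [q1 qsz] inS [inL1 inL2]] := encode_join inp.
rewrite [ntok _]/= in tn *.
apply: (wp_conseq (T := (ntok e1 * tokcost + (ntok e2 * tokcost + (tokcost + T)))%N) _ _ (fun=> id)); last first.
  by rewrite mulSn mulnDl; lia.
apply: (IH1 _ h) => // [|s1 ss1 t1 p1 sp1 low1 [d1 c1 rep1]]; first by lia.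
have s1i x : x \in [:: vk; vn; vM] -> ivar s1 x = ivar s x.
  by rewrite !inE => /or3P[] /eqP ->; rewrite (same_i ss1).
apply: (IH2 _ h.+1) => // [|||||||s2 ss2 t2 p2 sp2 low2 [d2 c2 rep2]].
- by rewrite s1i.
- by rewrite s1i.
- by rewrite s1i.
- by rewrite (same_r ss1).
- by rewrite (same_r ss1).
- by rewrite (same_ia ss1) // p1.
- by rewrite t1; lia.
have ss12 := same_trans ss1 ss2.
have s2k : ivar s2 vk = k by rewrite (same_i ss12).
have s2M : ivar s2 vM = (6 * k)%N by rewrite (same_i ss12).
have s2n : ivar s2 vn = n by rewrite (same_i ss12).
have s2g : rvar s2 rsg = sg by rewrite (same_r ss12).
have s2i : iarr s2 0 = iarr s 0 by rewrite (same_ia ss12).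
rewrite p1 in p2.
apply: (wp_conseq (T := (7 + ((4 + (1 + 60 * 1000 * (k * k * k))).+1 + 4) + T).+1) _ _ (fun=> id)); last first.
  rewrite /tokcost.
  have k2 : (0 < k * k * k)%N by rewrite !muln_gt0 k_gt0.
  lia.
apply: wp_while; first by rewrite /= s2n t2 t1; move: tn; lia.
apply: wp_seq; apply: wp_if => [|_]; first by rewrite /= s2i p2 q1.
(* The second operand was processed at height [h + 1], so the pair of the first one in slot [h] is
   intact. *)
have slot_h i' : (i' == 1)%N || (i' == 2)%N -> slotM k i' s2 h = slotM k i' s1 h.
  move=> i12; apply/matrixP => a b; rewrite !mxE /slot.
  have lx : ((h * k + a) * k + b < h.+1 * k * k)%N.
    by have := ltn_ord a; have := ltn_ord b; nia.
  by have [e1' e2'] := low2 _ lx; case/orP: i12 => /eqP ->.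
rewrite -!slot_h // in rep1.
apply: wp_conseq (wp_joinc k_gt0 s2k s2M sp2 s2g _ _ _ rep1 rep2) (leqnn _) _.
- by move=> a b; rewrite s2i p2 inS.
- by move=> a; rewrite s2i p2 inL1.
- by move=> a; rewrite s2i p2 inL2.
move=> s3 [ss3 [p3 sp3] low3 [d c3 rep3]].
have low x : (x < h * k * k)%N -> rarr s3 1 x = rarr s 1 x /\ rarr s3 2 x = rarr s 2 x.
  move=> lx; have [-> ->] := low3 _ lx.
  have [-> ->] : rarr s2 1 x = rarr s1 1 x /\ rarr s2 2 x = rarr s1 2 x.
    by apply: low2; apply: leq_trans lx _; rewrite !leq_mul2r leqnSn !orbT.
  exact: low1.
apply: (@wp_iset _ vtok); apply: cont.
- apply: same_trans ss12 _; apply: (same_trans (s2 := s3)).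
    by apply: (@same_mono R joinc) ss3 => // x /= ->; rewrite ?orbT.
  by split=> // z /=; rewrite !negb_or /upd => /andP[_ /negbTE ->].
- by rewrite /= /upd /= (same_i ss3) // t2 t1; lia.
- by rewrite qsz /= /upd /= p3 p2.
- by rewrite /= /upd /= sp3.
- exact: low.
exists (d1 + d2 + d)%N; first by rewrite /= /upd /= c3 c2 c1; lia.
exact: rep3.
Qed.

Lemma wp_solvec (sg dg : R) (e : sexpr k) s :
  ivar s vk = k -> ivar s vn = nleaf e -> rvar s rsg = sg -> rvar s rdg = dg ->
  iarr s 0 = nth 0%N (encode e) ->
  wp solvec s (300 * 1000 * (k * k * k * nleaf e)) (fun s' => same solvec s s' /\
    neg_index (@graph_form R k sg dg (sgraph_of e)) (ivar s' vcnt)).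
Proof.
move=> sk sn sg_ dg_ inp; set n := nleaf e.
have n0 : (0 < n)%N := nleaf_gt0 e.
set K := (k * k * k)%N.
have K1 : (k * k <= K)%N by rewrite /K leq_pmulr.
have K0 : (0 < K)%N by rewrite !muln_gt0 k_gt0.
pose T := (4 + (2 + (2 + (2 + (2 + (ntok e * tokcost + 8 + (800 * (k * k)
  + (1000 * (k * k) + (50 * 1000 * K + 20)))))))))%N.
suff H : wp solvec s T (fun s' => neg_index (@graph_form R k sg dg (sgraph_of e)) (ivar s' vcnt)).
  apply: (wp_conseq (wp_same H)) => //.
  have nK : (K <= K * n)%N by rewrite leq_pmulr.
  (* With one more token there would be exactly [2 * n] of them. *)
  have : (ntok e * tokcost + 61 * 1000 * K = 122 * 1000 * (K * n))%N.
    by rewrite /tokcost -/K -mulSnr ntokE -/n; ring.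
  rewrite /T; lia.
rewrite /T => {T}.
apply: wp_seq; apply: (@wp_iset _ vM).
apply: wp_seq; apply: (@wp_iset _ vcnt (IConst 0)).
apply: wp_seq; apply: (@wp_iset _ vpos (IConst 0)).
apply: wp_seq; apply: (@wp_iset _ vsp (IConst 0)).
apply: wp_seq; apply: (@wp_iset _ vtok (IConst 0)).
rewrite [ieval _ _]/= sk; set s0 := set_ivar _ _ _.
apply: wp_seq.
  apply: (wp_tokloop_expr (sg := sg) (dg := dg) (n := n) (h := 0%N)) => //.
  - by move=> i _; rewrite /= inp.
  - by rewrite /= /upd /=; have := ntokE e; rewrite -/n; lia.
  move=> s1 ss1 t1 p1 sp1 _ [c c1 rep1].
  apply: wp_while_stop.
    rewrite /= t1 (same_i ss1) // /= /upd /= sn -leqNgt.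
    by have := ntokE e; rewrite -/n; lia.
  have s1k : ivar s1 vk = k by rewrite (same_i ss1).
  have s1M : ivar s1 vM = (6 * k)%N by rewrite (same_i ss1).
  have s1n : ivar s1 vn = n by rewrite (same_i ss1).
  (* The result sits in slot 0. It is loaded into the first two blocks of a cleared matrix, and this
     time all [6 * k] variables are eliminated. *)
  apply: wp_seq; apply: wp_conseq (wp_clearQ k_gt0 s1k s1M) (leqnn _) _ => s2 [ss2 P2].
  have s2k : ivar s2 vk = k by rewrite (same_i ss2).
  have s2M : ivar s2 vM = (6 * k)%N by rewrite (same_i ss2).
  apply: wp_seq; apply: wp_conseq (wp_loadQ (h0 := 0%N) k_gt0 s2k s2M _ _ _ P2) (leqnn _) _ => //.
  move=> s3 [ss3 [sy3 P3]].
  have s3k : ivar s3 vk = k by rewrite (same_i ss3).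
  have s3M : ivar s3 vM = (6 * k)%N by rewrite (same_i ss3).
  apply: wp_seq.
  apply: wp_conseq (wp_reducec k_gt0 (N := (6 * k)%N) s3M _ _ _ sy3) (leqnn _) _ => //.
    by move=> s' ss'; rewrite /= (same_i ss') // s3k.
  move=> s4 [ss4 [d [c4 red4 sy4 Z4]]].
  have s4k : ivar s4 vk = k by rewrite (same_i ss4).
  have s4n : ivar s4 vn = n by rewrite (same_i ss4) // (same_i ss3) // (same_i ss2).
  have [|N eN negN] := represents_root rep1 _ red4 Z4.
    move=> X; rewrite P3 add0r; apply: eq_bigr => a _; apply: eq_bigr => b _.
    by rewrite !mxE /slot !(same_ra ss2).
  (* By [eN] the number of planes is at most the count, so the truncated subtraction is exact. *)
  apply: (wp_conseq (T := 14) _ _ (fun _ H => H)) => //; apply: (@wp_iset _ vcnt).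
  suff -> : ivar (set_ivar s4 vcnt (ieval s4 (IVar vcnt #-
    (IVar vn #* (IVar vk #- IConst 1) #+ (IVar vn #- IConst 1) #* IVar vk)))) vcnt = N by [].
  rewrite /= /upd /= s4k s4n c4 (same_i ss3) // (same_i ss2) // c1 /= /upd /=.
  by rewrite -shiftE add0n addnC eN addnK.
Qed.

End Solve.

(** * From forms to eigenvalues *)

Section Main.
Variable R : realType.

Lemma neg_index_unique (V : lmodType R) (F : V -> R) N N' :
  neg_index F N -> neg_index F N' -> N = N'.
Proof.
move=> [_ FN maxN] [_ FN' maxN']; apply/eqP.
by rewrite eqn_leq maxN' // maxN.
Qed.

Lemma tr_adjacency (G : sgraph) : (adjacency R G)^T = adjacency R G.
Proof. by apply/matrixP => i j; rewrite !mxE edge_sym. Qed.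

Lemma neg_index_adjacency k (H : lgraph k) (G : sgraph) (s c : R) N :
  generates H G -> neg_index (@graph_form R k s (- (s * c)) H) N ->
  neg_index (fun v : 'rV[R]_#|G| => s * (v *m adjacency R G *m v^T - c *: (v *m v^T)) 0 0) N.
Proof.
case=> f [[g fK gK] fE] negN.
pose t (u : H) : 'I_#|G| := enum_rank (f u).
pose t' (i : 'I_#|G|) : H := g (enum_val i).
have tK : cancel t t' by move=> u; rewrite /t /t' enum_rankK fK.
have t'K : cancel t' t by move=> i; rewrite /t /t' gK enum_valK.
have tbij : bijective t by exists t'.
pose h (v : {ffun H -> R^o}) : 'rV[R]_#|G| := \row_i v (t' i).
pose h' (x : 'rV[R]_#|G|) : {ffun H -> R^o} := [ffun u => x 0 (t u)].
have main x : graph_form s (- (s * c)) (h' x) =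
    s * (x *m adjacency R G *m x^T - c *: (x *m x^T)) 0 0.
  have e1 : (x *m adjacency R G *m x^T) 0 0 =
      \sum_u \sum_w (ledge u w)%:R * h' x u * h' x w.
    rewrite -dotvE dotv_mulmx (reindex t) /=; last exact: onW_bij.
    apply: eq_bigr => u _; rewrite (reindex t) /=; last exact: onW_bij.
    by apply: eq_bigr => w _; rewrite !ffunE mxE !enum_rankK fE.
  have e2 : (x *m x^T) 0 0 = \sum_u h' x u ^+ 2.
    rewrite -dotvE /dotv (reindex t) /=; last exact: onW_bij.
    by apply: eq_bigr => u _; rewrite !ffunE expr2.
  have mxB (A B : 'M[R]_1) : (A - c *: B) 0 0 = A 0 0 - c * B 0 0 by rewrite !mxE.
  rewrite mxB e1 e2 mulrBr !mulr_sumr.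
  rewrite /graph_form; congr (_ + _).
    by apply: eq_bigr => u _; rewrite mulr_sumr; apply: eq_bigr => w _; rewrite !mulrA.
  rewrite -sumrN; apply: eq_bigr => u _; ring.
have hK v : h' (h v) = v by apply/ffunP => u; rewrite ffunE mxE tK.
apply: (@neg_index_equiv _ _ _ _ _ h h') negN.
- by move=> a v w; apply/rowP => i; rewrite !mxE !ffunE.
- by move=> a v w; apply/ffunP => u; rewrite !ffunE !mxE.
- by move=> v; rewrite -main hK.
exact: main.
Qed.

Section Bounds.
Variables (k : nat) (e : sexpr k) (G : sgraph) (ds : seq R).
Hypothesis genG : generates (sgraph_of e) G.
Hypothesis sz : size ds = #|G|.
Hypothesis inert : forall (c : R) (right : bool), exists N,
  neg_index (fun v : 'rV[R]_#|G| => (if right then -1 else 1) *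
    (v *m adjacency R G *m v^T - c *: (v *m v^T)) 0 0) N /\
  nbelow ds (BSide (~~ right) c) = if right then (#|G| - N)%N else N.

Let k_gt0 : (0 < k)%N := sexpr_gt0 e.

Lemma card_generated : #|G| = nleaf e.
Proof.
by case: genG => f [/bij_eq_card <- _]; rewrite card_sgraph_of.
Qed.

(** The membership hypotheses place the endpoint cells outside the footprint of [solvec], so the
    kind can still be read after it. *)
Lemma wp_boundc (s : state R) kv entry out (b : itv_bound R) :
  kv \in [:: 2; 3] -> entry \in [:: 0; 1] -> out \in [:: vlow; 15] ->
  ivar s vk = k -> ivar s vn = #|G| -> iarr s 0 = nth 0%N (encode e) ->
  ivar s kv = bound_kind b -> rvar s entry = bound_value b ->
  wp (boundc kv entry out) s (301 * 1000 * (k * k * k * #|G|))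
    (fun s' => same (boundc kv entry out) s s' /\ ivar s' out = nbelow ds b).
Proof.
move=> kvI rvI outI sk sn inp skv srv.
suff H : wp (boundc kv entry out) s (5 + (5 + (20 + (20 + (300 * 1000 * (k * k * k * #|G|) + 20)))))
    (fun s' => ivar s' out = nbelow ds b).
  apply: wp_conseq (wp_same H) _ _ => //.
  have : (0 < k * k * k * #|G|)%N by rewrite !muln_gt0 k_gt0 card_generated nleaf_gt0.
  lia.
have kvs : ~~ imod solvec kv by move: kvI; rewrite !inE => /orP[] /eqP ->.
have rvs : ~~ rmod (CRSet rsg ROne) entry.
  by move: rvI; rewrite !inE => /orP[] /eqP ->.
have go right c : b = BSide (~~ right) c ->
    wp (boundc kv entry out) s (5 + (5 + (20 + (20 + (300 * 1000 * (k * k * k * #|G|) + 20)))))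
      (fun s' => ivar s' out = nbelow ds b).
  move=> bE; rewrite bE /= in srv; pose sg : R := if right then -1 else 1.
  have kind0 : (ivar s kv == 0%N) = ~~ right by rewrite skv bE; case: (right).
  have kind2 : (ivar s kv == 2%N) = false by rewrite skv bE; case: (right).
  have kind3 : (ivar s kv == 3%N) = false by rewrite skv bE; case: (right).
  apply: (@wp_conseq _ _ _ (3 + (2 + (3 + (2 + ((3 + (2 + 4)).+1
    + (6 + (300 * 1000 * (k * k * k * #|G|) + (3 + (2 + 4)).+1))))).+1)).+1
    _ _ _ _ _ (fun _ H => H)); last by lia.
  apply: wp_if => [|_]; first by rewrite /= kind2.
  apply: wp_if => [|_]; first by rewrite /= kind3.
  have sgE : wp (CIf (BIEq (IVar kv) (IConst 0)) (CRSet rsg ROne) (CRSet rsg rmone)) s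
      (3 + (2 + 4)).+1 (fun s' => rvar s' rsg = sg).
    apply: wp_if; rewrite /= kind0 ?negbK => r; [apply: (@wp_rset _ rsg ROne) | apply: (@wp_rset _ rsg rmone)].
      by rewrite /= /upd /= /sg (negbTE r).
    by rewrite /= /upd /= /sg r sub0r.
  apply: wp_seq; apply: wp_conseq (wp_same sgE) (leqnn _) _ => s1 [ss1 s1g].
  have rvs' : ~~ rmod (CIf (BIEq (IVar kv) (IConst 0)) (CRSet rsg ROne) (CRSet rsg rmone)) entry.
    by rewrite /= orbb.
  apply: wp_seq; apply: (@wp_rset _ rdg).
  rewrite [reval _ _]/= s1g (same_r ss1) // srv sub0r; set s2 := set_rvar _ _ _.
  have s2k : ivar s2 vk = k by rewrite /= (same_i ss1).
  have s2n : ivar s2 vn = nleaf e by rewrite /= (same_i ss1) // sn card_generated.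
  have s2i : iarr s2 0 = nth 0%N (encode e) by rewrite /= (same_ia ss1).
  have := wp_solvec k_gt0 s2k s2n s1g (erefl (rvar s2 rdg)) s2i; rewrite -card_generated => Hs.
  apply: wp_seq; apply: wp_conseq Hs (leqnn _) _ => s3 [ss3 neg3].
  have s3kv : ivar s3 kv = ivar s kv by rewrite (same_i ss3) // /= (same_i ss1).
  have s3n : ivar s3 vn = #|G| by rewrite (same_i ss3) // /= (same_i ss1).
  have [N [negN belowE]] := inert c right.
  (* The computed count and the spectral one are indices of the same form, hence equal. *)
  have cntE : ivar s3 vcnt = N.
    by apply: neg_index_unique negN; apply: neg_index_adjacency genG _.
  apply: wp_if; rewrite /= s3kv kind0 ?negbK => r.
    by apply: (@wp_iset _ out (IVar vcnt)); rewrite /= /upd eqxx bE belowE (negbTE r).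
  apply: (@wp_iset _ out (IVar vn #- IVar vcnt)).
  by rewrite /= /upd eqxx bE belowE r s3n cntE.
case: b skv srv go => [[] c|[]] skv srv go.
- exact: (go false c).
- exact: (go true c).
- apply: (@wp_conseq _ _ _ (3 + (2 + (300 * 1000 * (k * k * k * #|G|) + 30))).+1 _ _ _ _ _ (fun _ H => H)); last by lia.
  apply: wp_if => [_|]; last by rewrite /= skv.
  apply: (@wp_iset _ out (IConst 0)); rewrite /= /upd eqxx /nbelow.
  by apply/esym/eqP; rewrite -leqn0 leqNgt -has_count; apply/hasPn => x _.
apply: (@wp_conseq _ _ _ (3 + (2 + (3 + (2 + (300 * 1000 * (k * k * k * #|G|) + 20))).+1)).+1 _ _ _ _ _ (fun _ H => H)); last by lia.
apply: wp_if => [|_]; first by rewrite /= skv.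
apply: wp_if => [_|]; last by rewrite /= skv.
apply: (@wp_iset _ out (IVar vn)); rewrite /= /upd eqxx /nbelow sn -sz.
by apply/esym/eqP; rewrite -all_count; apply/allP.
Qed.

End Bounds.
End Main.

Theorem corollary1 :
  exists (P : cmd) (C : nat),
    forall (R : realType) (G : sgraph) (n k : nat) (e : sexpr k)
           (I : interval R),
      (0 < #|G|)%N ->
      #|G| = n ->
      is_clique_width G k ->
      generates (sgraph_of e) G ->
      exists (s : state R) (t : nat),
        exec P (input_state n e I) s t /\
        output s = num_eigenvalues_in (adjacency R G) I /\
        (t <= C * (k ^ 3 * n))%N.
Proof.
(* Each endpoint costs at most 301 * 1000 times [k ^ 3 * n]; the rest of the constant covers the
   final subtraction. *)
exists mainc, (700 * 1000)%N => R G n k e [l u] G0 Gn _ genG.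
have [ds [sz numE inert]] := nbelow_inertia (tr_adjacency R G).
set s := input_state n e _.
have k0 := sexpr_gt0 e.
have n0 : (0 < k * k * k * #|G|)%N by rewrite !muln_gt0 k0.
suff [s' [t [ex le out]]] : wp mainc s (700 * 1000 * (k * k * k * #|G|))
    (fun s' => output s' = (nbelow ds u - nbelow ds l)%N).
  exists s', t; split=> //; split; first by rewrite numE count_itv.
  by rewrite !expnS expn0 muln1 (mulnA k k) -Gn.
apply: (@wp_conseq _ mainc s (301 * 1000 * (k * k * k * #|G|) + (301 * 1000 * (k * k * k * #|G|) + 4)) _ _ _ _ _ (fun _ H => H)); last by lia.
apply: wp_seq; apply: wp_conseq (wp_boundc genG sz inert (b := u) _ _ _ _ _ _ _ _) (leqnn _) _ => //.
move=> s1 [ss1 o1].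
apply: wp_seq; apply: wp_conseq (wp_boundc genG sz inert (b := l) _ _ _ _ _ _ _ _) (leqnn _) _ => //.
- by rewrite (same_i ss1).
- by rewrite (same_i ss1).
- by rewrite (same_ia ss1).
- by rewrite (same_i ss1).
- by rewrite (same_r ss1).
move=> s2 [ss2 o2]; apply: (@wp_iset _ 0).
by rewrite /output /= /upd /= o2 (same_i ss2) // o1.
Qed.
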